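(* For every integer $n\ge 1$ there exists an $n$-dimensional Riemannian manifold with density $(M,g,\phi)$ whose $\nabla^\phi$-holonomy group $Hol^\phi$ is $SL_n(\mathbb{R})$. For every pair of non-negative integers $(p,q)$ with $p+q\geq 1$ there exists a $(p+q)$-dimensional Riemannian manifold with density $(M,g,\phi)$ whose $\nabla^\phi$-holonomy group $Hol^\phi$ is $SO^+(p,q)$.
   Context: A Riemannian manifold with density $(M,g,\phi)$ is a smooth connected manifold $M$ with a Riemannian metric $g$ and a smooth function $\phi:M\to\mathbb{R}$. Let $\nabla$ be the Levi-Civita connection of $g$. The weighted connection is the torsion-free affine connection $\nabla^\phi_X Y=\nabla_X Y-d\phi(X)Y-d\phi(Y)X$. For $p\in M$, $Hol^\phi_p$ is the group of all linear maps $T_pM\to T_pM$ obtained by $\nabla^\phi$-parallel translation along piecewise $C^1$ loops based at $p$. Choosing a basis of $T_pM$ identifies $Hol^\phi_p$ with a subgroup of $GL_n(\mathbb{R})$ ($n=\dim M$), well defined up to conjugation and independent of $p$ up to conjugation; ''$Hol^\phi$ is $G$'' means that it equals $G$ for a suitable choice of basis. $SO^+(p,q)$ denotes the identity component of $SO(p,q)$ (with $SO^+(n,0)=SO^+(0,n)=SO(n)$). *)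

(* Defs.v *)
From HB Require Import structures.
From mathcomp Require Import all_boot all_order all_algebra.
From mathcomp Require Import all_classical all_reals all_analysis.
From mathcomp Require Import ring.
Set Implicit Arguments.
Unset Strict Implicit.
Unset Printing Implicit Defensive.
Import Order.TTheory GRing.Theory Num.Theory numFieldNormedType.Exports.
Local Open Scope classical_set_scope.
Local Open Scope ring_scope.

Section Smooth.
Context {R : realType} {n : nat} {W : normedModType R}.

Fixpoint Ck (k : nat) (U : set 'cV[R]_n) (f : 'cV[R]_n -> W) : Prop :=
  match k with
  | 0 => forall x, U x -> {for x, continuous f}
  | k'.+1 => (forall x, U x -> differentiable f x) /\
             (forall v : 'cV[R]_n, Ck k' U (fun x => 'D_v f x))
  end.

(* Meaningful for U open only. *)
Definition smooth (U : set 'cV[R]_n) (f : 'cV[R]_n -> W) : Prop :=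
  forall k, Ck k U f.

End Smooth.

(* A manifold is given by an atlas of charts valued in column vectors; the
   total functions [chart i] and [chart_inv i] carry information only on
   [chart_dom i] and on its image. *)
Record manifold (R : realType) (n : nat) := Manifold {
  carrier :> topologicalType;
  carrier_hausdorff : hausdorff_space carrier;
  carrier_second_countable : @second_countable carrier;
  carrier_nonempty : [set: carrier] !=set0;
  carrier_connected : connected [set: carrier];
  chart_index : Type;
  chart_dom : chart_index -> set carrier;
  chart : chart_index -> carrier -> 'cV[R]_n;
  chart_inv : chart_index -> 'cV[R]_n -> carrier;
  chart_dom_open : forall i, open (chart_dom i);
  chart_cover : forall p, exists i, chart_dom i p;
  chart_img_open : forall i, open (chart i @` chart_dom i);
  chartK : forall i p, chart_dom i p -> chart_inv i (chart i p) = p;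
  chart_continuous :
    forall i p, chart_dom i p -> {for p, continuous (chart i)};
  chart_inv_continuous :
    forall i x, (chart i @` chart_dom i) x -> {for x, continuous (chart_inv i)};
  transition_smooth : forall i j,
    smooth (chart i @` (chart_dom i `&` chart_dom j))
           (chart j \o chart_inv i)
}.

Definition chart_img (R : realType) (n : nat) (M : manifold R n)
  (i : chart_index M) : set 'cV[R]_n := chart i @` chart_dom i.

Definition transition (R : realType) (n : nat) (M : manifold R n)
  (i j : chart_index M) : 'cV[R]_n -> 'cV[R]_n := chart j \o chart_inv i.

Definition inner (R : realType) (n : nat) (G : 'M[R]_n) (u v : 'cV[R]_n) : R :=
  (u^T *m G *m v) 0 0.

(* [metric i x] is the Gram matrix of g in the coordinates of the chart i, at
   the point of coordinates x. *)
Record density_manifold (R : realType) (n : nat) := DensityManifold {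
  dm_manifold :> manifold R n;
  metric : chart_index dm_manifold -> 'cV[R]_n -> 'M[R]_n;
  density : dm_manifold -> R;
  metric_smooth : forall i, smooth (chart_img i) (metric i);
  metric_sym : forall i x, chart_img i x -> (metric i x)^T = metric i x;
  metric_posdef : forall i x, chart_img i x ->
    forall v : 'cV[R]_n, v != 0 -> 0 < inner (metric i x) v v;
  metric_change : forall i j x,
    (chart i @` (chart_dom i `&` chart_dom j)) x ->
    forall u v : 'cV[R]_n, inner (metric i x) u v =
      inner (metric j (transition i j x))
        ('d (transition i j) x u) ('d (transition i j) x v);
  density_smooth : forall i, smooth (chart_img i) (density \o chart_inv i)
}.

Section Connection.
Context {R : realType} {n : nat}.
Implicit Types (G : 'cV[R]_n -> 'M[R]_n) (f : 'cV[R]_n -> R).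
Implicit Types x u v w : 'cV[R]_n.

(* The Koszul formula for constant vector fields: g(nabla_u v, w). *)
Definition christoffel1 G x u v w : R :=
  2^-1 * ('D_u (fun y => inner (G y) v w) x + 'D_v (fun y => inner (G y) u w) x
          - 'D_w (fun y => inner (G y) u v) x).

(* The Christoffel symbols of the Levi-Civita connection, as a vector-valued
   form: [christoffel G x u v] has components Gamma^k_ij u^i v^j. *)
Definition christoffel G x u v : 'cV[R]_n :=
  invmx (G x) *m \col_k christoffel1 G x u v (delta_mx k 0).

(* The same for nabla^phi, f being phi read in coordinates. *)
Definition weighted_christoffel G f x u v : 'cV[R]_n :=
  christoffel G x u v - 'D_u f x *: v - 'D_v f x *: u.

Lemma innerE (A : 'M[R]_n) u v :
  inner A u v = \sum_j \sum_i u i 0 * A i j * v j 0.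
Proof.
rewrite /inner mxE; apply: eq_bigr => j _; rewrite mxE mulr_suml.
by apply: eq_bigr => i _; rewrite mxE.
Qed.

Lemma innerDr (A : 'M[R]_n) u v w :
  inner A u (v + w) = inner A u v + inner A u w.
Proof. by rewrite /inner mulmxDr mxE. Qed.

Lemma innerDl (A : 'M[R]_n) u v w :
  inner A (u + v) w = inner A u w + inner A v w.
Proof. by rewrite /inner linearD /= !mulmxDl mxE. Qed.

Lemma innerZr (A : 'M[R]_n) (a : R) u v : inner A u (a *: v) = a * inner A u v.
Proof. by rewrite /inner -scalemxAr mxE. Qed.

Lemma innerC (A : 'M[R]_n) u v : A^T = A -> inner A u v = inner A v u.
Proof.
by move=> sA; rewrite /inner -[in RHS]sA -[in RHS](trmxK u) -!trmx_mul mulmxA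
  [RHS]mxE.
Qed.

Lemma differentiable_inner G x u v : differentiable G x ->
  differentiable (fun y => inner (G y) u v) x.
Proof.
move=> dG; have -> : (fun y => inner (G y) u v) =
    \sum_j \sum_i (fun y => u i 0 * G y i j * v j 0).
  apply/funext => y; rewrite innerE fct_sumE; apply: eq_bigr => j _.
  by rewrite fct_sumE.
apply: differentiable_sum => j; apply: differentiable_sum => i.
have dc : differentiable (fun y => G y i j) x.
  apply: (differentiable_comp (f := G) (g := fun A : 'M[R]_n => A i j)) => //.
  exact: differentiable_coord.
apply: differentiableM => //; apply: differentiableM => //.
Qed.

Lemma christoffel1_linear G x u v : differentiable G x ->
  linear (christoffel1 G x u v : 'cV[R]_n -> R).
Proof.
move=> dG a w1 w2.
have dI u' v' w' : derivable (fun y => inner (G y) u' v') x w'.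
  exact/diff_derivable/differentiable_inner.
have L u' v' : 'D_v' (fun y => inner (G y) u' (a *: w1 + w2)) x =
   a * 'D_v' (fun y => inner (G y) u' w1) x + 'D_v' (fun y => inner (G y) u' w2) x.
  have -> : (fun y => inner (G y) u' (a *: w1 + w2)) =
     (a *: (fun y => inner (G y) u' w1)) + (fun y => inner (G y) u' w2).
    by apply/funext => y; rewrite innerDr innerZr.
  rewrite deriveD ?deriveZ //; exact: derivableZ.
have L2 : 'D_(a *: w1 + w2) (fun y => inner (G y) u v) x =
   a * 'D_w1 (fun y => inner (G y) u v) x + 'D_w2 (fun y => inner (G y) u v) x.
  by rewrite !deriveE ?linearP //; exact: differentiable_inner.
by rewrite /christoffel1 !L L2 /GRing.scale /=; ring.
Qed.

Lemma christoffelP G x u v w : differentiable G x -> (G x)^T = G x ->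
  G x \in unitmx -> inner (G x) (christoffel G x u v) w = christoffel1 G x u v w.
Proof.
move=> dG sG uG; rewrite innerC // /inner /christoffel mulmxA mulmxK //.
pose hM := GRing.isLinear.Build _ _ _ _ _ (christoffel1_linear u v dG).
pose h : {linear 'cV[R]_n -> R} := HB.pack (christoffel1 G x u v) hM.
have hE w' : christoffel1 G x u v w' = h w' by [].
rewrite mxE hE [in RHS](matrix_sum_delta w) linear_sum; apply: eq_bigr => k _.
by rewrite big_ord1 linearZ !mxE.
Qed.

(* Absence of torsion and, in the next lemma, compatibility with the metric:
   the properties that characterize the Levi-Civita connection. *)
Lemma christoffelC G x u v : (\forall y \near x, (G y)^T = G y) ->
  christoffel G x u v = christoffel G x v u.
Proof.
move=> sG; rewrite /christoffel; congr (_ *m _); apply/colP => k; rewrite !mxE.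
rewrite /christoffel1; congr (_ * (_ - _)); first by rewrite addrC.
by apply: near_eq_derive; near do rewrite innerC //.
Unshelve. all: by end_near. Qed.

Lemma christoffel_metric G x u v w : differentiable G x ->
  (\forall y \near x, (G y)^T = G y) -> G x \in unitmx ->
  'D_u (fun y => inner (G y) v w) x =
  inner (G x) (christoffel G x u v) w + inner (G x) v (christoffel G x u w).
Proof.
move=> dG sG uG; have sGx := nbhs_singleton sG.
rewrite (innerC v) // !christoffelP // /christoffel1.
have -> : 'D_u (fun y => inner (G y) w v) x = 'D_u (fun y => inner (G y) v w) x.
  by apply: near_eq_derive; near do rewrite innerC //.
by field.
Unshelve. all: by end_near. Qed.

End Connection.

Section Holonomy.
Context {R : realType} {n : nat} {M : density_manifold R n}.

Definition local_curve (i : chart_index M) (gamma : R -> M) : R -> 'cV[R]_n :=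
  fun t => chart i (gamma t).

(* Only the restriction of gamma to [0, 1] matters. Off the finite set s the
   curve is C^1; existence of both one-sided limits of the velocity makes it
   C^1 on each closed interval between consecutive break points. *)
Definition piecewise_C1 (gamma : R -> M) : Prop :=
  {within `[0, 1], continuous gamma} /\
  exists s : seq R, forall i : chart_index M,
    [/\ forall t, 0 < t < 1 -> t \notin s -> chart_dom i (gamma t) ->
          derivable (local_curve i gamma) t 1 /\
          {for t, continuous (derive1 (local_curve i gamma))},
        forall t, 0 <= t < 1 -> chart_dom i (gamma t) ->
          cvg (derive1 (local_curve i gamma) @ t^'+) &
        forall t, 0 < t <= 1 -> chart_dom i (gamma t) ->
          cvg (derive1 (local_curve i gamma) @ t^'-)].

(* A vector field along gamma: [V t i] is the component vector of V(t) in the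
   chart i, relevant when gamma(t) lies in its domain. *)
Definition field_along (gamma : R -> M) (V : R -> chart_index M -> 'cV[R]_n) :
    Prop :=
  forall t i j, 0 <= t <= 1 ->
    chart_dom i (gamma t) -> chart_dom j (gamma t) ->
    V t j = 'd (transition i j) (local_curve i gamma t) (V t i).

(* nabla^phi-parallel: V is continuous and V' + Gamma^phi(gamma', V) = 0 except
   at finitely many times. *)
Definition parallel (gamma : R -> M) (V : R -> chart_index M -> 'cV[R]_n) :
    Prop :=
  [/\ field_along gamma V,
      forall i, {within [set t | 0 <= t <= 1 /\ chart_dom i (gamma t)],
                  continuous (fun t => V t i)} &
      exists s : seq R, forall i t,
        0 < t < 1 -> t \notin s -> chart_dom i (gamma t) ->
        is_derive t 1 (fun t' => V t' i)
          (- weighted_christoffel (metric i) (@density _ _ M \o chart_inv i)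
               (local_curve i gamma t) (derive1 (local_curve i gamma) t) (V t i))].

(* The group Hol^phi_p as a set of matrices, in the basis of T_pM whose members
   have the columns of B as component vectors in the chart i at p. *)
Definition holonomy (p : M) (i : chart_index M) (B : 'M[R]_n) : set 'M[R]_n :=
  [set A | exists gamma : R -> M,
    [/\ piecewise_C1 gamma, gamma 0 = p, gamma 1 = p &
        forall v : 'cV[R]_n, exists V : R -> chart_index M -> 'cV[R]_n,
          [/\ parallel gamma V, V 0 i = B *m v & V 1 i = B *m (A *m v)]]].

End Holonomy.

Definition holonomy_is (R : realType) (n : nat) (M : density_manifold R n)
    (G : set 'M[R]_n) : Prop :=
  forall p : M, exists (i : chart_index M) (B : 'M[R]_n),
    [/\ chart_dom i p, B \in unitmx & holonomy p i B = G].

Definition SL (R : realType) (n : nat) : set 'M[R]_n := [set A | \det A = 1].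
Arguments SL : clear implicits.

Definition form_mx (R : realType) (p q : nat) : 'M[R]_(p + q) :=
  block_mx 1%:M 0 0 (- 1%:M).

Definition SO (R : realType) (p q : nat) : set 'M[R]_(p + q) :=
  [set A | A^T *m form_mx R p q *m A = form_mx R p q /\ \det A = 1].
Arguments SO : clear implicits.

Definition SOplus (R : realType) (p q : nat) : set 'M[R]_(p + q) :=
  connected_component (SO R p q) 1%:M.
Arguments SOplus : clear implicits.

(* Main.v *)
Require Import Defs.
From HB Require Import structures.
From mathcomp Require Import all_boot all_order all_algebra.
From mathcomp Require Import all_classical all_reals all_analysis.
From mathcomp Require Import perm ring lra zify.

(** Both families live on the open unit ball of the sup norm of R^n with the flat
metric; all the geometry is in the density.  For the flat metric a field V along
a curve sigma is parallel when V' = dphi(sigma') V + dphi(V) sigma', and the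
rescaled field W = exp(- phi) V then satisfies the rank-one equation
W' = dphi(W) sigma'.  On a loop, V and W have the same holonomy, so it is enough
to study matrices X with X' = sigma' eta X, where eta is the row of partial
derivatives of phi ([parallel_frame]).

Upper bounds.  The trace of sigma' eta is the derivative of phi along sigma, so
by Jacobi's formula det X exp(- phi) is constant ([frame_det]): the holonomy of
any density on the flat ball lies in SL_n.  For phi = 1/2 ln (N + Q(x)), Q being
the form of signature (p, q), the weighted connection is the Levi-Civita
connection of a pseudo-Riemannian metric of constant curvature in Klein's
projective model, whose geodesics are also straight segments; on W the metric is
Q(W) - B(x, W)^2 / (N + Q(x)), where B is the polar form of Q, and it is
parallel ([frame_klein_metric]).  It has an
explicit orthonormal frame that is continuous in x.  Read in this frame, parallel
translation along a loop is a path in SO(p, q) from the identity to the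
holonomy, which is therefore in SO^+(p, q) ([frame_component]).

Lower bounds.  Loops are built as chains of arcs along which the equation is
solved in closed form; the holonomies of chains at the origin form a group, and
conjugation by a chain from the origin carries them to any other point
([chain_holonomy]).

For SL_n take phi(x) = - sum_i ln k(x_i) with k a cubic polynomial that is
critical at 0 and at 1/2.  Around the rectangle with corners 0, a e_i,
a e_i + e_j / 2 and e_j / 2 the changes of scale cancel and what remains is a
transvection ([rectangle_chain]); its coefficient fills an interval when a
varies, and transvections generate SL_n ([SL_generated]).

For SO^+(p, q) go from the origin along a radius, follow an orbit of the group of
rotations (or of boosts) of the coordinate plane (i, j), and come back along a
radius.  Radial translation is the orthonormal frame itself, and by symmetry the
translation along the orbit, read in that frame, turns with constant nonzero
speed ([orbit_frame]); so the whole one-parameter group is reached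
([plane_flow_chain]).  Plane rotations and boosts reduce any matrix preserving Q
to a diagonal matrix of signs ([orthogonal_form_generated]), and the sign of the
determinant of the upper left p x p block, which does not vanish on SO(p, q),
shows that for a matrix in SO^+(p, q) these signs come in pairs within each
block, that is, as products of half-turns ([SOplus_chain]). *)

Set Implicit Arguments.
Unset Strict Implicit.
Unset Printing Implicit Defensive.
Import Order.TTheory GRing.Theory Num.Theory numFieldNormedType.Exports.
Local Open Scope ring_scope.

(** * Transvections generate the special linear group *)

Section Transvections.
Variables (F : fieldType) (n : nat).
Implicit Types A : 'M[F]_n.

Definition transvection (i j : 'I_n) (t : F) : 'M[F]_n := 1%:M + t *: delta_mx i j.

Lemma mul_transvectionE i j t A a b :
  (transvection i j t *m A) a b = A a b + (a == i)%:R * (t * A j b).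
Proof.
rewrite mulmxDl mul1mx !mxE; congr (_ + _).
rewrite (bigD1 j) //= big1 => [|k kj]; last first.
  by rewrite !mxE (negPf kj) andbF mulr0 mul0r.
by rewrite !mxE eqxx andbT addr0; ring.
Qed.

Lemma transvectionK i j t A : i != j ->
  transvection i j (- t) *m (transvection i j t *m A) = A.
Proof.
move=> ij; have ji : (j == i) = false by rewrite eq_sym (negPf ij).
by apply/matrixP => a b; rewrite !mul_transvectionE ji mul0r addr0; ring.
Qed.

Lemma det_transvection i j t A : i != j ->
  \det (transvection i j t *m A) = \det A.
Proof.
move=> ij; rewrite det_mulmx (_ : \det _ = 1) ?mul1r //.
wlog : i j ij / (j < i)%N.
  move=> H; case: (ltngtP j i) => [|lt|/val_inj e]; first exact: H.
    rewrite -det_tr (_ : _^T = transvection j i t); first by apply: H => //; rewrite eq_sym.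
    by rewrite /transvection linearD linearZ /= trmx1 trmx_delta.
  by rewrite e eqxx in ij.
move=> ji; rewrite det_trig.
  apply: big1 => k _; rewrite !mxE eqxx.
  by case: eqP => [->|]; rewrite ?(negPf ij) /= mulr0 addr0.
apply/is_trig_mxP => a b ab; have nab : (a == b) = false by exact: ltn_eqF.
rewrite !mxE nab.
case: (a =P i) => [ai|]; last by rewrite /= mulr0 addr0.
case: (b =P j) => [bj|]; last by rewrite /= mulr0 addr0.
by move: ab; rewrite ai bj ltnNge (ltnW ji).
Qed.

Variable H : 'M[F]_n -> Prop.
Hypothesis H1 : H 1%:M.
Hypothesis HM : forall A B, H A -> H B -> H (A *m B).
Hypothesis HT : forall i j t, i != j -> H (transvection i j t).

Let reduce i j t A : i != j -> H (transvection i j t *m A) -> H A.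
Proof. by move=> ij h; rewrite -(transvectionK t A ij); apply: HM => //; exact: HT. Qed.

Let std A m := forall a b : 'I_n, (b < m)%N -> A a b = (a == b)%:R.

Let std_transvection A (m i j : 'I_n) t : (m <= j)%N -> std A m ->
  std (transvection i j t *m A) m.
Proof.
move=> mj sA a b bm; rewrite mul_transvectionE sA // (sA j) //.
suff -> : (j == b) = false by rewrite !mulr0 addr0.
by apply: gtn_eqF; exact: leq_trans bm mj.
Qed.

(** Gauss elimination by rows, one column after the other: a pivot 1 is produced
    with the help of a nonzero entry lower in the column, or, in the last column,
    is forced by the determinant. *)
Lemma SL_generated A : \det A = 1 -> H A.
Proof.
suff main m : (m <= n)%N -> forall A, \det A = 1 -> std A (n - m)%N -> H A.
  by move=> dA; apply: (main n) => // a b; rewrite subnn.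
elim: m => [|m IHm] mn {}A dA.
  rewrite subn0 => sA; suff -> : A = 1%:M by [].
  by apply/matrixP => a b; rewrite sA // mxE.
have lt_kn : (n - m.+1 < n)%N by rewrite ltn_subrL /= (leq_ltn_trans _ mn).
pose k := Ordinal lt_kn; rewrite -[(n - m.+1)%N]/(val k).
have kS : (n - m = k.+1)%N by rewrite /= subnSK.
(* A unit pivot clears the rest of its column; [s] lists the rows not yet cleared. *)
have clear (s : seq _) : forall A, \det A = 1 -> std A k -> A k k = 1 -> k \notin s ->
    (forall a, a != k -> a \notin s -> A a k = 0) -> H A.
  elim: s => [|i s IHs] B dB sB Bk ks B0.
    apply: (IHm (ltnW mn) _ dB) => a b; rewrite kS ltnS leq_eqVlt.
    move=> /orP[/eqP bk|/sB //]; have {bk}-> : b = k by exact: val_inj.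
    by case: (eqVneq a k) => [->//|ak]; rewrite B0.
  move: ks; rewrite in_cons negb_or => /andP[ki ks].
  have ik : i != k by rewrite eq_sym.
  apply: (@reduce i k (- B i k)) => //; apply: IHs => //.
  - by rewrite det_transvection.
  - exact: std_transvection.
  - by rewrite mul_transvectionE (negPf ki) mul0r addr0.
  move=> a ak as_; rewrite mul_transvectionE Bk mulr1.
  case: (eqVneq a i) => [->|ai]; first by rewrite mul1r subrr.
  by rewrite mul0r addr0 B0 // in_cons negb_or ai.
have {}clear B : \det B = 1 -> std B k -> B k k = 1 -> H B.
  move=> dB sB Bk; apply: (clear (rem k (enum 'I_n))) => //.
    by rewrite mem_rem_uniq ?enum_uniq // inE eqxx.
  by move=> a ak; rewrite mem_rem_uniq ?enum_uniq // inE ak mem_enum.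
have below B (j : 'I_n) : \det B = 1 -> std B k -> (k < j)%N -> B j k != 0 -> H B.
  move=> dB sB kj Bjk; have jk : k != j by rewrite neq_ltn kj.
  apply: (@reduce k j ((1 - B k k) / B j k)) => //.
  apply: clear; first by rewrite det_transvection.
    by apply: std_transvection => //; exact: ltnW.
  by rewrite mul_transvectionE eqxx mul1r divfK // addrC subrK.
move=> sA.
(* Otherwise column [k] would be a combination of the previous ones; [v] is the
   corresponding vector of the kernel. *)
have [j kj Ajk] : exists2 j : 'I_n, (k <= j)%N & A j k != 0.
  apply/exists_inP; apply: contraT; rewrite negb_exists_in => /forall_inP A0.
  pose v : 'cV[F]_n := \col_a (if a == k then 1 else if (a < k)%N then - A a k else 0).
  have uA : A \in unitmx by rewrite unitmxE dA unitr1.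
  have : A *m v = 0.
    apply/colP => a; rewrite !mxE (bigD1 k) //= mxE eqxx mulr1.
    case: (ltnP a k) => ak; last first.
      rewrite (eqP (negbNE (A0 a ak))) add0r big1 // => b bk; rewrite mxE (negPf bk).
      case: ifP => bk'; last by rewrite mulr0.
      have ab : (a == b) = false by apply: gtn_eqF; exact: leq_trans bk' ak.
      by rewrite sA // ab mul0r.
    have nak : a != k by rewrite neq_ltn ak.
    rewrite (bigD1 a) //= big1 => [|b /andP[bk ba]].
      by rewrite mxE (negPf nak) ak (sA a a) // eqxx addr0 mul1r subrr.
    rewrite mxE (negPf bk); case: ifP => bk'; last by rewrite mulr0.
    by rewrite sA // eq_sym (negPf ba) mul0r.
  move/(congr1 (mulmx (invmx A))); rewrite mulKmx // mulmx0 => /colP/(_ k).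
  by rewrite !mxE eqxx => /eqP; rewrite oner_eq0.
move: kj; rewrite leq_eqVlt => /orP[/eqP/val_inj e|kj]; last exact: below kj Ajk.
rewrite -{j}e in Ajk.
have [kn|nk] := ltnP k.+1 n; last first.
  (* [A] is now triangular, so the last pivot is the determinant. *)
  apply: clear => //; rewrite -dA -det_tr det_trig; last first.
    apply/is_trig_mxP => a b ab; have ba : (b == a) = false by exact: gtn_eqF.
    by rewrite mxE sA ?ba //; move: (ltn_ord b) nk ab => /=; lia.
  rewrite (bigD1 k) //= big1 ?mulr1 ?mxE // => a ak; rewrite mxE sA ?eqxx //.
  by move: ak nk (ltn_ord a); rewrite -val_eqE /=; lia.
pose j := Ordinal kn.
have jk : j != k by rewrite -val_eqE /= gtn_eqF.
apply: (@reduce j k ((1 - A j k) / A k k)) => //; apply: (@below _ j).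
- by rewrite det_transvection.
- exact: std_transvection.
- exact: ltnSn.
by rewrite mul_transvectionE eqxx mul1r divfK // addrC subrK oner_eq0.
Qed.

End Transvections.

(** * Plane rotations and boosts in a pseudo-orthogonal group *)

Section PlaneRotations.
Variables (R : rcfType) (n : nat) (J : 'I_n -> R).
Hypothesis JJ : forall i, J i * J i = 1.
Implicit Types A S : 'M[R]_n.

(** The rotation (if [J i = J j]) or boost (if [J i = - J j]) of the plane of the
    coordinates [i] and [j] for the form with diagonal [J]. *)
Definition plane_rot (i j : 'I_n) (c s : R) : 'M[R]_n :=
  1%:M + (c - 1) *: (delta_mx i i + delta_mx j j) + s *: delta_mx j i
  - (J i * J j * s) *: delta_mx i j.

(** The identity [A^T D A = D], where [D] is diagonal with entries [J]. *)
Definition orthogonal_form A := forall a b,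
  \sum_i J i * A i a * A i b = (a == b)%:R * J a.

Lemma sign_cases i : J i = 1 \/ J i = -1.
Proof.
have /eqP := JJ i; rewrite -expr2 sqrf_eq1.
by case/orP=> /eqP ->; [left|right].
Qed.

Lemma mul_deltaE (i j : 'I_n) A a b : (delta_mx i j *m A) a b = (a == i)%:R * A j b.
Proof.
rewrite mxE (bigD1 j) //= big1 => [|k kj]; last first.
  by rewrite !mxE (negPf kj) andbF mul0r.
by rewrite !mxE eqxx andbT addr0.
Qed.

Lemma mul_plane_rotE i j c s A a b : i != j ->
  (plane_rot i j c s *m A) a b =
    if a == i then c * A i b - J i * J j * s * A j b
    else if a == j then s * A i b + c * A j b else A a b.
Proof.
move=> ij; rewrite mulmxBl !mulmxDl mul1mx -!scalemxAl mulmxDl.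
have addE (M N : 'M[R]_n) : (M + N) a b = M a b + N a b by rewrite mxE.
have oppE (M : 'M[R]_n) : (- M) a b = - M a b by rewrite mxE.
have scaleE k (M : 'M[R]_n) : (k *: M) a b = k * M a b by rewrite mxE.
rewrite !(addE, oppE, scaleE) !mul_deltaE.
case: (eqVneq a i) => [->|ai]; first by rewrite (negPf ij) /=; ring.
by case: (eqVneq a j) => [->|aj] /=; ring.
Qed.

(** The condition for [plane_rot] to preserve the form: a circle of parameters if
    [J i = J j], a hyperbola otherwise. *)
Definition rot_param i j (c s : R) := c ^+ 2 + J i * J j * s ^+ 2 = 1.

Lemma plane_rotK i j c s A : i != j -> rot_param i j c s ->
  plane_rot i j c (- s) *m (plane_rot i j c s *m A) = A.
Proof.
move=> ij cs; have ji : j != i by rewrite eq_sym.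
apply/matrixP => a b; rewrite !mul_plane_rotE // !eqxx (negPf ji).
case: (eqVneq a i) => [->|ai].
  rewrite -[RHS]mul1r -cs; ring.
case: (eqVneq a j) => [->|//]; rewrite -[RHS]mul1r -cs; ring.
Qed.

Lemma orthogonal_form_plane_rot i j c s A : i != j -> rot_param i j c s ->
  orthogonal_form A -> orthogonal_form (plane_rot i j c s *m A).
Proof.
move=> ij cs oA a b; rewrite -oA.
have ji : j != i by rewrite eq_sym.
rewrite (bigD1 i) //= (bigD1 j) //= [RHS](bigD1 i) //= [in RHS](bigD1 j) //=.
rewrite !addrA; congr (_ + _).
  rewrite !mul_plane_rotE // !eqxx (negPf ji).
  rewrite -[RHS]mul1r -cs.
  by have [->|->] := sign_cases i; have [->|->] := sign_cases j; ring.
apply: eq_bigr => k /andP[ki kj].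
by rewrite !mul_plane_rotE // (negPf ki) (negPf kj).
Qed.

Variable H : 'M[R]_n -> Prop.
Hypothesis H1 : H 1%:M.
Hypothesis HM : forall A B, H A -> H B -> H (A *m B).
Hypothesis HR : forall i j c s, i != j -> rot_param i j c s ->
  (J i != J j -> 0 < c) -> H (plane_rot i j c s).

Let good A := exists g (d : 'rV[R]_n),
  [/\ H g, forall i, d 0 i ^+ 2 = 1 & A = g *m diag_mx d].

Let good_rot i j c s A : i != j -> rot_param i j c s -> (J i != J j -> 0 < c) ->
  good (plane_rot i j c s *m A) -> good A.
Proof.
move=> ij cs c0 [g [d [Hg d1 E]]].
have cs' : rot_param i j c (- s) by rewrite /rot_param sqrrN.
exists (plane_rot i j c (- s) *m g), d; split=> //.
  by apply: HM => //; exact: HR.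
by rewrite -mulmxA -E plane_rotK.
Qed.

Let offdiag A m := forall a b : 'I_n, (b < m)%N -> a != b -> A a b = 0.

Let offdiag_col A m (a b : 'I_n) : offdiag A m -> orthogonal_form A -> (a < m)%N ->
  J a * A a a * A a b = (a == b)%:R * J a.
Proof.
move=> sA oA am; rewrite -oA (bigD1 a) //= big1 ?addr0 // => i ia.
by rewrite (sA i a) // mulr0 mul0r.
Qed.

Let offdiag_diag A m (a : 'I_n) : offdiag A m -> orthogonal_form A -> (a < m)%N ->
  A a a ^+ 2 = 1.
Proof.
move=> sA oA am; have := offdiag_col a sA oA am; rewrite eqxx mul1r.
by move/(congr1 ( *%R (J a))); rewrite !mulrA JJ mul1r expr2.
Qed.

Let offdiag_rot A m (i j : 'I_n) c s : (m <= i)%N -> (m <= j)%N -> i != j ->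
  offdiag A m -> offdiag (plane_rot i j c s *m A) m.
Proof.
move=> mi mj ij sA a b bm ab; rewrite mul_plane_rotE //.
have bi : i != b by rewrite -val_eqE neq_ltn (leq_trans bm mi) orbT.
have bj : j != b by rewrite -val_eqE neq_ltn (leq_trans bm mj) orbT.
by rewrite (sA i b) // (sA j b) // (sA a b) // !mulr0 subr0 addr0 !if_same.
Qed.

(** Elimination below the diagonal, one column after the other.  In column [k] the
    entries whose sign in the form is that of [k] are first absorbed into the
    pivot by rotations; orthogonality then makes the pivot larger in absolute
    value than each remaining entry, which can be absorbed by a boost.  The
    entries above the diagonal vanish by orthogonality to the previous columns. *)
Lemma orthogonal_form_generated A : orthogonal_form A -> good A.
Proof.
suff main m : (m <= n)%N -> forall A, orthogonal_form A -> offdiag A (n - m)%N -> good A.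
  by move=> oA; apply: (main n) => // a b; rewrite subnn.
elim: m => [|m IHm] mn {}A oA.
  rewrite subn0 => sA; exists 1%:M, (\row_i A i i); split=> // [i|].
    by rewrite mxE; exact: offdiag_diag sA oA _.
  rewrite mul1mx; apply/matrixP => a b; rewrite !mxE.
  by case: (eqVneq a b) => [->|ab] //; rewrite sA.
have lt_kn : (n - m.+1 < n)%N by rewrite ltn_subrL /= (leq_ltn_trans _ mn).
pose k := Ordinal lt_kn; rewrite -[(n - m.+1)%N]/(val k).
have kS : (n - m = k.+1)%N by rewrite /= subnSK.
have above B (a : 'I_n) : orthogonal_form B -> offdiag B k -> (a < k)%N -> B a k = 0.
  move=> oB sB ak; have := offdiag_col k sB oB ak.
  have -> : (a == k) = false by exact: ltn_eqF.
  have := offdiag_diag sB oB ak; have := JJ a.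
  move=> Ja Ba /eqP; rewrite mul0r mulf_eq0 => /orP[|/eqP //].
  rewrite mulf_eq0 => /orP[] /eqP E; [move: Ja|move: Ba]; rewrite E.
    by rewrite mul0r => /eqP; rewrite eq_sym oner_eq0.
  by rewrite expr0n => /eqP; rewrite eq_sym oner_eq0.
have norm_k B : orthogonal_form B -> offdiag B k ->
    B k k ^+ 2 + \sum_(i : 'I_n | (k < i)%N) J k * J i * B i k ^+ 2 = 1.
  move=> oB sB; have := oB k k; rewrite eqxx mul1r.
  rewrite (bigID (fun i : 'I_n => (k < i)%N)) /= addrC (bigD1 k) ?ltnn //=.
  rewrite [X in _ + X + _]big1 ?addr0 => [|i /andP[ki ik]]; last first.
    rewrite above ?mulr0 // ltn_neqAle leqNgt ki andbT.
    by rewrite val_eqE.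
  move=> /(congr1 ( *%R (J k))); rewrite mulrDr !mulrA JJ mul1r -expr2 mulr_sumr => <-.
  by congr (_ + _); apply: eq_bigr => i _; rewrite expr2 !mulrA.
(* The indices of the sign opposite to that of [k]: boosts, once the others are
   cleared. *)
have pass2 (s : seq 'I_n) : forall B, orthogonal_form B -> offdiag B k ->
    (forall j : 'I_n, (k < j)%N -> J j = J k -> B j k = 0) ->
    (forall j : 'I_n, (k < j)%N -> j \notin s -> B j k = 0) -> good B.
  elim: s => [|j s IHs] B oB sB B1 B2.
    apply: (IHm (ltnW mn) _ oB) => a b; rewrite kS ltnS leq_eqVlt.
    move=> /orP[/eqP bk|bk]; last exact: sB.
    have {bk}-> : b = k by exact: val_inj.
    rewrite neq_ltn => /orP[ak|ka]; first exact: above.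
    exact: B2.
  case: (boolP ((k < j)%N && (J j != J k))) => [/andP[kj Jjk]|jk]; last first.
    apply: IHs => // i ki is_; case: (eqVneq i j) => [ij|ij].
      by move: jk; rewrite -ij ki negbK => /eqP /B1; apply.
    by apply: B2; rewrite // in_cons negb_or ij.
  have nkj : k != j by rewrite -val_eqE neq_ltn kj.
  have Jkj : J k * J j = -1.
    have := Jjk; have [->|->] := sign_cases k; have [->|->] := sign_cases j; rewrite ?eqxx // =>
      _; ring.
  (* This inequality makes the boost possible: the column has square [J k]. *)
  have Bj : B j k ^+ 2 + 1 <= B k k ^+ 2.
    have := norm_k B oB sB; rewrite (bigD1 j) //= Jkj.
    rewrite (_ : \sum_(i | _) _ = - \sum_(i : 'I_n | (k < i)%N && (i != j)) B i k ^+ 2).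
      have : 0 <= \sum_(i : 'I_n | (k < i)%N && (i != j)) B i k ^+ 2.
        by apply: sumr_ge0 => i _; exact: sqr_ge0.
      lra.
    rewrite -sumrN; apply: eq_bigr => i /andP[ki ij].
    case: (eqVneq (J i) (J k)) => [/(B1 _ ki) ->|Jik]; first by rewrite expr0n /= mulr0 oppr0.
    rewrite -mulN1r; congr (_ * _).
    have := Jik; have [->|->] := sign_cases k; have [->|->] := sign_cases i; rewrite ?eqxx // =>
      _; ring.
  have Bk0 : B k k != 0.
    apply/eqP => B0; move: Bj; rewrite B0 expr0n /=; have := sqr_ge0 (B j k); lra.
  pose r := Num.sqrt (B k k ^+ 2 - B j k ^+ 2).
  have r2 : r ^+ 2 = B k k ^+ 2 - B j k ^+ 2 by rewrite sqr_sqrtr; lra.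
  have r0 : 0 < r by rewrite sqrtr_gt0; lra.
  pose c := `|B k k| / r; pose t := - (B j k * c / B k k).
  have cs : rot_param k j c t.
    rewrite /rot_param Jkj /t /c sqrrN !exprMn !exprVn real_normK ?num_real // r2.
    have : B k k ^+ 2 - B j k ^+ 2 != 0 by rewrite gt_eqF //; lra.
    by move=> H0; field; rewrite Bk0.
  apply: (good_rot nkj cs) => [_|]; first by rewrite divr_gt0 // normr_gt0.
  apply: IHs.
  - exact: orthogonal_form_plane_rot.
  - by apply: offdiag_rot => //; exact: ltnW.
  - move=> i ki Jik; rewrite mul_plane_rotE // !ifF ?B1 //.
      by apply/eqP => ij; move: Jjk; rewrite -ij Jik eqxx.
    by apply: gtn_eqF.
  move=> i ki is_; rewrite mul_plane_rotE // ifF; last exact: gtn_eqF.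
  case: (eqVneq i j) => [ij|ij]; first by rewrite /t; field.
  by apply: B2; rewrite // in_cons negb_or ij.
have pass1 (s : seq 'I_n) : forall B, orthogonal_form B -> offdiag B k ->
    (forall j : 'I_n, (k < j)%N -> J j = J k -> j \notin s -> B j k = 0) -> good B.
  elim: s => [|j s IHs] B oB sB B1.
    apply: (pass2 (enum 'I_n)) => // i ki; first by move=> Ji; exact: B1.
    by rewrite mem_enum.
  case: (boolP [&& (k < j)%N, J j == J k & B j k != 0]) => [/and3P[kj /eqP Jjk Bj]|jk];
      last first.
    apply: IHs => // i ki Ji is_; case: (eqVneq i j) => [ij|ij].
      by move: jk; rewrite -ij ki Ji eqxx negbK => /eqP.
    by apply: B1; rewrite // in_cons negb_or ij.
  have nkj : k != j by rewrite -val_eqE neq_ltn kj.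
  have Jkj : J k * J j = 1 by rewrite Jjk JJ.
  have rp : 0 < B k k ^+ 2 + B j k ^+ 2.
    by rewrite ltr_wpDl ?sqr_ge0 // lt0r sqr_ge0 sqrf_eq0 Bj.
  pose r := Num.sqrt (B k k ^+ 2 + B j k ^+ 2).
  have r2 : r ^+ 2 = B k k ^+ 2 + B j k ^+ 2 by rewrite sqr_sqrtr // ltW.
  have r0 : 0 < r by rewrite sqrtr_gt0.
  pose c := B k k / r; pose t := - (B j k / r).
  have cs : rot_param k j c t.
    rewrite /rot_param Jkj /t /c sqrrN !exprMn !exprVn r2.
    by field; rewrite gt_eqF.
  apply: (good_rot nkj cs) => [|]; first by rewrite Jjk eqxx.
  apply: IHs.
  - exact: orthogonal_form_plane_rot.
  - by apply: offdiag_rot => //; exact: ltnW.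
  move=> i ki Ji is_; rewrite mul_plane_rotE // ifF; last exact: gtn_eqF.
  case: (eqVneq i j) => [ij|ij]; first by rewrite /t /c; ring.
  by apply: B1; rewrite // in_cons negb_or ij.
move=> sA; apply: (pass1 (enum 'I_n)) => // i ki Ji.
by rewrite mem_enum.
Qed.

(** Half-turns flip signs two at a time within a block of constant [J], and the
    product condition makes the number of signs in each block even. *)
Lemma diag_signs_generated (d : 'rV[R]_n) : (forall i, d 0 i ^+ 2 = 1) ->
  (forall x, \prod_(i | J i == x) d 0 i = 1) -> H (diag_mx d).
Proof.
have [m] := ubnP #|[set i | d 0 i != 1]|.
elim: m d => // m IHm d; rewrite ltnS => dm d1 dJ.
case: (pickP (fun i => d 0 i != 1)) => [i di|d0]; last first.
  suff -> : diag_mx d = 1%:M by [].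
  by apply/matrixP => a b; rewrite !mxE; have /negbFE/eqP -> := d0 a.
have dN a : d 0 a != 1 -> d 0 a = -1.
  have /eqP := d1 a; rewrite sqrf_eq1 => /orP[/eqP ->|/eqP //].
  by rewrite eqxx.
have [j /andP[ij Jij] dj] : exists2 j, (j != i) && (J j == J i) & d 0 j != 1.
  apply/exists_inP; apply: contraT; rewrite negb_exists_in => /forall_inP all1.
  have := dJ (J i); rewrite (bigD1 i) //= big1 => [|j /andP[Jj ji]].
    by rewrite dN // mulr1 => E; suff : False by []; lra.
  by have := all1 j; rewrite ji Jj => /(_ isT) /negbNE/eqP.
have nij : i != j by rewrite eq_sym.
have cs : rot_param i j (-1) 0 by rewrite /rot_param sqrrN expr1n expr0n /= mulr0 addr0.
pose e : 'rV[R]_n := \row_a (if (a == i) || (a == j) then 1 else d 0 a).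
have -> : diag_mx d = plane_rot i j (-1) 0 *m diag_mx e.
  apply/matrixP => a b; rewrite mul_plane_rotE // !mxE.
  case: (eqVneq a i) => [->|ai].
    by rewrite ?eqxx ?orbT /= dN // mulr0 mul0r subr0; case: (i == b) => /=; ring.
  case: (eqVneq a j) => [->|aj] //.
  by rewrite ?eqxx ?orbT /= (dN j) // mul0r add0r; case: (j == b) => /=; ring.
apply: HM; first by apply: HR => //; rewrite (eqP Jij) eqxx.
apply: IHm.
- apply: leq_trans dm; apply: proper_card; apply/properP; split.
    by apply/fintype.subsetP => a; rewrite !inE mxE; case: ifP => //; rewrite eqxx.
  by exists i; rewrite !inE // mxE eqxx /= negbK.
- by move=> a; rewrite mxE; case: ifP => // _; rewrite expr1n.
move=> x; case: (eqVneq (J i) x) => [xi|xi]; last first.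
  rewrite -[RHS](dJ x); apply: eq_bigr => a /eqP ax; rewrite mxE ifF //.
  apply/negP => /orP[] /eqP E; move: xi; first by rewrite -E ax eqxx.
  by rewrite -(eqP Jij) -E ax eqxx.
have := dJ x; rewrite (bigD1 i) ?xi //= (bigD1 j) /=; last by rewrite (eqP Jij) xi eqxx ij.
rewrite (dN i di) (dN j dj) mulrA mulrNN !mul1r => prodE; rewrite -[RHS]prodE.
rewrite (bigD1 i) ?xi //= (bigD1 j) /=; last by rewrite (eqP Jij) xi eqxx ij.
rewrite !mxE !eqxx orbT /= !mul1r; apply: eq_bigr => a /andP[/andP[_ ai] aj].
by rewrite mxE (negPf ai) (negPf aj).
Qed.

End PlaneRotations.

Local Open Scope classical_set_scope.

(** * Smooth functions on an open set *)

Lemma near_eq_is_diff (R : numFieldType) (V W : normedModType R)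
    (f g df : V -> W) (x : V) :
  (\near x, f x = g x) -> is_diff x f df -> is_diff x g df.
Proof.
move=> fg [dfx <-].
have cdf := diff_continuous dfx.
have gE : g \o shift x = cst (g x) + 'd f x +o_ 0 id.
  apply/eqaddoP => _/posnumP[e].
  have /eqaddoP/(_ e%:num [gt0 of e%:num]) := diff_locally dfx.
  have gx : f x = g x by exact: nbhs_singleton fg.
  rewrite (near_shift 0 x) subr0 in fg.
  apply: filter_app; apply: filterS fg => h /= fgh.
  by rewrite -![(_ + _ : _ -> _) _]/(_ + _) -![(- _ : _ -> _) _]/(- _) /= /cst
    -fgh -gx.
have dE := diff_unique cdf gE.
split; last by rewrite dE.
by apply/diff_locallyP; rewrite dE; split.
Qed.

Section SmoothClosure.
Context {R : realType} {n : nat}.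
Local Notation E := 'cV[R]_n.
Variable U : set E.
Hypothesis oU : open U.

Section Vector.
Context {W : normedModType R}.
Implicit Types f g : E -> W.

(** [Ck] asks for derivatives as total functions, while the formulas for them hold
    on [U] only; this lemma lets them replace each other. *)
Lemma Ck_ext k f g : {in U, f =1 g} -> Ck k U f -> Ck k U g.
Proof.
have nearU h1 h2 x : {in U, h1 =1 h2 :> (E -> W)} -> U x -> \near x, h1 x = h2 x.
  move=> e Ux; have := open_nbhs_nbhs (conj oU Ux).
  by apply: filterS => y Uy; apply: e; rewrite inE.
elim: k f g => [|k IH] f g e /=.
  move=> cf x Ux; have gf := nearU _ _ _ e Ux.
  rewrite /prop_for /continuous_at -(nbhs_singleton gf).
  apply: cvg_trans (cf x Ux).
  exact: (@near_eq_cvg _ _ (nbhs x) _ f g).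
move=> [df Df]; split.
  move=> x Ux; have /differentiableP H := df x Ux.
  by have [] := near_eq_is_diff (nearU _ _ _ e Ux) H.
move=> v; apply: IH (Df v) => x; rewrite inE => Ux.
exact: near_eq_derive (nearU _ _ _ e Ux).
Qed.

Lemma CkS k f : Ck k.+1 U f -> Ck k U f.
Proof.
elim: k f => [|k IH] f; last first.
  by move=> [df Df]; split=> // v; exact: IH.
by move=> [df _] x Ux; exact: differentiable_continuous (df x Ux).
Qed.

Lemma Ck_cst k (w : W) : Ck k U (cst w).
Proof.
elim: k w => [|k IH] w /=; first by move=> x _; exact: cst_continuous.
split=> [x _|v]; first exact: differentiable_cst.
apply: Ck_ext (IH 0) => x _.
by rewrite derive_cst.
Qed.

Lemma Ck_linear k (h : {linear E -> W}) : continuous h -> Ck k U h.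
Proof.
move=> ch; case: k => [|k] /=; first by move=> x _; exact: ch.
have dh x : differentiable h x by exact: linear_differentiable.
split=> [//|v]; apply: Ck_ext (Ck_cst k (h v)) => x _.
by rewrite deriveE // diff_lin.
Qed.

Lemma CkD k f g : Ck k U f -> Ck k U g -> Ck k U (f + g).
Proof.
elim: k f g => [|k IH] f g /=.
  by move=> cf cg x Ux; exact: cvgD (cf x Ux) (cg x Ux).
move=> [df Df] [dg Dg]; split=> [x Ux|v].
  by apply: differentiableD; [exact: df|exact: dg].
apply: Ck_ext (IH _ _ (Df v) (Dg v)) => x; rewrite inE => Ux.
by rewrite deriveD //; apply/diff_derivable; [exact: df|exact: dg].
Qed.

End Vector.

Implicit Types f g : E -> R.

Lemma CkM k f g : Ck k U f -> Ck k U g -> Ck k U (f * g).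
Proof.
elim: k f g => [|k IH] f g /=.
  by move=> cf cg x Ux; exact: cvgM (cf x Ux) (cg x Ux).
move=> [df Df] [dg Dg]; split=> [x Ux|v].
  by apply: differentiableM; [exact: df|exact: dg].
have /CkS cf : Ck k.+1 U f by [].
have /CkS cg : Ck k.+1 U g by [].
apply: Ck_ext (CkD (IH _ _ cf (Dg v)) (IH _ _ cg (Df v))) => x; rewrite inE => Ux.
by rewrite deriveM //; apply/diff_derivable; [exact: df|exact: dg].
Qed.

Lemma Ck_comp_inv k f : (forall x, U x -> f x != 0) ->
  Ck k U f -> Ck k U (fun x => (f x)^-1).
Proof.
move=> f0; elim: k => [|k IH] cf.
  by move=> x Ux; exact: cvgV (f0 x Ux) (cf x Ux).
have ci := IH (CkS cf); case: (cf) => df Df; split=> [x Ux|v].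
  by apply: differentiableV; [exact: df|exact: f0].
have H := CkM (Ck_cst k (-1 : R)) (CkM (CkM ci ci) (Df v)).
apply: Ck_ext H => x.
rewrite inE => Ux.
rewrite deriveV ?f0 //; last exact/diff_derivable/df.
rewrite -![(_ * _ : _ -> _) _]/(_ * _) /cst /GRing.scale /=.
by rewrite expr2 invfM; ring.
Qed.

Lemma Ck_comp_ln k f : (forall x, U x -> 0 < f x) ->
  Ck k U f -> Ck k U (fun x => ln (f x)).
Proof.
move=> f0; case: k => [|k] cf.
  by move=> x Ux; apply: continuous_comp (cf x Ux) _; exact/continuous_ln/f0.
have f0' x : U x -> f x != 0 by move=> /f0/lt0r_neq0.
have ci := Ck_comp_inv f0' (CkS cf); case: (cf) => df Df.
have dl (y : R) : 0 < y -> is_derive y 1 (@ln R) y^-1 by exact: is_derive1_ln.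
have dl' (y : R) : 0 < y -> differentiable (@ln R) y.
  by move=> /dl[] /derivable1_diffP.
have dc x : U x -> differentiable (fun x => ln (f x)) x.
  move=> Ux; apply: (differentiable_comp (f := f) (g := @ln R)); first exact: df.
  exact/dl'/f0.
split=> [//|v].
apply: Ck_ext (CkM ci (Df v)) => x; rewrite inE => Ux.
rewrite deriveE; last exact: dc.
rewrite (diff_comp (df x Ux) (dl' _ (f0 x Ux))).
rewrite /= -(deriveE _ (df x Ux)).
have [dl1 dl2] := dl _ (f0 _ Ux).
by rewrite deriv1E // derive1E dl2 /GRing.scale /= mulrC.
Qed.

End SmoothClosure.

(** * Calculus of curves of matrices *)

(** The fields and frames below are differentiable off finitely many times only;
    continuity carries the constancy across these times. *)
Lemma is_cst_off_finite (R : realType) (f : R -> R) (s : seq R) (a b : R) :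
  a <= b -> {within `[a, b], continuous f} ->
  (forall t, a < t < b -> t \notin s -> is_derive t 1 f 0) -> f a = f b.
Proof.
elim: s a b => [|x s IH] a b ab cf df.
  have [ba|{}ab] := leP b a; first by congr f; apply: le_anti; rewrite ab ba.
  have [|c _] := @MVT R f (cst 0) a b ab _ cf.
    by move=> t; rewrite in_itv /= => tab; exact: df.
  by rewrite /cst mul0r => /eqP; rewrite subr_eq0 => /eqP ->.
case: (boolP (a < x < b)) => [/andP[ax xb]|xab].
  have E1 : f a = f x.
    apply: IH (ltW ax) _ _.
      by apply: continuous_subspaceW cf => t /=; rewrite !in_itv /=; lra.
    move=> t tax ts; apply: df; first by lra.
    by rewrite in_cons negb_or ts andbT; apply/eqP => E; move: tax; rewrite E; lra.
  rewrite E1; apply: IH (ltW xb) _ _.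
    by apply: continuous_subspaceW cf => t /=; rewrite !in_itv /=; lra.
  move=> t tax ts; apply: df; first by lra.
  by rewrite in_cons negb_or ts andbT; apply/eqP => E; move: tax; rewrite E; lra.
apply: IH ab cf _ => t tab ts; apply: df => //.
rewrite in_cons negb_or ts andbT; apply: contra xab => /eqP <-.
exact: tab.
Qed.

Section MatrixLimits.
Context {R : realType} {T : Type} {F : set_system T} {FF : Filter F}.

Lemma cvg_mx m n (f : T -> 'M[R]_(m, n)) (l : 'M[R]_(m, n)) :
  (forall i j, f x i j @[x --> F] --> l i j) -> f x @[x --> F] --> l.
Proof.
move=> fl A [P lP PA]; rewrite /= /nbhs /=.
apply: (@filterS _ F _ (fun x => forall i j, P i j (f x i j))).
  by move=> x Px; exact: PA.
by apply: filter_forall => i; apply: filter_forall => j; exact: (fl i j _ (lP i j)).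
Qed.

Lemma cvg_coord m n (f : T -> 'M[R]_(m, n)) (l : 'M[R]_(m, n)) i j :
  f x @[x --> F] --> l -> f x i j @[x --> F] --> l i j.
Proof.
move=> fl; have := @coord_continuous R m n i j l.
by move=> /(cvg_comp f (fun M : 'M[R]_(m, n) => M i j) fl).
Qed.

Lemma cvg_sumf (I : Type) (r : seq I) (P : pred I) (f : I -> T -> R) (l : I -> R) :
  (forall i, P i -> f i x @[x --> F] --> l i) ->
  (\sum_(i <- r | P i) f i x) @[x --> F] --> \sum_(i <- r | P i) l i.
Proof.
move=> fl; elim: r => [|i r IH].
  by under eq_cvg do rewrite big_nil; rewrite big_nil; exact: cvg_cst.
under eq_cvg do rewrite big_cons; rewrite big_cons.
by case: ifP => // Pi; apply: cvgD (fl i Pi) IH.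
Qed.

Lemma cvg_prodf (I : Type) (r : seq I) (P : pred I) (f : I -> T -> R) (l : I -> R) :
  (forall i, P i -> f i x @[x --> F] --> l i) ->
  (\prod_(i <- r | P i) f i x) @[x --> F] --> \prod_(i <- r | P i) l i.
Proof.
move=> fl; elim: r => [|i r IH].
  by under eq_cvg do rewrite big_nil; rewrite big_nil; exact: cvg_cst.
under eq_cvg do rewrite big_cons; rewrite big_cons.
by case: ifP => // Pi; apply: cvgM (fl i Pi) IH.
Qed.

Lemma cvg_mulmx m n p (f : T -> 'M[R]_(m, n)) (g : T -> 'M[R]_(n, p))
    (a : 'M[R]_(m, n)) (b : 'M[R]_(n, p)) :
  f x @[x --> F] --> a -> g x @[x --> F] --> b ->
  f x *m g x @[x --> F] --> a *m b.
Proof.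
move=> fa gb; apply: cvg_mx => i j; rewrite mxE; under eq_cvg do rewrite mxE.
by apply: cvg_sumf => k _; apply: cvgM; exact: cvg_coord.
Qed.

Lemma cvg_det n (f : T -> 'M[R]_n) (a : 'M[R]_n) :
  f x @[x --> F] --> a -> \det (f x) @[x --> F] --> \det a.
Proof.
move=> fa; rewrite /determinant; apply: cvg_sumf => s _.
by apply: cvgM; [exact: cvg_cst|apply: cvg_prodf => i _; exact: cvg_coord].
Qed.

End MatrixLimits.

(** The rules of differentiation along the real line, for functions written as
    explicit abstractions. *)
Section Derivation.
Context {R : realType}.
Implicit Types (f g : R -> R) (t : R).

Lemma der_ext (V : normedModType R) (f g : R -> V) t df dg :
  is_derive t 1 f df -> f =1 g -> df = dg -> is_derive t 1 g dg.
Proof. by move=> H /funext <- <-. Qed.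

Lemma derM f g t df dg : is_derive t 1 f df -> is_derive t 1 g dg ->
  is_derive t 1 (fun s => f s * g s) (df * g t + f t * dg).
Proof.
move=> Hf Hg; apply: der_ext (is_deriveM Hf Hg) _ _ => //.
by rewrite /GRing.scale /= addrC mulrC.
Qed.

Lemma derD f g t df dg : is_derive t 1 f df -> is_derive t 1 g dg ->
  is_derive t 1 (fun s => f s + g s) (df + dg).
Proof. by move=> Hf Hg; apply: der_ext (is_deriveD Hf Hg) _ _. Qed.

Lemma derN f t df : is_derive t 1 f df -> is_derive t 1 (fun s => - f s) (- df).
Proof. by move=> Hf; apply: der_ext (is_deriveN Hf) _ _. Qed.

Lemma derC (c : R) t : is_derive t 1 (fun=> c) 0.
Proof. exact: is_derive_cst. Qed.

Lemma derI t : is_derive t 1 (fun s : R => s) 1.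
Proof. exact: is_derive_id. Qed.

Lemma derV f t df : f t != 0 -> is_derive t 1 f df ->
  is_derive t 1 (fun s => (f s)^-1) (- df / f t ^+ 2).
Proof.
move=> f0 Hf; apply: der_ext (is_deriveV f0 Hf) _ _ => //.
by rewrite /GRing.scale /= mulrC mulrN mulNr mulrC.
Qed.

Lemma derF (g f : R -> R) t a df : is_derive (f t) 1 g a -> is_derive t 1 f df ->
  is_derive t 1 (fun s => g (f s)) (a * df).
Proof. by move=> Hg Hf; exact: is_derive1_comp. Qed.

Lemma der_sum (I : Type) (r : seq I) (P : pred I) (f : I -> R -> R) t
    (df : I -> R) : (forall i, P i -> is_derive t 1 (f i) (df i)) ->
  is_derive t 1 (fun s => \sum_(i <- r | P i) f i s) (\sum_(i <- r | P i) df i).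
Proof.
move=> H; elim: r => [|i r IH].
  by rewrite big_nil; apply: der_ext (derC 0 t) _ _ => // s; rewrite big_nil.
case: (boolP (P i)) => Pi; last first.
  by rewrite big_cons (negPf Pi); apply: der_ext IH _ _ => // s;
    rewrite big_cons (negPf Pi).
rewrite big_cons Pi; apply: der_ext (derD (H i Pi) IH) _ _ => // s.
by rewrite big_cons Pi.
Qed.

Lemma der_prod n (f : 'I_n -> R -> R) t (df : 'I_n -> R) :
  (forall i, is_derive t 1 (f i) (df i)) ->
  is_derive t 1 (fun s => \prod_i f i s)
    (\sum_i \prod_j (if j == i then df j else f j t)).
Proof.
elim: n f df => [|n IH] f df H.
  rewrite big_ord0; apply: der_ext (derC 1 t) _ _ => // s.
  by rewrite big_ord0.
have H1 := derM (H ord0) (IH _ _ (fun i => H (lift ord0 i))).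
apply: der_ext H1 _ _; first by move=> s; rewrite big_ord_recl.
rewrite big_ord_recl big_ord_recl /=; congr (_ + _).
by rewrite mulr_sumr; apply: eq_bigr => i _; rewrite big_ord_recl /=; congr (_ * _).
Qed.

Lemma der_mxP m n (X : R -> 'M[R]_(m, n)) t (Y : 'M[R]_(m, n)) :
  is_derive t 1 X Y <-> forall i j, is_derive t 1 (fun s => X s i j) (Y i j).
Proof.
split=> [[dX <-] i j|H].
  split; first exact: (derivable_mxP X t 1).1 dX i j.
  by rewrite derive_mx // mxE.
have dX : derivable X t 1 by apply/derivable_mxP => i j; exact: ex_derive.
split=> //; rewrite derive_mx //; apply/matrixP => i j; rewrite mxE.
by have [] := H i j.
Qed.

Lemma der_mulmx m n p (X : R -> 'M[R]_(m, n)) (Y : R -> 'M[R]_(n, p)) t dX dY :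
  is_derive t 1 X dX -> is_derive t 1 Y dY ->
  is_derive t 1 (fun s => X s *m Y s) (dX *m Y t + X t *m dY).
Proof.
move=> /der_mxP HX /der_mxP HY; apply/der_mxP => i j.
have H k (_ : true) := derM (HX i k) (HY k j).
apply: der_ext (der_sum (index_enum 'I_n) H) _ _.
  by move=> s; rewrite mxE.
by rewrite !mxE -big_split.
Qed.

Lemma der_mxcst m n (C : 'M[R]_(m, n)) t : is_derive t 1 (fun=> C) 0.
Proof. exact: is_derive_cst. Qed.

Lemma der_scalemx m n (f : R -> R) (X : R -> 'M[R]_(m, n)) t df dX :
  is_derive t 1 f df -> is_derive t 1 X dX ->
  is_derive t 1 (fun s => f s *: X s) (df *: X t + f t *: dX).
Proof.
move=> Hf /der_mxP HX; apply/der_mxP => i j.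
apply: der_ext (derM Hf (HX i j)) _ _; first by move=> s; rewrite mxE.
by rewrite !mxE.
Qed.

Lemma der_addmx m n (X Y : R -> 'M[R]_(m, n)) t dX dY :
  is_derive t 1 X dX -> is_derive t 1 Y dY ->
  is_derive t 1 (fun s => X s + Y s) (dX + dY).
Proof. by move=> HX HY; apply: der_ext (is_deriveD HX HY) _ _. Qed.

(** Expand along the replaced row: its cofactors do not see the replacement. *)
Lemma det_replace_row n (A B : 'M[R]_n) i :
  \det (\matrix_(k, j) (if k == i then B k j else A k j)) = (B *m \adj A) i i.
Proof.
rewrite (expand_det_row _ i) mxE; apply: eq_bigr => j _.
rewrite !mxE eqxx; congr (_ * _); rewrite /cofactor; congr (_ * \det _).
by apply/matrixP => k l; rewrite !mxE eq_sym (negPf (neq_lift _ _)).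
Qed.

(** Jacobi's formula. *)
Lemma der_det n (X : R -> 'M[R]_n) t Y : is_derive t 1 X Y ->
  is_derive t 1 (fun s => \det (X s)) (\tr (Y *m \adj (X t))).
Proof.
move=> /der_mxP H.
have Hs (s : {perm 'I_n}) (_ : true) := derM (derC ((-1) ^+ s) t)
  (der_prod (fun i => H i (s i))).
apply: der_ext (der_sum (index_enum _) Hs) _ _ => //.
rewrite /mxtrace.
under [RHS]eq_bigr do rewrite -det_replace_row.
rewrite [RHS]exchange_big /=; apply: eq_bigr => s _; rewrite mul0r add0r -mulr_sumr.
congr (_ * _); apply: eq_bigr => i _; apply: eq_bigr => j _; rewrite mxE.
by rewrite [in RHS]eq_sym eq_sym.
Qed.

End Derivation.

(** * The flat ball with a density *)

Section ColumnSpace.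
Context {R : realType} {n : nat}.
Local Notation E := 'cV[R]_n.

(** The balls with rational centers and radii form a basis. *)
Lemma cV_second_countable : @second_countable E.
Proof.
pose B := [set ball (map_mx ratr c.1 : E) (ratr c.2) | c in [set: 'cV[rat]_n * rat]].
exists B.
  apply: (@sub_countable _ _ _ [set: 'cV[rat]_n * rat]); last exact: countableP.
  exact: card_image_le.
split=> [_ [c _ <-]|x A]; first exact: ball_open.
rewrite /= -nbhs_ballE => -[e /= e0 xeA].
have [r] := rat_in_itvoo (divr_gt0 e0 (ltr0n _ 2)); rewrite in_itv /= => /andP[r0 re].
have ex (i : 'I_n) : {q : rat | `|x i 0 - ratr q| < ratr r}.
  apply: cid; have [] := @rat_in_itvoo R (x i 0 - ratr r) (x i 0 + ratr r).
    by rewrite ltrD2l gtrN.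
  move=> q; rewrite in_itv /= => H; exists q; rewrite ltr_distlC; lra.
pose v : 'cV[rat]_n := \col_i sval (ex i).
have vx : ball (map_mx ratr v : E) (ratr r) x.
  split=> // i j; rewrite !ord1 !mxE /ball /= distrC.
  exact: (svalP (ex i)).
exists (ball (map_mx ratr v : E) (ratr r)); first by split=> //; exists (v, r).
move=> y vy; apply: xeA.
have := ball_triangle (ball_sym vx) vy; apply: le_ball.
lra.
Qed.

Lemma cV_connected : connected [set: E].
Proof.
have -> : [set: E] = \bigcup_(x in [set: E]) ((fun t : R => t *: x) @` `[0, 1]).
  rewrite eqEsubset; split=> // x _; exists x => //; exists 1 => //=.
    by rewrite in_itv /= ler01 lexx.
  by rewrite scale1r.
apply: bigcup_connected.
  exists 0 => x _; exists 0; rewrite ?scale0r //=.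
  by rewrite in_itv /= ler01 lexx.
move=> x _; apply: connected_continuous_connected.
  exact: segment_connected.
apply: continuous_subspaceT => t.
by apply: cvgZl; exact: cvg_id.
Qed.

End ColumnSpace.

Section BallChart.
Context {R : realType} {n : nat}.
Local Notation E := 'cV[R]_n.
Implicit Types x y : E.

Definition unit_ball : set E := [set x | `|x| < 1].

Definition to_ball x : E := (1 + `|x|)^-1 *: x.
Definition of_ball y : E := (1 - `|y|)^-1 *: y.

Lemma norm_to_ball x : `|to_ball x| = `|x| / (1 + `|x|).
Proof.
by rewrite /to_ball normrZ ger0_norm 1?mulrC // invr_ge0.
Qed.

Lemma to_ballP x : unit_ball (to_ball x).
Proof.
have nx : 0 <= `|x| by [].
rewrite /unit_ball /= norm_to_ball ltr_pdivrMr; lra.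
Qed.

Lemma to_ballK : cancel to_ball of_ball.
Proof.
move=> x; have nx : 0 <= `|x| by [].
rewrite /of_ball norm_to_ball /to_ball scalerA.
have -> : (1 - `|x| / (1 + `|x|))^-1 / (1 + `|x|) = 1; last by rewrite scale1r.
have x1 : 1 + `|x| != 0 by rewrite gt_eqF //; lra.
have -> : 1 - `|x| / (1 + `|x|) = (1 + `|x|)^-1 by field.
by rewrite invrK mulfV.
Qed.

Lemma of_ballK y : unit_ball y -> to_ball (of_ball y) = y.
Proof.
rewrite /unit_ball /= => y1; have ny : 0 <= `|y| by [].
rewrite /to_ball /of_ball normrZ ger0_norm ?invr_ge0 ?subr_ge0 ?(ltW y1) //.
have x1 : 1 - `|y| != 0 by rewrite gt_eqF //; lra.
rewrite scalerA.
have -> : 1 + (1 - `|y|)^-1 * `|y| = (1 - `|y|)^-1 by field.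
by rewrite invrK mulfV // scale1r.
Qed.

Lemma to_ball_continuous : continuous to_ball.
Proof.
move=> x; rewrite /continuous_at /to_ball.
apply: (@cvgZ _ _ _ (nbhs x) _ (fun x : E => (1 + `|x|)^-1) id); last exact: cvg_id.
apply: cvgV; first by rewrite gt_eqF // ltr_pwDl.
by apply: cvgD; [exact: cvg_cst|exact: norm_continuous].
Qed.

Lemma of_ball_continuous y : unit_ball y -> {for y, continuous of_ball}.
Proof.
move=> y1; rewrite /prop_for /continuous_at /of_ball.
apply: (@cvgZ _ _ _ (nbhs y) _ (fun x : E => (1 - `|x|)^-1) id); last exact: cvg_id.
apply: cvgV; first by rewrite gt_eqF // subr_gt0.
by apply: cvgB; [exact: cvg_cst|exact: norm_continuous].
Qed.

Lemma unit_ball_open : open unit_ball.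
Proof.
have -> : unit_ball = ball (0 : E) 1.
  by rewrite -ball_normE /unit_ball /ball_; apply/seteqP; split=> x /=;
    rewrite sub0r normrN.
exact: ball_open.
Qed.

Lemma unit_ballZ (t : R) x : 0 <= t <= 1 -> unit_ball x -> unit_ball (t *: x).
Proof.
rewrite /unit_ball /= normrZ => /andP[t0 t1] x1; rewrite ger0_norm //.
have nx : 0 <= `|x| by [].
nra.
Qed.

Lemma unit_ball_near x (P : E -> Prop) :
  unit_ball x -> (forall y, unit_ball y -> P y) -> \near x, P x.
Proof.
by move=> Ux H; apply: filterS (open_nbhs_nbhs (conj unit_ball_open Ux)) => y /H.
Qed.

(** The set [D] is a variable because domains of charts occur in several
    convertible forms, such as [setT `&` setT]. *)
Lemma to_ball_image (D : set E) : D = setT -> to_ball @` D = unit_ball.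
Proof.
move=> ->; apply/seteqP; split=> [_ [x _ <-]|y Uy]; first exact: to_ballP.
by exists (of_ball y) => //; exact: of_ballK.
Qed.

Lemma ball_transition_diff x :
  unit_ball x -> is_diff x (to_ball \o of_ball) (id : E -> E).
Proof.
move=> Ux; apply: near_eq_is_diff (is_diff_id x).
by apply: unit_ball_near Ux _ => y Uy /=; rewrite of_ballK.
Qed.

Lemma ball_transition_smooth : smooth unit_ball (to_ball \o of_ball).
Proof.
move=> k; have cid : continuous (@idfun E) by move=> x; exact: cvg_id.
apply: (Ck_ext unit_ball_open) (Ck_linear unit_ball_open k cid) => x.
by rewrite inE => Ux /=; rewrite of_ballK.
Qed.

Lemma to_ball_image_open : open (to_ball @` [set: E]).
Proof. by rewrite to_ball_image //; exact: unit_ball_open. Qed.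

Lemma of_ball_image_continuous x :
  (to_ball @` [set: E]) x -> {for x, continuous of_ball}.
Proof.
by move=> Ux; apply: of_ball_continuous; rewrite -(to_ball_image (erefl _)).
Qed.

Lemma ball_transition_image_smooth :
  smooth (to_ball @` (setT `&` setT)) (to_ball \o of_ball).
Proof. rewrite to_ball_image ?setTI //; exact: ball_transition_smooth. Qed.

(** The carrier is the whole space, which is second countable and connected as it
    stands; the homeomorphism [to_ball] is the only chart, so the smooth structure is
    that of the ball. *)
Definition ball_manifold : manifold R n.
Proof.
refine (@Manifold R n E _ cV_second_countable _ cV_connected
  unit (fun=> setT) (fun=> to_ball) (fun=> of_ball) _ _ _ _ _ _ _).
- exact: norm_hausdorff.
- by exists 0.
- by move=> _; exact: openT.
- by move=> p; exists tt.
- by move=> _; exact: to_ball_image_open.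
- by move=> _ p _; exact: to_ballK.
- by move=> _ p _; exact: to_ball_continuous.
- by move=> _; exact: of_ball_image_continuous.
- by move=> _ _; exact: ball_transition_image_smooth.
Defined.

Variable phi : E -> R.
Hypothesis phi_smooth : smooth unit_ball phi.

Definition flat_ball : density_manifold R n.
Proof.
refine (@DensityManifold R n ball_manifold (fun _ _ => 1%:M) (phi \o to_ball)
  _ _ _ _ _).
- move=> i k; apply: (@Ck_cst _ _ (chart_img i) _ 'M[R]_n k 1%:M).
  by rewrite /chart_img to_ball_image //; exact: unit_ball_open.
- by move=> i x _; rewrite trmx1.
- move=> i x _ v v0; rewrite innerE.
  have -> : \sum_j \sum_i v i 0 * (1%:M : 'M[R]_n) i j * v j 0 =
      \sum_j v j 0 ^+ 2.
    apply: eq_bigr => j _; rewrite (bigD1 j) //= big1 => [|k kj].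
      by rewrite addr0 mxE eqxx mulr1.
    by rewrite mxE (negPf kj) mulr0 mul0r.
  rewrite lt0r sumr_ge0 ?andbT => [|j _]; last exact: sqr_ge0.
  apply: contra v0; rewrite psumr_eq0 => [/allP H|j _]; last exact: sqr_ge0.
  apply/eqP/colP => j; rewrite mxE; apply/eqP.
  by have := H j; rewrite mem_index_enum sqrf_eq0 => /(_ isT).
- move=> i j x; rewrite to_ball_image ?setTI // => Ux u v.
  by have [_ ->] := ball_transition_diff Ux.
- move=> i k; rewrite /chart_img to_ball_image //.
  apply: (Ck_ext unit_ball_open) (phi_smooth k) => x.
  by rewrite inE => Ux /=; rewrite of_ballK.
Defined.

(** The Levi-Civita part vanishes for a constant metric. *)
Lemma weighted_christoffel_flat x u v (i : chart_index flat_ball) : unit_ball x ->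
  weighted_christoffel (metric i) (@density _ _ flat_ball \o chart_inv i) x u v =
  - ('D_u phi x *: v) - 'D_v phi x *: u.
Proof.
move=> Ux; rewrite /weighted_christoffel.
have e w : 'D_w (@density _ _ flat_ball \o chart_inv i) x = 'D_w phi x.
  apply: near_eq_derive; apply: unit_ball_near Ux _ => y Uy /=.
  by rewrite of_ballK.
rewrite !e /christoffel.
have -> : \col_k christoffel1 (metric i) x u v (delta_mx k 0) = 0 :> 'cV[R]_n.
  apply/colP => k; rewrite !mxE /christoffel1 /= !derive_cst; ring.
by rewrite mulmx0 sub0r.
Qed.

End BallChart.
Arguments unit_ball {R n}.

(** * Frames of parallel fields and holonomy *)

Section Frames.
Context {R : realType} {n : nat}.
Local Notation E := 'cV[R]_n.
Variables (phi : E -> R) (eta : E -> 'rV[R]_n).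
Hypothesis phi_smooth : smooth unit_ball phi.
Hypothesis etaE : forall x u, unit_ball x -> 'D_u phi x = (eta x *m u) 0 0.
Local Notation M := (flat_ball phi_smooth).

Lemma der_phi (sigma : R -> E) t v : unit_ball (sigma t) ->
  is_derive t 1 sigma v ->
  is_derive t 1 (fun s => phi (sigma s)) ((eta (sigma t) *m v) 0 0).
Proof.
move=> Ut [ds <-].
have dphi : differentiable phi (sigma t) by exact: (phi_smooth 1).1.
have dsig : differentiable sigma t by exact/derivable1_diffP.
have dc := differentiable_comp dsig dphi.
split; first exact/derivable1_diffP.
rewrite -etaE // (deriveE _ dc) (diff_comp dsig dphi) /=.
by rewrite -(deriveE _ dsig) -(deriveE _ dphi).
Qed.

(** The columns of [X] are the fields [W = exp(- phi) V] for [V] parallel along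
    [sigma], in the coordinates of the chart and off the exceptional times [s]. *)
Record parallel_frame (sigma : R -> E) (s : seq R) (X : R -> 'M[R]_n) : Prop := {
  frame_dom : forall t : R, 0 <= t <= 1 -> unit_ball (sigma t);
  frame_base_continuous : {within `[0, 1], continuous sigma};
  frame_continuous : {within `[0, 1], continuous X};
  frame_base_derivable : forall t : R, 0 < t < 1 -> t \notin s -> derivable sigma t 1;
  frame_derive : forall t : R, 0 < t < 1 -> t \notin s ->
    is_derive t 1 X (derive1 sigma t *m (eta (sigma t) *m X t)) }.

Lemma within_phi (sigma : R -> E) :
  (forall t : R, 0 <= t <= 1 -> unit_ball (sigma t)) ->
  {within `[0, 1], continuous sigma} ->
  {within `[0, 1], continuous (fun t => phi (sigma t))}.
Proof.
move=> Us cs; apply/subspace_continuousP => t t01.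
have Ut : unit_ball (sigma t) by apply: Us; rewrite /= in_itv in t01.
have cphi : {for sigma t, continuous phi}.
  exact: differentiable_continuous ((phi_smooth 1).1 _ Ut).
apply: (cvg_comp sigma phi _ cphi).
by have /subspace_continuousP := cs; apply.
Qed.

(** The columns of the frame are the parallel fields of the definition of the
    holonomy for the basis vectors, rescaled by [exp(phi(sigma 0) - phi(sigma t))]
    so that the values at the ends are unchanged. *)
Lemma holonomy_frame (p : M) i B A : holonomy p i B A ->
  exists sigma s X, [/\ parallel_frame sigma s X, sigma 0 = chart i p,
    sigma 1 = chart i p, X 0 = B & X 1 = B *m A].
Proof.
move=> [gamma [[cg [sg Hsg]] g0 g1 HV]].
have cV (j : 'I_n) : {V : R -> chart_index M -> E |
  [/\ parallel gamma V, V 0 i = B *m delta_mx j 0 &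
      V 1 i = B *m (A *m delta_mx j 0)]} := cid (HV (delta_mx j 0)).
pose V j := sval (cV j).
have VP j : parallel gamma (V j) by have [] := svalP (cV j).
have cs (j : 'I_n) : {s : seq R | forall i t, 0 < t < 1 -> t \notin s ->
    chart_dom i (gamma t) -> is_derive t 1 (fun t' => V j t' i)
     (- weighted_christoffel (metric i) (@density _ _ M \o chart_inv i)
     (local_curve i gamma t) (derive1 (local_curve i gamma) t) (V j t i))}.
  by apply: cid; have [] := VP j.
pose sigma := local_curve i gamma.
pose c := phi (chart i p).
exists sigma, (sg ++ flatten [seq sval (cs j) | j <- enum 'I_n]).
exists (fun t => expR (c - phi (sigma t)) *: \matrix_(k, j) V j t i k 0).
have Us t : unit_ball (sigma t) by exact: to_ballP.
have csig : {within `[0, 1], continuous sigma}.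
  apply: (@within_continuous_comp _ _ _ _ gamma to_ball _ cg).
  by move=> x _; exact: to_ball_continuous.
have s0 : sigma 0 = chart i p by rewrite /sigma /local_curve g0.
have s1 : sigma 1 = chart i p by rewrite /sigma /local_curve g1.
have dsig t : 0 < t < 1 -> t \notin sg -> derivable sigma t 1.
  by move=> t01 ts; have [H _ _] := Hsg i; have [Hd _] := H t t01 ts I; exact: Hd.
split; [|exact: s0|exact: s1| |].
- split; [by move=> t _; exact: Us|exact: csig| | | ].
  + have Hphi := within_phi (fun t _ => Us t) csig.
    move=> t; apply: cvgZ.
      apply: continuous_cvg; first exact: continuous_expR.
      by apply: cvgB; [exact: cvg_cst|exact: Hphi].
    apply: cvg_mx => k j; rewrite mxE; under eq_cvg do rewrite mxE.
    apply: cvg_coord.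
    have [_ H _] := VP j; have := H i.
    have -> : [set t : R | 0 <= t <= 1 /\ chart_dom i (gamma t)] = `[0, 1]%classic.
      by apply/seteqP; split=> u /=; rewrite in_itv /= => H'; [case: H'|].
    by apply.
  + move=> t t01; rewrite mem_cat negb_or => /andP[ts _]; exact: dsig.
  + move=> t t01; rewrite mem_cat negb_or => /andP[ts tf].
    have Dsig : is_derive t 1 sigma (derive1 sigma t).
      by rewrite derive1E; exact/derivableP/dsig.
    have De : is_derive t 1 (fun s => expR (c - phi (sigma s)))
        (expR (c - phi (sigma t)) * (0 - (eta (sigma t) *m derive1 sigma t) 0 0)).
      exact: (derF (is_derive_expR _) (derD (derC c t)
        (derN (der_phi (Us t) Dsig)))).
    apply/der_mxP => k j.
    have tj : t \notin sval (cs j).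
      apply: contra tf => tj; apply/flattenP; exists (sval (cs j)) => //.
      by apply: map_f; rewrite mem_enum.
    have /der_mxP/(_ k 0) := svalP (cs j) i t t01 tj I.
    rewrite weighted_christoffel_flat // => DV.
    apply: der_ext (derM De DV) _ _; first by move=> u; rewrite !mxE.
    rewrite -!scalemxAr !etaE //.
    have -> : eta (sigma t) *m (\matrix_(k, j) V j t i k 0) =
       \row_j (eta (sigma t) *m V j t i) 0 0.
      by apply/rowP => l; rewrite !mxE; apply: eq_bigr => k' _; rewrite !mxE.
    rewrite !mxE big_ord1 !mxE.
    rewrite -/sigma; ring.
- rewrite s0 subrr expR0 scale1r; apply/matrixP => k j; rewrite mxE.
  have [_ V0 _] := svalP (cV j); rewrite (V0 : V j 0 i = _) mxE (bigD1 j) //= big1 => [|l lj].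
    by rewrite addr0 mxE !eqxx mulr1.
  by rewrite mxE (negPf lj) mulr0.
- rewrite s1 subrr expR0 scale1r; apply/matrixP => k j; rewrite mxE.
  have [_ _ V1] := svalP (cV j); rewrite (V1 : V j 1 i = _) mulmxA mxE (bigD1 j) //= big1 =>
    [|l lj].
    by rewrite addr0 [X in _ * X]mxE !eqxx mulr1.
  by rewrite [X in _ * X]mxE (negPf lj) mulr0.
Qed.

Record piecewise_smooth (sigma : R -> E) (s : seq R) : Prop := {
  ps_continuous : forall t : R, 0 < t < 1 -> t \notin s ->
    {for t, continuous (derive1 sigma)};
  ps_right : forall t : R, 0 <= t < 1 -> cvg (derive1 sigma @ t^'+);
  ps_left : forall t : R, 0 < t <= 1 -> cvg (derive1 sigma @ t^'-) }.

(** Conversely, a frame along a loop that starts at the identity gives the parallel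
    field with any initial value [B *m v], after undoing the rescaling. *)
Lemma frame_holonomy (p : M) i B P sigma s X : B \in unitmx ->
  parallel_frame sigma s X -> piecewise_smooth sigma s ->
  sigma 0 = chart i p -> sigma 1 = chart i p -> X 0 = 1%:M -> X 1 = P ->
  holonomy p i B (invmx B *m P *m B).
Proof.
move=> uB fX ps s0 s1 X0 X1.
pose gamma : R -> M := fun t => of_ball (sigma t).
have Us := frame_dom fX.
have lc j (t : R) : 0 <= t <= 1 -> local_curve j gamma t = sigma t.
  by move=> /Us Ut; rewrite /local_curve /= of_ballK.
have near01 j (t : R) : 0 < t < 1 -> \near t, local_curve j gamma t = sigma t.
  move=> t01; near=> u; apply: lc; apply/andP; split; apply: ltW.
    near: u; apply: lt_nbhsr; lra.
  near: u; apply: lt_nbhsl; lra.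
have d1 j (t : R) : 0 < t < 1 -> derive1 (local_curve j gamma) t = derive1 sigma t.
  by move=> t01; rewrite !derive1E; exact: near_eq_derive (near01 _ t t01).
exists gamma; split.
- split.
    apply: (@within_continuous_comp _ _ _ _ sigma of_ball _ (frame_base_continuous fX)).
    move=> x; rewrite inE => -[t t01 <-]; apply: of_ball_continuous.
    by apply: Us; move: t01; rewrite /= in_itv.
  exists s; case; split=> [t t01 ts _|t t01 _|t t01 _].
  + split.
      apply: near_eq_derivable (frame_base_derivable fX t01 ts).
      by apply: filterS (near01 _ t t01).
    rewrite /prop_for /continuous_at d1 //.
    apply: cvg_trans (ps_continuous ps t01 ts).
    apply: near_eq_cvg; near=> u; rewrite d1 //; apply/andP; split.
      near: u; apply: lt_nbhsr; lra.
    near: u; apply: lt_nbhsl; lra.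
  + have /cvg_ex[l Hl] := ps_right ps t01.
    apply/cvg_ex; exists l; apply: cvg_trans Hl.
    apply: near_eq_cvg; near=> u; rewrite d1 //; apply/andP; split.
      by apply: (@le_lt_trans _ _ t); [lra|near: u; exact: nbhs_right_gt].
    by near: u; apply: nbhs_right_lt; lra.
  + have /cvg_ex[l Hl] := ps_left ps t01.
    apply/cvg_ex; exists l; apply: cvg_trans Hl.
    apply: near_eq_cvg; near=> u; rewrite d1 //; apply/andP; split.
      by near: u; apply: nbhs_left_gt; lra.
    by apply: (@lt_le_trans _ _ t); [near: u; exact: nbhs_left_lt|lra].
- by rewrite /gamma s0 /= to_ballK.
- by rewrite /gamma s1 /= to_ballK.
move=> v; pose c := phi (chart i p).
exists (fun t _ => expR (phi (sigma t) - c) *: (X t *m (B *m v))); split.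
- split.
  + move=> t j k t01 _ _; have Ut := Us t t01; rewrite lc //.
    by have [_ ->] := ball_transition_diff Ut.
  + move=> j.
    have -> : [set t : R | 0 <= t <= 1 /\ chart_dom j (gamma t)] = `[0, 1]%classic.
      by apply/seteqP; split=> u /=; rewrite in_itv /= => H'; [case: H'|].
    move=> t; apply: cvgZ; last first.
      by apply: cvg_mulmx; [exact: (frame_continuous fX)|exact: cvg_cst].
    have Hphi := within_phi Us (frame_base_continuous fX).
    apply: continuous_cvg; first exact: continuous_expR.
    by apply: cvgB; [exact: Hphi|exact: cvg_cst].
  + exists s => j t t01 ts _.
    have tc : 0 <= t <= 1 by lra.
    rewrite weighted_christoffel_flat; last by rewrite lc //; exact: Us.
    rewrite lc // d1 // !etaE; [|exact: Us|exact: Us].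
    have Dsig : is_derive t 1 sigma (derive1 sigma t).
      by rewrite derive1E; exact/derivableP/(frame_base_derivable fX).
    have De : is_derive t 1 (fun s => expR (phi (sigma s) - c))
        (expR (phi (sigma t) - c) * ((eta (sigma t) *m derive1 sigma t) 0 0 + - 0)).
      exact: (derF (is_derive_expR _) (derD (der_phi (Us t tc) Dsig)
        (derN (derC c t)))).
    apply: der_ext (der_scalemx De (der_mulmx (frame_derive fX t01 ts)
      (der_mxcst (B *m v) t))) _ _ => //.
    rewrite oppr0 addr0 mulmx0 addr0 opprB opprK addrC -!scalemxAr.
    rewrite !scalerA; congr (_ + _); last by rewrite mulrC.
    rewrite -!mulmxA; set r := eta _ *m (X t *m (B *m v)).
    by rewrite [r]mx11_scalar mul_mx_scalar scalerA !mxE eqxx mulr1n.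
- by rewrite s0 subrr expR0 scale1r X0 mul1mx.
- by rewrite s1 subrr expR0 scale1r X1 !mulmxA mulmxV // mul1mx.
Unshelve. all: by end_near. Qed.

End Frames.

(** * Chains of arcs *)

Section Gluing.
Context {R : realType}.

Lemma within_comp_maps {S T W : topologicalType} (A : set S) (B : set T)
    (a : S -> T) (f : T -> W) : continuous a -> (forall x, A x -> B (a x)) ->
  {within B, continuous f} -> {within A, continuous (f \o a)}.
Proof.
move=> ca aAB /subspace_continuousP cf; apply/subspace_continuousP => x Ax.
have Ha : a @ within A (nbhs x) `=>` within B (nbhs (a x)).
  move=> P; rewrite /within /= => H; have := ca x _ H; rewrite /= => H'.
  apply: (@filterS _ (nbhs x) _ _ _ _ H') => y /= Py Ay.
  by apply: Py; exact: aAB.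
exact: (cvg_comp a f Ha (cf _ (aAB x Ax))).
Qed.

Lemma der_affine (k b t : R) : is_derive t 1 (fun s : R => k * s + b) k.
Proof.
apply: der_ext (derD (derM (derC k t) (derI t)) (derC b t)) _ _ => //; ring.
Qed.

Lemma affine_continuous (k b : R) : continuous (fun t : R => k * t + b).
Proof.
move=> t; apply/differentiable_continuous/derivable1_diffP.
by have [] := der_affine k b t.
Qed.

Lemma der_mx_affine m n (X : R -> 'M[R]_(m, n)) (k b t : R) Y :
  is_derive (k * t + b) 1 X Y -> is_derive t 1 (fun s => X (k * s + b)) (k *: Y).
Proof.
move=> /der_mxP H; apply/der_mxP => i j.
apply: der_ext (derF (f := fun s => k * s + b) (H i j) (der_affine k b t)) _ _ => //.
by rewrite mxE mulrC.
Qed.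

Lemma derive1_affine m n (X : R -> 'M[R]_(m, n)) (k b t : R) :
  derivable X (k * t + b) 1 ->
  derive1 (fun s => X (k * s + b)) t = k *: derive1 X (k * t + b).
Proof.
move=> /derivableP dX; rewrite !derive1E.
by have [_ ->] := der_mx_affine dX.
Qed.

(** The concatenation of two curves, both run at double speed.  The arguments are
    written in affine form so that the lemmas on affine changes of variable
    apply. *)
Definition glue {T : Type} (f g : R -> T) (t : R) : T :=
  if t <= 2^-1 then f (2 * t + 0) else g (2 * t + (- 1)).

Lemma glue_le {T : Type} (f g : R -> T) (t : R) :
  t <= 2^-1 -> glue f g t = f (2 * t + 0).
Proof. by rewrite /glue => ->. Qed.

Lemma glue_ge {T : Type} (f g : R -> T) (t : R) : f 1 = g 0 ->
  2^-1 <= t -> glue f g t = g (2 * t + (-1)).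
Proof.
move=> fg; rewrite le_eqVlt /glue => /predU1P[<-|]; last by rewrite leNgt => ->.
rewrite lexx.
have -> : 2 * 2^-1 + -1 = 0 :> R by lra.
by have -> : 2 * 2^-1 + 0 = 1 :> R by lra.
Qed.

Lemma glue_continuous {T : topologicalType} (f g : R -> T) : f 1 = g 0 ->
  {within `[0, 1], continuous f} -> {within `[0, 1], continuous g} ->
  {within `[0, 1], continuous (glue f g)}.
Proof.
move=> fg cf cg.
have -> : `[(0 : R), 1]%classic = `[0, 2^-1]%classic `|` `[2^-1, 1]%classic.
  apply/seteqP; split=> t /=; rewrite !in_itv /=; last by case; lra.
  by move=> H; case: (leP t 2^-1) => H'; [left|right]; lra.
apply: withinU_continuous; [exact: itv_closed|exact: itv_closed| |].
  apply: (@subspace_eq_continuous R `[0, 2^-1]%classic T (fun t => f (2 * t + 0))).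
    move=> t; rewrite inE /= in_itv /= => /andP[_ t2].
    exact/esym/glue_le.
  apply: within_comp_maps (@affine_continuous 2 0) _ cf.
  by move=> t /=; rewrite !in_itv /=; lra.
apply: (@subspace_eq_continuous R `[2^-1, 1]%classic T (fun t => g (2 * t + (-1)))).
  move=> t; rewrite inE /= in_itv /= => /andP[t2 _].
  exact/esym/glue_ge.
apply: within_comp_maps (@affine_continuous 2 (-1)) _ cg.
by move=> t /=; rewrite !in_itv /=; lra.
Qed.

Lemma glue_left {T : Type} (f g : R -> T) (t : R) : t < 2^-1 ->
  \near t, glue f g t = f (2 * t + 0).
Proof.
move=> t2; near=> u; rewrite /glue ifT //; apply: ltW.
by near: u; exact: lt_nbhsl.
Unshelve. all: by end_near. Qed.

Lemma glue_right {T : Type} (f g : R -> T) (t : R) : 2^-1 < t ->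
  \near t, glue f g t = g (2 * t + (-1)).
Proof.
move=> t2; near=> u; rewrite /glue ifF //; apply: negbTE; rewrite -ltNge.
by near: u; exact: lt_nbhsr.
Unshelve. all: by end_near. Qed.

End Gluing.

Section NotIn.
Context {R : realType}.

Lemma near_notin (s : seq R) (t : R) : t \notin s -> \near t, t \notin s.
Proof.
elim: s => [_|x s IH]; first by near=> u.
rewrite in_cons negb_or => /andP[tx /IH ts].
have {}tx : \near t, t != x.
  case: (ltgtP t x) tx => // tx _; near=> u.
    by rewrite lt_eqF //; near: u; exact: lt_nbhsl.
  by rewrite gt_eqF //; near: u; exact: lt_nbhsr.
near=> u; rewrite in_cons negb_or; apply/andP; split.
  by near: u; exact: tx.
by near: u; exact: ts.
Unshelve. all: by end_near. Qed.

Lemma right_notin (s : seq R) (t : R) : \forall u \near t^'+, u \notin s.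
Proof.
elim: s => [|x s IH]; first by near=> u.
have tx : \forall u \near t^'+, u != x.
  case: (leP x t) => xt; near=> u.
    by rewrite gt_eqF //; apply: le_lt_trans xt _; near: u; exact: nbhs_right_gt.
  by rewrite lt_eqF //; near: u; exact: nbhs_right_lt.
near=> u; rewrite in_cons negb_or; apply/andP; split; near: u.
  exact: tx.
exact: IH.
Unshelve. all: by end_near. Qed.

Lemma left_notin (s : seq R) (t : R) : \forall u \near t^'-, u \notin s.
Proof.
elim: s => [|x s IH]; first by near=> u.
have tx : \forall u \near t^'-, u != x.
  case: (leP t x) => xt; near=> u.
    by rewrite lt_eqF //; apply: lt_le_trans xt; near: u; exact: nbhs_left_lt.
  by rewrite gt_eqF //; near: u; exact: nbhs_left_gt.
near=> u; rewrite in_cons negb_or; apply/andP; split; near: u.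
  exact: tx.
exact: IH.
Unshelve. all: by end_near. Qed.

Lemma affine_right (t : R) (c : R) : 2 * u + c @[u --> t^'+] `=>` (2 * t + c)^'+.
Proof.
move=> A /= [e /= e0 H]; exists (e / 2); first by rewrite /= divr_gt0.
move=> u /= tu u0; apply: H => /=; last by lra.
have -> : 2 * t + c - (2 * u + c) = 2 * (t - u) by ring.
by rewrite normrM ger0_norm //; lra.
Qed.

Lemma affine_left (t : R) (c : R) : 2 * u + c @[u --> t^'-] `=>` (2 * t + c)^'-.
Proof.
move=> A /= [e /= e0 H]; exists (e / 2); first by rewrite /= divr_gt0.
move=> u /= tu u0; apply: H => /=; last by lra.
have -> : 2 * t + c - (2 * u + c) = 2 * (t - u) by ring.
by rewrite normrM ger0_norm //; lra.
Qed.

End NotIn.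

Section Chains.
Context {R : realType} {n : nat}.
Local Notation E := 'cV[R]_n.
Variables (phi : E -> R) (eta : E -> 'rV[R]_n).
Hypothesis phi_smooth : smooth unit_ball phi.
Hypothesis etaE : forall x u, unit_ball x -> 'D_u phi x = (eta x *m u) 0 0.
Local Notation M := (flat_ball phi_smooth).
Local Notation frame := (parallel_frame eta).

(** Jacobi's formula: the trace of [sigma' *m eta] is the derivative of [phi] along
    [sigma]. *)
Lemma frame_det sigma s X u : frame sigma s X -> 0 <= u <= 1 ->
  \det (X u) * expR (phi (sigma 0)) = \det (X 0) * expR (phi (sigma u)).
Proof.
move=> fX /andP[u0 u1]; have Us := frame_dom fX.
pose f t := \det (X t) * expR (- phi (sigma t)).
suff : f 0 = f u.
  rewrite /f !expRN => H.
  have e0 t : expR (phi (sigma t)) != 0 by rewrite gt_eqF // expR_gt0.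
  by apply/esym; move/eqP: H; rewrite eqr_div // => /eqP.
apply: (@is_cst_off_finite _ f s 0 u u0).
  have sub : `[0, u] `<=` `[0, 1] by move=> t /=; rewrite !in_itv /=; lra.
  apply: continuous_subspaceW sub _ => t; apply: cvgM; first by apply: cvg_det;
    exact: (frame_continuous fX).
  apply: continuous_cvg; first exact: continuous_expR.
  by apply: cvgN; exact: (within_phi phi_smooth Us (frame_base_continuous fX)).
move=> t t0u ts; have t01 : 0 < t < 1 by lra.
have tc : 0 <= t <= 1 by lra.
have Dsig : is_derive t 1 sigma (derive1 sigma t).
  by rewrite derive1E; exact/derivableP/(frame_base_derivable fX).
have De := derF (is_derive_expR _) (derN (der_phi phi_smooth etaE (Us t tc) Dsig)).
apply: der_ext (derM (der_det (frame_derive fX t01 ts)) De) _ _ => //.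
rewrite -!mulmxA mul_mx_adj mul_mx_scalar mxtrace_mulC -scalemxAl mxtraceZ.
by rewrite trace_mx11; ring.
Qed.

(** Arcs are C^1 on the whole line and the equation is asked at both end points, so
    that an arc can be reversed without one-sided derivatives; corners only
    appear when arcs are glued. *)
Definition piece (x y : E) (P : 'M[R]_n) : Prop := exists sigma X,
  [/\ forall t : R, 0 <= t <= 1 -> unit_ball (sigma t),
      forall t : R, derivable sigma t 1, continuous (derive1 sigma) &
      forall t : R, 0 <= t <= 1 ->
        is_derive t 1 X (derive1 sigma t *m (eta (sigma t) *m X t))] /\
  [/\ sigma 0 = x, sigma 1 = y, X 0 = 1%:M & X 1 = P].

(** Keeping the list of arcs unglued makes concatenation and reversal inductions on
    the list; the gluing is done once, in [chain_frame]. *)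
Inductive chain : E -> E -> 'M[R]_n -> Prop :=
| chain_nil x : unit_ball x -> chain x x 1%:M
| chain_cons x y z P Q : piece x y P -> chain y z Q -> chain x z (Q *m P).

Lemma der_within m1 m2 (X : R -> 'M[R]_(m1, m2)) (dX : R -> 'M[R]_(m1, m2)) :
  (forall t : R, 0 <= t <= 1 -> is_derive t 1 X (dX t)) ->
  {within `[0, 1], continuous X}.
Proof.
move=> H; apply: derivable_within_continuous => t.
by rewrite in_itv /= => /H[].
Qed.

Lemma piece_frame x y P : piece x y P -> exists sigma X,
  [/\ frame sigma [::] X, sigma 0 = x, sigma 1 = y, X 0 = 1%:M & X 1 = P].
Proof.
move=> [sigma [X [[H1 H2 H3 H4] [H5 H6 H7 H8]]]]; exists sigma, X; split=> //.
split=> //.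
- by apply: (der_within (dX := fun t => 'D_1 sigma t)) => t _; exact/derivableP.
- by apply: (der_within (dX := fun t => derive1 sigma t *m (eta (sigma t) *m X t))).
- by move=> t t01 _; apply: H4; lra.
Qed.

Lemma piece_unit x y P : piece x y P -> P \in unitmx.
Proof.
move=> /piece_frame[sigma [X [fX _ _ X0 X1]]].
have := frame_det fX (_ : 0 <= 1 <= 1); rewrite ler01 lexx => /(_ isT);
  rewrite X0 X1 det1 mul1r unitmxE unitfE => H.
apply/eqP => P0; have := expR_gt0 (phi (sigma 1)).
by rewrite -H P0 mul0r ltxx.
Qed.

Lemma piece_rev x y P : piece x y P -> piece y x (invmx P).
Proof.
move=> pP; have uP := piece_unit pP.
move: pP => [sigma [X [[H1 H2 H3 H4] [H5 H6 H7 H8]]]].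
exists (fun t => sigma (- 1 * t + 1)), (fun t => X (- 1 * t + 1) *m invmx P).
have d1 t : derive1 (fun s => sigma (-1 * s + 1)) t = -1 *: derive1 sigma (-1 * t + 1).
  by apply: derive1_affine; exact: H2.
split; split.
- by move=> t t01; apply: H1; lra.
- by move=> t; have /derivableP/der_mx_affine[] := H2 (-1 * t + 1).
- move=> t; rewrite /continuous_at d1; under eq_cvg do rewrite d1.
  apply: cvgZ; first exact: cvg_cst.
  have ca := @affine_continuous R (-1) 1 t.
  exact: (cvg_comp (fun s : R => -1 * s + 1) (derive1 sigma) ca (H3 _)).
- move=> t t01; have t01' : 0 <= -1 * t + 1 <= 1 by lra.
  have D := der_mulmx (der_mx_affine (H4 _ t01')) (der_mxcst (invmx P) t).
  apply: der_ext D _ _ => //.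
  by rewrite mulmx0 addr0 d1 -!scalemxAl !mulmxA.
- by rewrite mulr0 add0r.
- by rewrite mulr1 addNr.
- by rewrite mulr0 add0r H8 mulmxV.
- by rewrite mulr1 addNr H7 mul1mx.
Qed.

Lemma chain_cat x y z P Q : chain x y P -> chain y z Q -> chain x z (Q *m P).
Proof.
move=> c; elim: c Q => [{}x _|{}x y' {}y P1 P2 p c IH] Q cQ; first by rewrite mulmx1.
by rewrite mulmxA; apply: chain_cons p (IH _ cQ).
Qed.

Lemma piece_dom x y P : piece x y P -> unit_ball x /\ unit_ball y.
Proof.
move=> [sigma [X [[H1 _ _ _] [<- <- _ _]]]].
by split; apply: H1; rewrite ?ler01 lexx.
Qed.

Lemma piece_chain x y P : piece x y P -> chain x y P.
Proof.
move=> p; have [_ Uy] := piece_dom p.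
by rewrite -[P]mul1mx; apply: chain_cons p (chain_nil Uy).
Qed.

Lemma chain_unit x y P : chain x y P -> P \in unitmx.
Proof.
elim=> [{}x _|{}x y' {}y P1 P2 p c IH]; first exact: unitmx1.
by rewrite unitmx_mul IH (piece_unit p).
Qed.

Lemma chain_rev x y P : chain x y P -> chain y x (invmx P).
Proof.
elim=> [{}x Ux|{}x y' {}y P1 P2 p c IH]; first by rewrite invmx1; exact: chain_nil.
have uP1 := piece_unit p; have uP2 := chain_unit c.
have -> : invmx (P2 *m P1) = invmx P1 *m invmx P2.
  have u12 : P2 *m P1 \in unitmx by rewrite unitmx_mul uP1 uP2.
  apply: (can_inj (mulKmx u12)); rewrite mulmxV //.
  by rewrite mulmxA mulmxK // mulmxV.
exact: chain_cat IH (piece_chain (piece_rev p)).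
Qed.

Lemma glue_frame sigma1 X1 sigma2 s2 X2 (P := X1 1) :
  (forall t : R, 0 <= t <= 1 -> unit_ball (sigma1 t)) ->
  (forall t : R, derivable sigma1 t 1) -> continuous (derive1 sigma1) ->
  (forall t : R, 0 <= t <= 1 ->
     is_derive t 1 X1 (derive1 sigma1 t *m (eta (sigma1 t) *m X1 t))) ->
  frame sigma2 s2 X2 -> piecewise_smooth sigma2 s2 ->
  sigma1 1 = sigma2 0 -> X2 0 = 1%:M ->
  let s := 2^-1 :: [seq (u + 1) / 2 | u <- s2] in
  frame (glue sigma1 sigma2) s (glue X1 (fun t => X2 t *m P)) /\
  piecewise_smooth (glue sigma1 sigma2) s.
Proof.
move=> H1 H2 H3 H4 fX ps s12 X20 s.
have sE t : t \notin s -> t != 2^-1 /\ 2 * t + (-1) \notin s2.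
  rewrite in_cons negb_or => /andP[-> H]; split=> //; apply: contra H => H.
  by apply/mapP; exists (2 * t + (-1)) => //; field.
have dL t : t < 2^-1 ->
    derive1 (glue sigma1 sigma2) t = 2 *: derive1 sigma1 (2 * t + 0).
  move=> t2; rewrite -derive1_affine; last exact: H2.
  by rewrite !derive1E; exact: near_eq_derive (glue_left _ _ t2).
have dR t : 2^-1 < t -> derivable sigma2 (2 * t + (-1)) 1 ->
    derive1 (glue sigma1 sigma2) t = 2 *: derive1 sigma2 (2 * t + (-1)).
  move=> t2 d; rewrite -derive1_affine //.
  by rewrite !derive1E; exact: near_eq_derive (glue_right _ _ t2).
split; split.
- move=> t t01; rewrite /glue; case: leP => t2.
    by apply: H1; lra.
  by apply: (frame_dom fX); lra.
- apply: glue_continuous s12 _ (frame_base_continuous fX).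
  by apply: (der_within (dX := fun t => 'D_1 sigma1 t)) => t _; exact/derivableP.
- apply: glue_continuous.
  + by rewrite X20 mul1mx.
  + exact: (der_within H4).
  + by move=> t; apply: cvg_mulmx; [exact: (frame_continuous fX)|exact: cvg_cst].
- move=> t t01 /sE[t2 ts]; case: (ltgtP t 2^-1) t2 => // t2 _.
    have gl := glue_left sigma1 sigma2 t2.
    have [+ _] := der_mx_affine (derivableP (H2 (2 * t + 0))).
    by apply: near_eq_derivable; apply: filterS gl.
  have gl := glue_right sigma1 sigma2 t2.
  have t01' : 0 < 2 * t + (-1) < 1 by lra.
  have [+ _] := der_mx_affine (derivableP (frame_base_derivable fX t01' ts)).
  by apply: near_eq_derivable; apply: filterS gl.
- move=> t t01 /sE[t2 ts]; case: (ltgtP t 2^-1) t2 => // t2 _.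
    have gl := glue_left X1 (fun t => X2 t *m P) t2.
    have t01' : 0 <= 2 * t + 0 <= 1 by lra.
    have D := der_mx_affine (H4 _ t01').
    have gls : \near t, X1 (2 * t + 0) = glue X1 (fun t => X2 t *m P) t.
      by apply: filterS gl.
    apply: (near_eq_is_derive gls); apply: der_ext D _ _ => //.
    by rewrite dL // /glue (ltW t2) -!scalemxAl.
  have gl := glue_right X1 (fun t => X2 t *m P) t2.
  have t01' : 0 < 2 * t + (-1) < 1 by lra.
  have D := der_mulmx (der_mx_affine (frame_derive fX t01' ts)) (der_mxcst P t).
  have gls : \near t, X2 (2 * t + (-1)) *m P = glue X1 (fun t => X2 t *m P) t.
    by apply: filterS gl.
  apply: (near_eq_is_derive gls); apply: der_ext D _ _ => //.
  rewrite dR //; last by apply: (frame_base_derivable fX).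
  by rewrite /glue leNgt t2 /= mulmx0 addr0 -!scalemxAl !mulmxA.
- move=> t t01 /sE[t2 ts]; case: (ltgtP t 2^-1) t2 => // t2 _.
    rewrite /prop_for /continuous_at dL //.
    apply: cvg_trans (_ : 2 *: derive1 sigma1 (2 * u + 0) @[u --> t] --> _); last first.
      apply: cvgZ; first exact: cvg_cst.
      have ca := @affine_continuous R 2 0 t.
      exact: (cvg_comp (fun s : R => 2 * s + 0) (derive1 sigma1) ca (H3 _)).
    apply: near_eq_cvg; near=> u; rewrite dL //.
    by near: u; exact: lt_nbhsl.
  have t01' : 0 < 2 * t + (-1) < 1 by lra.
  rewrite /prop_for /continuous_at dR //; last by apply: (frame_base_derivable fX).
  apply: cvg_trans (_ : 2 *: derive1 sigma2 (2 * u + (-1)) @[u --> t] --> _); last first.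
    apply: cvgZ; first exact: cvg_cst.
    have ca := @affine_continuous R 2 (-1) t.
    exact: (cvg_comp (fun s : R => 2 * s + (-1)) (derive1 sigma2) ca
      (ps_continuous ps t01' ts)).
  apply: near_eq_cvg; near=> u; rewrite dR //.
    by near: u; exact: lt_nbhsr.
  apply: (frame_base_derivable fX).
    have ut : u < 1 by near: u; apply: lt_nbhsl; lra.
    have u2 : 2^-1 < u by near: u; exact: lt_nbhsr.
    lra.
  suff : u \notin s by move=> /sE[].
  near: u; apply: near_notin; rewrite in_cons negb_or gt_eqF //=.
  apply: contra ts => /mapP[u0 u0s ->].
  by have -> : 2 * ((u0 + 1) / 2) + -1 = u0 by field.
- move=> t t01; case: (ltP t 2^-1) => t2.
    apply/cvg_ex; exists (2 *: derive1 sigma1 (2 * t + 0)).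
    have H : 2 *: derive1 sigma1 (2 * u + 0) @[u --> t^'+] -->
        2 *: derive1 sigma1 (2 * t + 0).
      apply: cvgZ; first exact: cvg_cst.
      apply: (cvg_comp (fun s : R => 2 * s + 0) (derive1 sigma1) _ (H3 _)).
      by apply: cvg_within_filter; exact: affine_continuous.
    apply: cvg_trans H; apply: near_eq_cvg.
    by apply: filterS (nbhs_right_lt t2) => u u2; rewrite dL.
  have t01' : 0 <= 2 * t + (-1) < 1 by lra.
  have /cvg_ex[l Hl] := ps_right ps t01'.
  apply/cvg_ex; exists (2 *: l).
  have H : 2 *: derive1 sigma2 (2 * u + (-1)) @[u --> t^'+] --> 2 *: l.
    apply: cvgZ; first exact: cvg_cst.
    exact: (cvg_comp (fun s : R => 2 * s + (-1)) (derive1 sigma2)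
      (@affine_right _ t (-1)) Hl).
  apply: cvg_trans H; apply: near_eq_cvg.
  have t1 : t < 1 by lra.
  apply: filterS3 (nbhs_right_gt t) (nbhs_right_lt t1) (right_notin s t) => u tu u1 us.
  rewrite dR //; first exact: le_lt_trans t2 tu.
  by apply: (frame_base_derivable fX); [lra|have [] := sE _ us].
- move=> t t01; case: (leP t 2^-1) => t2.
    apply/cvg_ex; exists (2 *: derive1 sigma1 (2 * t + 0)).
    have H : 2 *: derive1 sigma1 (2 * u + 0) @[u --> t^'-] -->
        2 *: derive1 sigma1 (2 * t + 0).
      apply: cvgZ; first exact: cvg_cst.
      apply: (cvg_comp (fun s : R => 2 * s + 0) (derive1 sigma1) _ (H3 _)).
      by apply: cvg_within_filter; exact: affine_continuous.
    apply: cvg_trans H; apply: near_eq_cvg.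
    by apply: filterS (nbhs_left_lt t) => u ut; rewrite dL //; exact: lt_le_trans ut t2.
  have t01' : 0 < 2 * t + (-1) <= 1 by lra.
  have /cvg_ex[l Hl] := ps_left ps t01'.
  apply/cvg_ex; exists (2 *: l).
  have H : 2 *: derive1 sigma2 (2 * u + (-1)) @[u --> t^'-] --> 2 *: l.
    apply: cvgZ; first exact: cvg_cst.
    exact: (cvg_comp (fun s : R => 2 * s + (-1)) (derive1 sigma2)
      (@affine_left _ t (-1)) Hl).
  apply: cvg_trans H; apply: near_eq_cvg.
  apply: filterS3 (nbhs_left_gt t2) (nbhs_left_lt t) (left_notin s t) => u u2 ut us.
  rewrite dR //.
  by apply: (frame_base_derivable fX); [lra|have [] := sE _ us].
Unshelve. all: by end_near. Qed.

Lemma chain_frame x y P : chain x y P -> exists sigma s X,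
  [/\ frame sigma s X, piecewise_smooth sigma s &
   [/\ sigma 0 = x, sigma 1 = y, X 0 = 1%:M & X 1 = P]].
Proof.
elim=> [{}x Ux|{}x y' {}y P1 P2 p c [sigma2 [s2 [X2 [fX ps [E0 E1 E2 E3]]]]]].
  exists (fun=> x), [::], (fun=> 1%:M).
  have d1 : derive1 (fun _ : R => x) = fun=> 0 by apply/funext => t; rewrite derive1_cst.
  split; last by [].
    split=> [//| | |t _ _|t _ _].
    - by apply: continuous_subspaceT => t; exact: cvg_cst.
    - by apply: continuous_subspaceT => t; exact: cvg_cst.
    - exact: derivable_cst.
    - by rewrite d1 mul0mx; exact: der_mxcst.
  split=> [t _ _|t _|t _]; rewrite d1.
  - exact: cst_continuous.
  - by apply/cvg_ex; exists 0; exact: cvg_cst.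
  - by apply/cvg_ex; exists 0; exact: cvg_cst.
move: p => [sigma1 [X1 [[H1 H2 H3 H4] [F0 F1 F2 F3]]]].
have s12 : sigma1 1 = sigma2 0 by rewrite F1 E0.
have [G1 G2] := glue_frame H1 H2 H3 H4 fX ps s12 E2.
do 3 eexists; split; [exact: G1|exact: G2|].
have l0 : (0 : R) <= 2^-1 by rewrite invr_ge0.
have l1 : (1 : R) <= 2^-1 = false by apply: negbTE; rewrite -ltNge; lra.
have e1 : 2 * 1 + -1 = 1 :> R by lra.
by rewrite /glue l0 l1 e1 mulr0 addr0 F0 F2 F3 E1 E3.
Qed.

End Chains.

(** * Densities given by formulas *)

Section Coordinates.
Context {R : realType} {n : nat}.
Local Notation E := 'cV[R]_n.
Variable U : set E.
Hypothesis oU : open U.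

Lemma derive_coord (x v : E) i : 'D_v (fun y : E => y i 0) x = v i 0.
Proof.
have did : derivable (@id E) x v by exact: derivable_id.
have := derive_mx did; rewrite derive_id => /matrixP/(_ i 0).
by rewrite mxE.
Qed.

Lemma Ck_coord k i : Ck k U (fun y : E => y i 0).
Proof.
case: k => [|k] /=.
  by move=> x _; exact: coord_continuous.
split=> [x _|v]; first exact: differentiable_coord.
apply: (Ck_ext oU) (Ck_cst oU k (v i 0)) => x _.
by rewrite derive_coord.
Qed.

Lemma Ck_sum (I : Type) (r : seq I) (f : I -> E -> R) k :
  (forall i, Ck k U (f i)) -> Ck k U (fun x => \sum_(i <- r) f i x).
Proof.
move=> H; elim: r => [|i r IH].
  by apply: (Ck_ext oU) (Ck_cst oU k (0 : R)) => x _; rewrite big_nil.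
by apply: (Ck_ext oU) (CkD oU (H i) IH) => x _; rewrite big_cons.
Qed.

(** Reduces directional derivatives to derivatives on the real line, where the rules
    above apply. *)
Lemma derive_line (f : E -> R) (x u : E) d :
  is_derive (0 : R) 1 (fun h : R => f (h *: u + x)) d -> 'D_u f x = d.
Proof.
move=> [_ <-]; rewrite /derive; congr (lim _).
apply/seteqP; split=> P; apply: near_eq_cvg; apply: nearW => h /=;
  by rewrite addr0 [_%:A]mulr1 scale0r add0r.
Qed.

Lemma unit_ball_coord (x : E) i : unit_ball x -> `|x i 0| < 1.
Proof.
move=> Ux; apply: le_lt_trans Ux; rewrite [leRHS]/Num.Def.normr /= mx_normrE.
exact: (le_bigmax _ (fun ij : 'I_n * 'I_1 => `|x ij.1 ij.2|) (i, 0)).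
Qed.

Lemma unit_ballP (x : E) : (forall i, `|x i 0| < 1) -> unit_ball x.
Proof.
move=> H; rewrite /unit_ball /= [ltLHS]/Num.Def.normr /= mx_normrE.
by apply: bigmax_lt => // -[i j] _ /=; rewrite ord1.
Qed.

End Coordinates.

(** A group that contains an arc of a one-parameter group near the identity
    contains all of it: [F t] is a power of [F (t / N)]. *)
Lemma one_parameter_subgroup (R : archiRealFieldType) n (H : 'M[R]_n -> Prop)
    (F : R -> 'M[R]_n) (d : R) : 0 < d ->
  H 1%:M -> (forall A B, H A -> H B -> H (A *m B)) ->
  (forall s t, F (s + t) = F s *m F t) -> F 0 = 1%:M ->
  (forall t, 0 <= t <= d -> H (F t)) -> (forall t, H (F t) -> H (F (- t))) ->
  forall t, H (F t).
Proof.
move=> d0 H1 HM FD F0 Hd HN.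
suff pos t : 0 <= t -> H (F t).
  move=> t; case: (leP 0 t) => [|t0]; first exact: pos.
  by rewrite -[t]opprK; apply: HN; apply: pos; rewrite oppr_ge0 ltW.
move=> t0.
have Fn m s : H (F s) -> H (F (s *+ m)).
  move=> Hs; elim: m => [|m IH]; first by rewrite mulr0n F0.
  by rewrite mulrS FD; apply: HM.
pose N := (Num.bound (t / d)).+1.
have -> : t = t / N%:R *+ N by rewrite -mulr_natr divfK // pnatr_eq0.
apply/Fn/Hd; rewrite divr_ge0 //= ler_pdivrMr ?ltr0n // mulrC -ler_pdivrMr //.
have := archi_boundP (divr_ge0 t0 (ltW d0)); move=> /ltW /le_trans; apply.
by rewrite ler_nat.
Qed.

Section Holonomy.
Context {R : realType} {n : nat}.
Local Notation E := 'cV[R]_n.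
Variables (phi : E -> R) (eta : E -> 'rV[R]_n).
Hypothesis phi_smooth : smooth unit_ball phi.
Hypothesis etaE : forall x u, unit_ball x -> 'D_u phi x = (eta x *m u) 0 0.
Local Notation M := (flat_ball phi_smooth).

Lemma chain_holonomy (p : M) i B A :
  chain eta 0 (chart i p) B -> chain eta 0 0 A -> holonomy p i B A.
Proof.
move=> cB cA; have uB := chain_unit phi_smooth etaE cB.
have := chain_cat (chain_cat (chain_rev phi_smooth etaE cB) cA) cB.
move=> /chain_frame[sigma [s [X [fX ps [s0 s1 X0 X1]]]]].
have := frame_holonomy etaE uB fX ps s0 s1 X0 X1.
by rewrite !mulmxA mulVmx // mul1mx mulmxKV.
Qed.

Lemma holonomy_det (p : M) i B A : B \in unitmx -> holonomy p i B A -> \det A = 1.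
Proof.
move=> uB /(holonomy_frame etaE)[sigma [s [X [fX s0 s1 X0 X1]]]].
have := frame_det phi_smooth etaE fX (_ : 0 <= 1 <= 1); rewrite ler01 lexx => /(_ isT).
rewrite s0 s1 X0 X1 det_mulmx.
have e0 : expR (phi (chart i p)) != 0 by rewrite gt_eqF // expR_gt0.
move=> /(mulIf e0) /eqP; rewrite -[X in _ == X]mulr1 => /eqP/mulfI; apply.
by rewrite -unitfE -unitmxE.
Qed.

End Holonomy.

(** * A separable density with holonomy SL *)

Section Separable.
Context {R : realType}.

(** The critical points 0 and 1/2 of this polynomial, positive on ]-1, 1[, are the
    coordinates of the corners of the rectangles below. *)
Definition cubic (x : R) : R := 1 + x ^+ 2 / 4 - x ^+ 3 / 3.
Definition cubic' (x : R) : R := x * (2^-1 - x).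
Definition cubic_int (x : R) : R := x + x ^+ 3 / 12 - x ^+ 4 / 12.

Lemma cubic_gt0 x : `|x| < 1 -> 0 < cubic x.
Proof.
rewrite ltr_norml /cubic => /andP[x0 x1].
have x2 := sqr_ge0 x; have x21 : x ^+ 2 < 1 by nra.
have x3 : x ^+ 3 <= x ^+ 2 by rewrite exprS; nra.
lra.
Qed.

Lemma der_cubic (f : R -> R) (t df : R) : is_derive t 1 f df ->
  is_derive t 1 (fun s => cubic (f s)) (cubic' (f t) * df).
Proof.
move=> Hf; have H2 := derM Hf Hf; have H3 := derM H2 Hf.
apply: der_ext (derD (derD (derC 1 t) (derM H2 (derC (4^-1) t)))
  (derN (derM H3 (derC (3^-1) t)))) _ _ => [s|].
  by rewrite /cubic !exprS expr0; ring.
by rewrite /cubic'; field.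
Qed.

Lemma der_cubic_int (f : R -> R) (t df : R) : is_derive t 1 f df ->
  is_derive t 1 (fun s => cubic_int (f s)) (cubic (f t) * df).
Proof.
move=> Hf; have H2 := derM Hf Hf; have H3 := derM H2 Hf; have H4 := derM H3 Hf.
apply: der_ext (derD (derD Hf (derM H3 (derC (12^-1) t)))
  (derN (derM H4 (derC (12^-1) t)))) _ _ => [s|].
  by rewrite /cubic_int !exprS expr0; ring.
by rewrite /cubic; field.
Qed.

Context {n : nat}.
Local Notation E := 'cV[R]_n.

Definition sep_phi (x : E) : R := - \sum_i ln (cubic (x i 0)).
Definition sep_eta (x : E) : 'rV[R]_n := \row_j (- (cubic' (x j 0) / cubic (x j 0))).

Lemma sep_phi_smooth : smooth unit_ball sep_phi.
Proof.
move=> k; pose oU := @unit_ball_open R n.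
have cc (c : R) := Ck_cst oU k c.
have H i : Ck k unit_ball (fun x : E => ln (cubic (x i 0))).
  apply: Ck_comp_ln => //; first by move=> x /unit_ball_coord /cubic_gt0.
  have cx := Ck_coord oU k i; have c2 := CkM oU cx cx; have c3 := CkM oU c2 cx.
  apply: (Ck_ext oU) (CkD oU (CkD oU (cc 1) (CkM oU (cc 4^-1) c2))
    (CkM oU (cc (- 3^-1)) c3)) => x _.
  rewrite -![(_ + _ : _ -> _) _]/(_ + _) -![(_ * _ : _ -> _) _]/(_ * _) /cst /cubic.
  by rewrite !exprS expr0; ring.
apply: (Ck_ext oU) (CkM oU (cc (-1)) (Ck_sum oU (index_enum 'I_n) H)) => x _.
by rewrite -![(_ * _ : _ -> _) _]/(_ * _) /cst mulN1r.
Qed.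

Lemma sep_etaE (x u : E) : unit_ball x -> 'D_u sep_phi x = (sep_eta x *m u) 0 0.
Proof.
move=> Ux; apply: derive_line.
have H i (_ : true) : is_derive (0 : R) 1 (fun h : R => ln (cubic ((h *: u + x) i 0)))
    ((cubic (x i 0))^-1 * (cubic' (x i 0) * u i 0)).
  have D : is_derive (0 : R) 1 (fun h : R => (h *: u + x) i 0) (u i 0).
    apply: der_ext (derD (derM (derI 0) (derC (u i 0) 0)) (derC (x i 0) 0)) _ _.
      by move=> s; rewrite !mxE.
    by ring.
  have k0 : 0 < cubic (x i 0) by exact/cubic_gt0/unit_ball_coord.
  have e0 : ((0 : R) *: u + x) i 0 = x i 0 by rewrite scale0r add0r.
  have := der_cubic D; rewrite e0 => D2.
  apply: (derF (g := @ln R) (f := fun h : R => cubic ((h *: u + x) i 0)) _ D2).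
  by rewrite e0; exact: is_derive1_ln.
apply: der_ext (derN (der_sum (index_enum 'I_n) H)) _ _ => //.
rewrite mxE -sumrN; apply: eq_bigr => i _; rewrite mxE; ring.
Qed.

Definition axis_mx (j : 'I_n) (r : 'rV[R]_n) : 'M[R]_n :=
  1%:M + (delta_mx j 0 : 'cV[R]_n) *m r.

Lemma mul_axis_mxE j r (A : 'M[R]_n) a b :
  (axis_mx j r *m A) a b = A a b + (a == j)%:R * (r *m A) 0 b.
Proof.
rewrite /axis_mx mulmxDl mul1mx mxE -mulmxA; congr (_ + _).
by rewrite mxE big_ord1 mxE andbT.
Qed.

(** Along the axis [j] the equation is [W_j' = L (eta W)], the other components being
    constant.  Since [eta_j] is minus the logarithmic derivative of [cubic], the
    function [cubic(y) W_j] of the [j]-th coordinate [y] has derivative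
    [cubic(y)] times a constant, which integrates by [cubic_int]. *)
Lemma axis_piece x j (L : R) :
  unit_ball x -> unit_ball (x + L *: delta_mx j 0) ->
  let y := x j 0 + L in
  piece sep_eta x (x + L *: delta_mx j 0)
   (axis_mx j (\row_l (if l == j then cubic (x j 0) / cubic y - 1
               else sep_eta x 0 l * (cubic_int y - cubic_int (x j 0)) / cubic y))).
Proof.
move=> Ux Uy y.
pose r (t : R) : 'rV[R]_n := \row_l (if l == j then cubic (x j 0) / cubic (L * t + x j 0) - 1
   else sep_eta x 0 l * (cubic_int (L * t + x j 0) - cubic_int (x j 0)) / cubic (L * t + x j 0)).
pose sigma (t : R) : E := x + (L * t) *: delta_mx j 0.
have sj t : sigma t j 0 = L * t + x j 0 by rewrite !mxE !eqxx mulr1 addrC.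
have sl t l : l != j -> sigma t l 0 = x l 0.
  by move=> lj; rewrite !mxE (negPf lj) mulr0 addr0.
have Us (t : R) : 0 <= t <= 1 -> unit_ball (sigma t).
  move=> /andP[t0 t1]; have -> : sigma t = (1 - t) *: x + t *: (x + L *: delta_mx j 0).
    by rewrite /sigma scalerDr addrA -scalerDl subrK scale1r scalerA [t * L]mulrC.
  rewrite /unit_ball /=; apply: le_lt_trans (ler_normD _ _) _.
  rewrite !normrZ !ger0_norm ?subr_ge0 //.
  have xm : `|x| <= Num.max `|x| `|x + L *: delta_mx j 0| by rewrite le_max lexx.
  have ym : `|x + L *: delta_mx j 0| <= Num.max `|x| `|x + L *: delta_mx j 0|.
    by rewrite le_max lexx orbT.
  have m1 : Num.max `|x| `|x + L *: delta_mx j 0| < 1 by rewrite gt_max Ux Uy.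
  apply: le_lt_trans m1; nra.
have ds (t : R) : is_derive t 1 sigma (L *: delta_mx j 0).
  have D := der_addmx (der_mxcst x t) (der_scalemx (derM (derC L t) (derI t))
    (der_mxcst (delta_mx j 0 : E) t)).
  apply: der_ext D _ _ => //.
  by rewrite scaler0 addr0 add0r mul0r add0r mulr1.
have d1 (t : R) : derive1 sigma t = L *: delta_mx j 0.
  by rewrite derive1E; have [_ ->] := ds t.
exists sigma, (fun t => axis_mx j (r t)); split; split.
- exact: Us.
- by move=> t; have [] := ds t.
- move=> t; rewrite /continuous_at d1; under eq_cvg do rewrite d1; exact: cvg_cst.
- move=> t t01; rewrite d1.
  have k0 l : 0 < cubic (sigma t l 0) by exact/cubic_gt0/unit_ball_coord/Us.
  have Dy : is_derive t 1 (fun s => L * s + x j 0) L by exact: der_affine.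
  have Dr : is_derive t 1 r (L *: (sep_eta (sigma t) *m axis_mx j (r t))).
    apply/der_mxP => i l; rewrite ord1.
    have kt : cubic (L * t + x j 0) != 0 by rewrite -sj gt_eqF.
    have Dk := derV (f := fun s => cubic (L * s + x j 0)) kt (der_cubic Dy).
    have rE : (sep_eta (sigma t) *m axis_mx j (r t)) 0 l =
        sep_eta (sigma t) 0 l + sep_eta (sigma t) 0 j * r t 0 l.
      rewrite mulmxDr mulmx1 mxE; congr (_ + _); rewrite mulmxA mxE big_ord1.
      congr (_ * _); rewrite mxE (bigD1 j) //= big1 ?mxE ?eqxx ?mulr1 ?addr0 // => l' lj.
      by rewrite [X in _ * X]mxE (negPf lj) mulr0.
    rewrite [X in is_derive _ _ _ X]mxE rE ![sep_eta (sigma t) 0 _]mxE sj.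
    case: (eqVneq l j) => [->|lj].
      apply: der_ext (derD (derM (derC (cubic (x j 0)) t) Dk) (derC (-1) t)) _ _.
        by move=> s; rewrite mxE eqxx.
      by rewrite sj mxE eqxx; field.
    rewrite sl //.
    apply: der_ext (derM (derM (derC (sep_eta x 0 l) t)
      (derD (der_cubic_int Dy) (derC (- cubic_int (x j 0)) t))) Dk) _ _.
      by move=> s; rewrite [RHS]mxE (negPf lj).
    have -> : r t 0 l = sep_eta x 0 l * (cubic_int (L * t + x j 0) - cubic_int (x j 0)) /
        cubic (L * t + x j 0) by rewrite mxE (negPf lj).
    rewrite ![sep_eta x 0 l]mxE.
    by field; rewrite kt -(sl t l lj) gt_eqF.
  apply: der_ext (der_addmx (der_mxcst 1%:M t)
    (der_mulmx (der_mxcst (delta_mx j 0 : E) t) Dr)) _ _ => //.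
  by rewrite add0r mul0mx add0r -scalemxAr -scalemxAl.
- by rewrite /sigma mulr0 scale0r addr0.
- by rewrite /sigma mulr1.
- rewrite /axis_mx (_ : r 0 = 0) ?mulmx0 ?addr0 //.
  apply/rowP => l; rewrite !mxE mulr0 add0r subrr mulr0 mul0r divff ?subrr ?if_same //.
  by rewrite gt_eqF //; exact/cubic_gt0/unit_ball_coord.
by congr axis_mx; apply/rowP => l; rewrite !mxE mulr1 [L + _]addrC.
Qed.
End Separable.

Section SpecialLinear.
Context {R : realType} {n : nat}.
Local Notation E := 'cV[R]_n.
Local Notation eta := (@sep_eta R n).
Local Notation phi_smooth := (@sep_phi_smooth R n).
Local Notation etaE := (@sep_etaE R n).

(** Change the coordinates one by one. *)
Lemma sep_chain_origin (p : E) : unit_ball p -> exists P, chain eta 0 p P.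
Proof.
move=> Up; pose q m : E := \col_i (if (i < m)%N then p i 0 else 0).
have Uq m : unit_ball (q m).
  apply: unit_ballP => i; rewrite mxE; case: ifP => _; last by rewrite normr0.
  exact: unit_ball_coord.
suff H m : (m <= n)%N -> exists P, chain eta 0 (q m) P.
  have [P cP] := H n (leqnn n); exists P.
  by have <- : q n = p; last exact: cP; apply/colP => i; rewrite mxE ltn_ord.
elim: m => [_|m IHm mn].
  exists 1%:M; have -> : q 0%N = 0 by apply/colP => i; rewrite !mxE.
  by apply: chain_nil; rewrite /unit_ball /= normr0.
have [P cP] := IHm (ltnW mn).
have qS : q m.+1 = q m + p (Ordinal mn) 0 *: delta_mx (Ordinal mn) 0.
  apply/colP => i; rewrite !mxE eqxx andbT -val_eqE /=.
  case: (ltngtP i m) => [im|im|im].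
  - by rewrite ltnS ltnW // mulr0 addr0.
  - by rewrite ltnS leqNgt im mulr0 addr0.
  rewrite im ltnSn mulr1 add0r; congr (p _ 0); exact: val_inj.
have Uy : unit_ball (q m + p (Ordinal mn) 0 *: delta_mx (Ordinal mn) 0).
  by rewrite -qS.
have := axis_piece (Uq m) Uy; rewrite -qS => pc.
by eexists; exact: chain_cat cP (piece_chain pc).
Qed.

Lemma cubic0 : cubic 0 = 1 :> R. Proof. by rewrite /cubic !expr0n /= !mul0r subr0 addr0. Qed.

Lemma cubic'0 : cubic' 0 = 0 :> R. Proof. by rewrite /cubic' mul0r. Qed.

Lemma cubic'_half : cubic' 2^-1 = 0 :> R. Proof. by rewrite /cubic' subrr mulr0. Qed.

(** Up to sign, the coefficient of the transvection obtained around the rectangle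
    with sides [a] and 1/2. *)
Definition shear_coef (a : R) : R :=
  cubic' a / cubic a ^+ 2 * (cubic_int 2^-1 - cubic_int 0).

(** On the sides parallel to [e_i], run at heights where [cubic'] vanishes, only
    [W_i] changes, by inverse factors on the two sides.  On the sides parallel to
    [e_j] the component [W_j] is rescaled by inverse factors as well, but only the
    side at abscissa [a] adds to it a multiple of [W_i]. *)
Lemma rectangle_chain (i j : 'I_n) (a : R) : i != j -> 0 <= a <= 2^-1 ->
  chain eta 0 0 (transvection j i (- shear_coef a)).
Proof.
move=> ij a01; have ji : j != i by rewrite eq_sym.
pose ei : E := delta_mx i 0; pose ej : E := delta_mx j 0.
pose b : R := 2^-1.
have U0 s t : 0 <= s <= 2^-1 -> 0 <= t <= 2^-1 -> unit_ball (s *: ei + t *: ej).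
  move=> s01 t01; apply: unit_ballP => k; rewrite !mxE !eqxx !andbT.
  case: (eqVneq k i) => [->|ki].
    by rewrite (negPf ij) /= mulr1 mulr0 addr0 ger0_norm; lra.
  case: (eqVneq k j) => [_|kj] /=; first by rewrite mulr1 mulr0 add0r ger0_norm; lra.
  by rewrite !mulr0 addr0 normr0.
have b01 : 0 <= b <= 2^-1 by rewrite /b; lra.
have z01 : 0 <= (0 : R) <= 2^-1 by lra.
have x0 : (0 : E) = 0 *: ei + 0 *: ej by rewrite !scale0r addr0.
have E1 : 0 *: ei + 0 *: ej + a *: ei = a *: ei + 0 *: ej.
  by rewrite !scale0r !addr0 add0r.
have E2 : a *: ei + 0 *: ej + b *: ej = a *: ei + b *: ej.
  by rewrite scale0r addr0.
have E3 : a *: ei + b *: ej + (- a) *: ei = 0 *: ei + b *: ej.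
  by rewrite addrAC -scalerDl subrr.
have E4 : 0 *: ei + b *: ej + (- b) *: ej = 0 *: ei + 0 *: ej.
  by rewrite -addrA -scalerDl subrr.
have u1 : unit_ball (0 *: ei + 0 *: ej + a *: ei) by rewrite E1; exact: U0.
have u2 : unit_ball (a *: ei + 0 *: ej + b *: ej) by rewrite E2; exact: U0.
have u3 : unit_ball (a *: ei + b *: ej + (- a) *: ei) by rewrite E3; exact: U0.
have u4 : unit_ball (0 *: ei + b *: ej + (- b) *: ej) by rewrite E4; exact: U0.
have p1 := axis_piece (U0 _ _ z01 z01) u1; rewrite /= -/ei E1 in p1.
have p2 := axis_piece (U0 _ _ a01 z01) u2; rewrite /= -/ej E2 in p2.
have p3 := axis_piece (U0 _ _ a01 b01) u3; rewrite /= -/ei E3 in p3.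
have p4 := axis_piece (U0 _ _ z01 b01) u4; rewrite /= -/ej E4 in p4.
have := chain_cons p1 (chain_cons p2 (chain_cons p3 (piece_chain p4))).
have cE s t k : (s *: ei + t *: ej) k 0 = s * (k == i)%:R + t * (k == j)%:R.
  by rewrite !mxE !eqxx !andbT.
have etaE' s t k : eta (s *: ei + t *: ej) 0 k =
    - (cubic' (s * (k == i)%:R + t * (k == j)%:R) / cubic (s * (k == i)%:R + t * (k == j)%:R)).
  by rewrite mxE cE.
have ei1 s t : (s *: ei + t *: ej) i 0 = s.
  by rewrite cE eqxx (negPf ij) /= mulr1 mulr0 addr0.
have ej1 s t : (s *: ei + t *: ej) j 0 = t.
  by rewrite cE eqxx (negPf ji) /= mulr1 mulr0 add0r.
have eta0 s t k : k != i -> k != j -> eta (s *: ei + t *: ej) 0 k = 0.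
  by move=> ki kj; rewrite etaE' (negPf ki) (negPf kj) /= !mulr0 addr0 cubic'0 mul0r oppr0.
have etai s t : eta (s *: ei + t *: ej) 0 i = - (cubic' s / cubic s) by rewrite mxE ei1.
have etaj s t : eta (s *: ei + t *: ej) 0 j = - (cubic' t / cubic t) by rewrite mxE ej1.
rewrite !ei1 !ej1 !add0r !subrr.
have rowE2 c1 c2 (r : 'rV[R]_n) : r 0 i = c1 -> r 0 j = c2 ->
    (forall k, k != i -> k != j -> r 0 k = 0) ->
    r = c1 *: delta_mx 0 i + c2 *: delta_mx 0 j.
  move=> ri rj rk; apply/rowP => k; rewrite !mxE eqxx /=.
  case: (eqVneq k i) => [->|ki]; first by rewrite (negPf ij) /= mulr1 mulr0 addr0.
  case: (eqVneq k j) => [->|kj]; first by rewrite /= mulr1 mulr0 add0r.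
  by rewrite rk //= !mulr0 addr0.
have rowM c1 c2 (A : 'M[R]_n) l :
    ((c1 *: delta_mx 0 i + c2 *: delta_mx 0 j : 'rV[R]_n) *m A) 0 l
    = c1 * A i l + c2 * A j l.
  by rewrite mulmxDl -!scalemxAl -!rowE !mxE.
set r4 := \row_l _; set r3 := \row_l _; set r2 := \row_l _; set r1 := \row_l _.
have ka : 0 < cubic a by apply: cubic_gt0; rewrite ger0_norm; lra.
have kb : 0 < cubic b by apply: cubic_gt0; rewrite ger0_norm /b; lra.
have -> : r1 = ((cubic a)^-1 - 1) *: delta_mx 0 i + 0 *: delta_mx 0 j.
  apply: rowE2 => [||k ki kj]; rewrite mxE ?eqxx ?(negPf ji) ?(negPf ki).
  - by rewrite cubic0 mul1r.
  - by rewrite etaj cubic'0 mul0r oppr0 !mul0r.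
  - by rewrite eta0 // !mul0r.
have -> : r2 = (- (cubic' a / cubic a) * (cubic_int b - cubic_int 0) / cubic b) *: delta_mx 0 i +
    ((cubic b)^-1 - 1) *: delta_mx 0 j.
  apply: rowE2 => [||k ki kj]; rewrite mxE ?eqxx ?(negPf ij) ?(negPf kj).
  - by rewrite etai.
  - by rewrite cubic0 mul1r.
  - by rewrite eta0 // !mul0r.
have -> : r3 = (cubic a - 1) *: delta_mx 0 i + 0 *: delta_mx 0 j.
  apply: rowE2 => [||k ki kj]; rewrite mxE ?eqxx ?(negPf ji) ?(negPf ki).
  - by rewrite cubic0 divr1.
  - by rewrite etaj cubic'_half mul0r oppr0 !mul0r.
  - by rewrite eta0 // !mul0r.
have -> : r4 = 0 *: delta_mx 0 i + (cubic b - 1) *: delta_mx 0 j.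
  apply: rowE2 => [||k ki kj]; rewrite mxE ?eqxx ?(negPf ij) ?(negPf kj).
  - by rewrite etai cubic'0 mul0r oppr0 !mul0r.
  - by rewrite cubic0 divr1.
  - by rewrite eta0 // !mul0r.
rewrite -x0; set P := (X in chain _ _ _ X -> _).
suff -> : P = transvection j i (- shear_coef a) by [].
rewrite {}/P -!mulmxA -[axis_mx i (((cubic a)^-1 - 1) *: _ + _)]mulmx1 -[RHS]mulmx1.
apply/matrixP => k l; rewrite mul_transvectionE.
rewrite !(mul_axis_mxE, rowM).
rewrite ?eqxx ?(negPf ij) ?(negPf ji) /shear_coef /=.
case: (eqVneq k i) => [->|ki]; first by rewrite (negPf ij) /=; field; rewrite !gt_eqF.
case: (eqVneq k j) => [->|kj] /=; last by ring.
by rewrite -/b; field; rewrite !gt_eqF.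
Qed.

(** By the intermediate value theorem on [0, 1/4], where [cubic'] is positive except
    at 0. *)
Lemma shear_coef_small : exists2 d : R, 0 < d &
  forall t, 0 <= t <= d -> exists2 a, 0 <= a <= 2^-1 & shear_coef a = t.
Proof.
have kp (a : R) : 0 <= a <= 2^-1 -> 0 < cubic a.
  by move=> a01; apply: cubic_gt0; rewrite ger0_norm; lra.
have K0 : 0 < cubic_int 2^-1 - cubic_int 0 :> R.
  rewrite /cubic_int !expr0n /= mul0r subr0 addr0 subr0 !exprS expr0; lra.
exists (shear_coef 4^-1).
  have k4 : 0 < cubic 4^-1 :> R by apply: kp; lra.
  have k4' : 0 < cubic' 4^-1 :> R by rewrite /cubic'; lra.
  by rewrite /shear_coef mulr_gt0 // divr_gt0 // exprn_gt0.
move=> t t01.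
have cs : {within `[0, 4^-1], continuous shear_coef}.
  apply: derivable_within_continuous => a; rewrite in_itv /= => a01.
  have ka : cubic a != 0 by rewrite gt_eqF // kp //; lra.
  have k2 : cubic a ^+ 2 != 0 by rewrite expf_neq0.
  have Dk := der_cubic (derI a).
  have Dk2 : is_derive a 1 (fun s =>
    cubic s ^+ 2) (cubic' a * 1 * cubic a + cubic a * (cubic' a * 1)).
    exact: der_ext (derM Dk Dk) _ _.
  have Dk' := derM (derI a) (derD (derC 2^-1 a) (derN (derI a))).
  have [+ _] := derM (derM Dk' (derV (f := fun s => cubic s ^+ 2) k2 Dk2))
    (derC (cubic_int 2^-1 - cubic_int 0) a).
  by [].
have le4 : (0 : R) <= 4^-1 by lra.
have g0 : shear_coef 0 = 0 by rewrite /shear_coef cubic'0 !mul0r.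
have [|a] := @IVT R shear_coef 0 4^-1 t le4 cs.
  rewrite g0; have /andP[t0 t1] := t01.
  by rewrite ge_min t0 le_max t1 orbT.
rewrite in_itv /= => a01 <-; exists a => //; lra.
Qed.

Theorem flat_ball_holonomy_SL : holonomy_is (flat_ball phi_smooth) (SL R n).
Proof.
move=> p; have [P cP] := sep_chain_origin (to_ballP (p : E)).
have uP := chain_unit phi_smooth etaE cP.
exists tt, P; split; [by []|exact: uP|].
apply/seteqP; split=> A; first exact: (holonomy_det etaE uP).
move=> /= dA; apply: (chain_holonomy etaE); first exact: cP.
have U0 : unit_ball (0 : E) by rewrite /unit_ball /= normr0.
apply: (SL_generated (H := chain eta 0 0)) dA; first exact: chain_nil.
  by move=> B C cB cC; exact: chain_cat cC cB.
move=> i j t ij.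
have TD s u : transvection i j (s + u) = transvection i j s *m transvection i j u :> 'M[R]_n.
  apply/matrixP => a b; rewrite -[transvection i j u]mulmx1 -[transvection i j (s + u)]mulmx1.
  have ji : (j == i) = false by rewrite eq_sym (negPf ij).
  by rewrite !mul_transvectionE ji mul0r addr0; ring.
have T0 : transvection i j 0 = 1%:M :> 'M[R]_n by rewrite /transvection scale0r addr0.
have TN u : chain eta 0 0 (transvection i j u) -> chain eta 0 0 (transvection i j (- u)).
  move=> c; have := chain_rev phi_smooth etaE c.
  suff -> : invmx (transvection i j u) = transvection i j (- u) by [].
  have uT := chain_unit phi_smooth etaE c.
  by apply: (can_inj (mulKmx uT)); rewrite mulmxV // -TD subrr T0.
have [d d0 Hd] := shear_coef_small.
have ji : j != i by rewrite eq_sym.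
apply: (one_parameter_subgroup (F := transvection i j) d0) => //.
- exact: chain_nil.
- by move=> B C cB cC; exact: chain_cat cC cB.
move=> u /Hd[a a01 <-]; rewrite -[shear_coef a]opprK; apply: TN.
exact: rectangle_chain.
Qed.

End SpecialLinear.

(** * Densities of constant curvature *)

(** Rotations and boosts are treated at once: [gcos] and [gsin] are circular for
    [e = 1] and hyperbolic for [e = -1]. *)
Section Trigonometry.
Context {R : realType}.
Implicit Types e t u : R.

Definition gcos e t : R := if e == 1 then cos t else (expR t + expR (- t)) / 2.
Definition gsin e t : R := if e == 1 then sin t else (expR t - expR (- t)) / 2.

Lemma gcos0 e : gcos e 0 = 1.
Proof. by rewrite /gcos; case: ifP => _; rewrite ?cos0 // oppr0 expR0; field. Qed.

Lemma gsin0 e : gsin e 0 = 0.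
Proof. by rewrite /gsin; case: ifP => _; rewrite ?sin0 // oppr0 expR0; field. Qed.

Variable e : R.
Hypothesis e1 : e = 1 \/ e = -1.

Let m1N1 : (-1 == 1 :> R) = false.
Proof. by apply/negbTE/eqP => H; suff : False by []; lra. Qed.

Lemma der_expN t : is_derive t 1 (fun s : R => expR (- s)) (- expR (- t)).
Proof. by apply: der_ext (derF (is_derive_expR (- t)) (derN (derI t))) _ _ => //; ring. Qed.

Lemma der_gcos t : is_derive t 1 (gcos e) (- e * gsin e t).
Proof.
case: e1 => ->; rewrite /gcos /gsin ?eqxx ?m1N1.
  by apply: der_ext (is_derive_cos t) _ _ => //; ring.
apply: der_ext (derM (derD (is_derive_expR t) (der_expN t)) (derC 2^-1 t)) _ _ => //.
by ring.
Qed.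

Lemma der_gsin t : is_derive t 1 (gsin e) (gcos e t).
Proof.
case: e1 => ->; rewrite /gcos /gsin ?eqxx ?m1N1.
  by apply: der_ext (is_derive_sin t) _ _.
apply: der_ext (derM (derD (is_derive_expR t) (derN (der_expN t))) (derC 2^-1 t)) _ _ => //.
by ring.
Qed.

Lemma gcos2Dgsin2 t : gcos e t ^+ 2 + e * gsin e t ^+ 2 = 1.
Proof.
case: e1 => ->; rewrite /gcos /gsin ?eqxx ?m1N1; first by rewrite mul1r cos2Dsin2.
have H : expR t * expR (- t) = 1 by rewrite -expRD subrr expR0.
by transitivity (expR t * expR (- t)) => //; field.
Qed.

Lemma gcosD t u : gcos e (t + u) = gcos e t * gcos e u - e * gsin e t * gsin e u.
Proof.
case: e1 => ->; rewrite /gcos /gsin ?eqxx ?m1N1; first by rewrite cosD; ring.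
by rewrite opprD !expRD; field.
Qed.

Lemma gsinD t u : gsin e (t + u) = gsin e t * gcos e u + gcos e t * gsin e u.
Proof.
case: e1 => ->; rewrite /gcos /gsin ?eqxx ?m1N1; first by rewrite sinD; ring.
by rewrite opprD !expRD; field.
Qed.

Lemma gcos_gsin_bound t : -1 <= t <= 1 ->
  `|gcos e t| <= expR 1 /\ `|gsin e t| <= expR 1.
Proof.
move=> t1; have ee : 1 <= expR 1 :> R by rewrite -expR0 ler_expR.
case: e1 => ->; rewrite /gcos /gsin ?eqxx ?m1N1.
  split; apply: le_trans ee; rewrite ler_norml.
    by rewrite cos_geN1 cos_le1.
  by rewrite sin_geN1 sin_le1.
have H1 : expR t <= expR 1 by rewrite ler_expR; lra.
have H2 : expR (- t) <= expR 1 by rewrite ler_expR; lra.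
have := expR_gt0 t; have := expR_gt0 (- t).
by rewrite !ler_norml; split; lra.
Qed.

(** The points of the hyperbola with [c > 0] are parametrized by
    [t = ln (c + s)]. *)
Lemma gcos_gsin_onto c s : c ^+ 2 + e * s ^+ 2 = 1 -> (e != 1 -> 0 < c) ->
  exists t, gcos e t = c /\ gsin e t = s.
Proof.
case: e1 => ->; rewrite /gcos /gsin ?eqxx ?m1N1.
  rewrite mul1r => cs _.
  have c1 : -1 <= c <= 1 by have := sqr_ge0 s; nra.
  have [s0|s0] := leP 0 s; [exists (acos c)|exists (- acos c)].
    rewrite acosK // sin_acos //; split=> //.
    by rewrite (_ : 1 - c ^+ 2 = s ^+ 2) ?sqrtr_sqr ?ger0_norm // -cs; ring.
  rewrite cosN acosK // sinN sin_acos //; split=> //.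
  rewrite (_ : 1 - c ^+ 2 = s ^+ 2) ?sqrtr_sqr ?ltr0_norm ?opprK //.
  by rewrite -cs; ring.
rewrite mulN1r => cs /(_ isT) c0.
have cs0 : 0 < c + s by nra.
exists (ln (c + s)); rewrite expRN lnK //.
have -> : (c + s)^-1 = c - s.
  by apply: (mulfI (lt0r_neq0 cs0)); rewrite divff ?lt0r_neq0 // -cs; ring.
by split; field.
Qed.

End Trigonometry.

Section Klein.
Context {R : realType} {n : nat}.
Local Notation E := 'cV[R]_n.
Variable J : 'I_n -> R.
Hypothesis JJ : forall i, J i * J i = 1.
Implicit Types x y : E.

(** Any constant larger than [n] keeps [klein_denom] positive on the unit ball of the
    sup norm. *)
Definition radius_sqr : R := n.+1%:R.
Definition quad x : R := \sum_i J i * x i 0 ^+ 2.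
Definition klein_denom x : R := radius_sqr + quad x.
Definition dual_row x : 'rV[R]_n := \row_i (J i * x i 0).
Definition klein_phi x : R := 2^-1 * ln (klein_denom x).
Definition klein_eta x : 'rV[R]_n := (klein_denom x)^-1 *: dual_row x.

Lemma klein_denom_gt0 x : unit_ball x -> 0 < klein_denom x.
Proof.
move=> Ux; rewrite /klein_denom /radius_sqr.
have : - (n%:R) <= quad x.
  rewrite /quad -[n in n%:R]card_ord -sum1_card natr_sum -sumrN; apply: ler_sum => i _.
  have := unit_ball_coord i Ux; rewrite ltr_norml => xi.
  have x2 : x i 0 ^+ 2 <= 1 by nra.
  have := sqr_ge0 (x i 0).
  by have [->|->] := sign_cases JJ i; lra.
rewrite -natr1; lra.
Qed.

Lemma klein_phi_smooth : smooth unit_ball klein_phi.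
Proof.
move=> k; pose oU := @unit_ball_open R n.
have cc (c : R) := Ck_cst oU k c.
have H : Ck k unit_ball (fun x : E => ln (klein_denom x)).
  apply: Ck_comp_ln => //; first by move=> x /klein_denom_gt0.
  have HJ i : Ck k unit_ball (fun x : E => J i * x i 0 ^+ 2).
    have cx := Ck_coord oU k i.
    apply: (Ck_ext oU) (CkM oU (cc (J i)) (CkM oU cx cx)) => x _.
    by rewrite -![(_ * _ : _ -> _) _]/(_ * _) /cst expr2.
  exact: (Ck_ext oU) (CkD oU (cc radius_sqr) (Ck_sum oU (index_enum 'I_n) HJ)).
exact: (Ck_ext oU) (CkM oU (cc (2^-1)) H).
Qed.

Lemma mul_dual_rowE x (m : nat) (A : 'M[R]_(n, m)) a b :
  (dual_row x *m A) a b = \sum_i J i * x i 0 * A i b.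
Proof. by rewrite mxE; apply: eq_bigr => i _; rewrite mxE. Qed.

Lemma der_quad (sigma : R -> E) (t : R) v : is_derive t 1 sigma v ->
  is_derive t 1 (fun s => quad (sigma s)) (2 * (dual_row (sigma t) *m v) 0 0).
Proof.
move=> /der_mxP H.
have Hi i (_ : true) := derM (derC (J i) t) (derM (H i 0) (H i 0)).
apply: der_ext (der_sum (index_enum 'I_n) Hi) _ _ => //.
by rewrite mul_dual_rowE mulr_sumr; apply: eq_bigr => i _; ring.
Qed.

Lemma der_klein_denom (sigma : R -> E) (t : R) v : is_derive t 1 sigma v ->
  is_derive t 1 (fun s => klein_denom (sigma s)) (2 * (dual_row (sigma t) *m v) 0 0).
Proof. by move=> /der_quad H; apply: der_ext (derD (derC radius_sqr t) H) _ _ => //; ring. Qed.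

Lemma klein_etaE x u : unit_ball x -> 'D_u klein_phi x = (klein_eta x *m u) 0 0.
Proof.
move=> Ux; apply: derive_line.
have Dl : is_derive (0 : R) 1 (fun h : R => h *: u + x) u.
  apply: der_ext (der_addmx (der_scalemx (derI 0) (der_mxcst u 0)) (der_mxcst x 0)) _ _ => //.
  by rewrite scale1r scaler0 !addr0.
have D2 := der_klein_denom Dl.
have e0 : (0 : R) *: u + x = x by rewrite scale0r add0r.
have Dln : is_derive (klein_denom ((0 : R) *: u + x)) 1 (@ln R) (klein_denom ((0 : R) *: u + x))^-1.
  by apply: is_derive1_ln; rewrite e0; exact: klein_denom_gt0.
have := derM (derC 2^-1 0) (derF (f := fun h : R => klein_denom (h *: u + x)) Dln D2).
rewrite e0 => D3; apply: der_ext D3 _ _ => //.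
by rewrite -scalemxAl [RHS]mxE; field; rewrite gt_eqF // klein_denom_gt0.
Qed.

Definition radius : R := Num.sqrt radius_sqr.
Definition klein_root x : R := Num.sqrt (klein_denom x).
(** The frame [klein_frame] is orthonormal for the parallel metric
    ([klein_metric_frame]) and is also radial parallel translation from the origin
    ([radial_piece]).  Its coefficient [c] solves [c^2 radius^2 quad + 2 c radius^2 = 1],
    a quadratic equation whose root is written here without division by [quad]. *)
Definition klein_frame_coef x : R := (radius * (radius + klein_root x))^-1.
Definition klein_frame x : 'M[R]_n := 1%:M + klein_frame_coef x *: (x *m dual_row x).
Definition klein_frame_inv x : 'M[R]_n :=
  1%:M - (klein_root x * (radius + klein_root x))^-1 *: (x *m dual_row x).

Lemma radius_gt0 : 0 < radius. Proof. by rewrite sqrtr_gt0 /radius_sqr. Qed.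

Lemma sqr_radius : radius ^+ 2 = radius_sqr.
Proof. by rewrite sqr_sqrtr // /radius_sqr. Qed.

Lemma klein_root_gt0 x : unit_ball x -> 0 < klein_root x.
Proof. by move=> /klein_denom_gt0; rewrite sqrtr_gt0. Qed.

Lemma sqr_klein_root x : unit_ball x -> klein_root x ^+ 2 = klein_denom x.
Proof. by move=> /klein_denom_gt0/ltW H; rewrite sqr_sqrtr. Qed.

Lemma quad_klein_root x : unit_ball x -> quad x = klein_root x ^+ 2 - radius ^+ 2.
Proof. by move=> Ux; rewrite sqr_klein_root // sqr_radius /klein_denom; ring. Qed.

Lemma dual_row_self x : dual_row x *m x = (quad x)%:M.
Proof.
rewrite [LHS]mx11_scalar; congr _%:M; rewrite mul_dual_rowE; apply: eq_bigr => i _; ring.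
Qed.

(** Both matrices are of the form 1 + c N where N is [x *m dual_row x], and
    N^2 = quad N. *)
Lemma klein_frame_invK x : unit_ball x -> klein_frame_inv x *m klein_frame x = 1%:M.
Proof.
move=> Ux; set N := x *m dual_row x.
have NN : N *m N = quad x *: N.
  by rewrite /N mulmxA -(mulmxA x) dual_row_self mul_mx_scalar scalemxAl.
rewrite /klein_frame /klein_frame_inv mulmxBl !mulmxDr !mulmx1 !mul1mx -scalemxAl -scalemxAr -/N NN.
rewrite !scalerA -addrA -[RHS]addr0; congr (_ + _).
rewrite -scalerDl -scalerBl quad_klein_root // /klein_frame_coef.
have a0 := radius_gt0; have d0 := klein_root_gt0 Ux.
rewrite (_ : _ - _ = 0) ?scale0r //.
by field; rewrite !gt_eqF //; lra.
Qed.

Lemma dual_row_klein_frame x : unit_ball x ->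
  dual_row x *m klein_frame x = (klein_root x / radius) *: dual_row x.
Proof.
move=> Ux; rewrite /klein_frame mulmxDr mulmx1 -scalemxAr mulmxA dual_row_self mul_scalar_mx.
rewrite scalerA -[X in X + _]scale1r -scalerDl quad_klein_root // /klein_frame_coef.
have a0 := radius_gt0; have d0 := klein_root_gt0 Ux.
by congr (_ *: _); field; rewrite !gt_eqF //; lra.
Qed.

Lemma klein_frame0 : klein_frame 0 = 1%:M.
Proof. by rewrite /klein_frame mul0mx scaler0 addr0. Qed.

Lemma der_klein_root (sigma : R -> E) (t : R) v : unit_ball (sigma t) -> is_derive t 1 sigma v ->
  is_derive t 1 (fun s => klein_root (sigma s)) ((dual_row (sigma t) *m v) 0 0 / klein_root (sigma t)).
Proof.
move=> Ut Ds; have D := der_klein_denom Ds; have D0 := klein_denom_gt0 Ut.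
have Dq := derF (f := fun s => klein_denom (sigma s)) (is_derive1_sqrt D0) D.
apply: der_ext Dq _ _ => //; rewrite -/(klein_root (sigma t)).
by have := klein_root_gt0 Ut => d0; field; rewrite gt_eqF.
Qed.

(** Along the radius the equation only involves the coefficient of
    [x *m dual_row x], and reduces to the derivative of [t^2 klein_frame_coef]. *)
Lemma radial_piece x : unit_ball x -> piece klein_eta 0 x (klein_frame x).
Proof.
move=> Ux; exists (fun t => t *: x), (fun t => klein_frame (t *: x)).
have ds (t : R) : is_derive t 1 (fun t : R => t *: x) x.
  apply: der_ext (der_scalemx (derI t) (der_mxcst x t)) _ _ => //.
  by rewrite scale1r scaler0 addr0.
have d1 (t : R) : derive1 (fun t : R => t *: x) t = x.
  by rewrite derive1E; have [_ ->] := ds t.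
have Us t : 0 <= t <= 1 -> unit_ball (t *: x) by move=> t01; exact: unit_ballZ.
have jZ (t : R) : dual_row (t *: x) = t *: dual_row x.
  by apply/rowP => i; rewrite !mxE; ring.
split; split.
- exact: Us.
- by move=> t; have [] := ds t.
- move=> t; rewrite /continuous_at d1; under eq_cvg do rewrite d1; exact: cvg_cst.
- move=> t t01; rewrite d1; cbv beta;
  rewrite /klein_eta -scalemxAl (dual_row_klein_frame (Us t t01)) jZ.
  have Ut := Us t t01; have a0 := radius_gt0; have d0 := klein_root_gt0 Ut.
  have Dd := der_klein_root Ut (ds t).
  rewrite jZ -scalemxAl dual_row_self !mxE eqxx mulr1n in Dd.
  have Dp := derM (derC radius t) (derD (derC radius t) Dd).
  have np : radius * (radius + klein_root (t *: x)) != 0 by rewrite gt_eqF // mulr_gt0 // addr_gt0.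
  have Dg := derM (derM (derI t) (derI t))
    (derV (f := fun s => radius * (radius + klein_root (s *: x))) np Dp).
  apply: der_ext (der_addmx (der_mxcst 1%:M t)
    (der_scalemx Dg (der_mxcst (x *m dual_row x) t))) _ _.
    move=> s /=; rewrite /klein_frame /klein_frame_coef jZ -scalemxAl -scalemxAr !scalerA.
    by congr (_ + _ *: _); rewrite -[RHS]mulrA mulrC.
  rewrite add0r scaler0 addr0 -!scalemxAr !scalerA; congr (_ *: _).
  have tQ : t * (t * quad x) = klein_root (t *: x) ^+ 2 - radius ^+ 2.
    rewrite -quad_klein_root // /quad !mulr_sumr; apply: eq_bigr => i _; rewrite mxE; ring.
  rewrite -sqr_klein_root //.
  transitivity (t * (2 * (radius + klein_root (t *: x)) * klein_root (t *: x) - t * (t * quad x)) /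
     (radius * (radius + klein_root (t *: x)) ^+ 2 * klein_root (t *: x))).
    by field; rewrite !gt_eqF //; lra.
  by rewrite tQ; field; rewrite !gt_eqF //; lra.
- by rewrite scale0r.
- by rewrite scale1r.
- by rewrite scale0r klein_frame0.
- by rewrite scale1r.
Qed.

End Klein.

(** * The holonomy of a constant curvature density is in SO+ *)

Lemma der_tr (R : realType) m n (X : R -> 'M[R]_(m, n)) (t : R) dX :
  is_derive t 1 X dX -> is_derive t 1 (fun s => (X s)^T) dX^T.
Proof.
move=> /der_mxP H; apply/der_mxP => i j.
by apply: der_ext (H j i) _ _ => [s|]; rewrite mxE.
Qed.

Section KleinUpper.
Context {R : realType} {n : nat}.
Local Notation E := 'cV[R]_n.
Variable J : 'I_n -> R.
Hypothesis JJ : forall i, J i * J i = 1.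
Implicit Types x y : E.
Local Notation frame := (parallel_frame (klein_eta J)).
Local Notation drow := (dual_row J).
Local Notation frm := (klein_frame J).
Local Notation frmV := (klein_frame_inv J).
Local Notation rad := (@radius R n).
Local Notation phi_smooth := (klein_phi_smooth JJ).
Local Notation etaE := (klein_etaE JJ).

Definition form_diag : 'M[R]_n := diag_mx (\row_i J i).

Lemma dual_row_mulmx x : drow x = x^T *m form_diag.
Proof.
apply/rowP => i; rewrite mul_mx_diag !mxE; ring.
Qed.

Lemma form_diag_tr : form_diag^T = form_diag. Proof. exact: tr_diag_mx. Qed.

Lemma dual_row_tr x : (drow x)^T = form_diag *m x.
Proof. by rewrite dual_row_mulmx trmx_mul trmxK form_diag_tr. Qed.

(** The constant curvature metric of Klein's projective model, expressed on the
    rescaled fields [exp(- phi) V]. *)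
Definition klein_metric x : 'M[R]_n :=
  form_diag - (klein_denom J x)^-1 *: ((drow x)^T *m drow x).

(** The coefficient of [(drow x)^T *m drow x] on the left is
    [2 c + c^2 quad - 1 / radius^2], which is zero by the choice of [c]. *)
Lemma klein_metric_frame x : unit_ball x ->
  (frm x)^T *m klein_metric x *m frm x = form_diag.
Proof.
move=> Ux; have a0 := @radius_gt0 R n; have d0 := klein_root_gt0 JJ Ux.
have jf := dual_row_klein_frame JJ Ux; have jft : (frm x)^T *m (drow x)^T =
  (klein_root J x / rad) *: (drow x)^T.
  by rewrite -trmx_mul jf linearZ /=.
have jj : (frm x)^T *m ((drow x)^T *m drow x) *m frm x =
    (klein_root J x / rad * (klein_root J x / rad)) *: ((drow x)^T *m drow x).
  by rewrite mulmxA jft -mulmxA jf -scalemxAl -scalemxAr scalerA.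
rewrite /klein_metric mulmxBr mulmxBl -!scalemxAr -!scalemxAl jj scalerA.
have -> : (frm x)^T *m form_diag *m frm x =
    form_diag + (klein_frame_coef J x * 2 + klein_frame_coef J x ^+ 2 * quad J x) *: ((drow x)^T *m drow x).
  have -> : (frm x)^T = 1%:M + klein_frame_coef J x *: ((drow x)^T *m x^T).
    by rewrite linearD linearZ /= trmx1 trmx_mul.
  set N := (drow x)^T *m drow x.
  have F1 : form_diag *m (x *m drow x) = N by rewrite mulmxA -dual_row_tr.
  have F2 : N *m (x *m drow x) = quad J x *: N.
    by rewrite /N -mulmxA (mulmxA (drow x)) dual_row_self mul_scalar_mx scalemxAr.
  rewrite mulmxDl mul1mx -scalemxAl -mulmxA -dual_row_mulmx -/N.
  rewrite /klein_frame mulmxDr mulmx1 -scalemxAr mulmxDl -scalemxAl F1 F2.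
  rewrite scalerDr !scalerA -addrA -!scalerDl.
  by congr (_ + _ *: _); ring.
rewrite -addrA -scalerBl -[RHS]addr0; congr (_ + _).
rewrite -(sqr_klein_root JJ Ux) quad_klein_root // /klein_frame_coef (_ : _ - _ = 0) ?scale0r //.
by field; rewrite !gt_eqF //; lra.
Qed.

Lemma cvg_dual_row (T : Type) (F : set_system T) {FF : Filter F} (f : T -> E) y :
  f @ F --> y -> drow (f t) @[t --> F] --> drow y.
Proof.
move=> H; apply: cvg_mx => i j; rewrite mxE; under eq_cvg do rewrite mxE.
by apply: cvgM; [exact: cvg_cst|exact: cvg_coord].
Qed.

Lemma cvg_klein_denom (T : Type) (F : set_system T) {FF : Filter F} (f : T -> E) y :
  f @ F --> y -> klein_denom J (f t) @[t --> F] --> klein_denom J y.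
Proof.
move=> H; apply: cvgD; first exact: cvg_cst.
apply: cvg_sumf => i _; apply: cvgM; first exact: cvg_cst.
under eq_cvg do rewrite expr2; rewrite expr2.
by apply: cvgM; exact: cvg_coord.
Qed.

Lemma cvg_klein_root (T : Type) (F : set_system T) {FF : Filter F} (f : T -> E) y :
  f @ F --> y -> klein_root J (f t) @[t --> F] --> klein_root J y.
Proof.
move=> H.
exact: (cvg_comp (fun t => klein_denom J (f t)) Num.sqrt (cvg_klein_denom H)
  (@sqrt_continuous R (klein_denom J y))).
Qed.

Lemma cvg_klein_frame_inv (T : Type) (F : set_system T) {FF : Filter F} (f : T -> E) y :
  unit_ball y -> f @ F --> y -> frmV (f t) @[t --> F] --> frmV y.
Proof.
move=> Uy H; have a0 := @radius_gt0 R n; have d0 := klein_root_gt0 JJ Uy.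
apply: cvgB; first exact: cvg_cst.
apply: cvgZ; last by apply: cvg_mulmx; [exact: H|exact: cvg_dual_row].
apply: cvgV; first by rewrite gt_eqF // mulr_gt0 // addr_gt0.
apply: cvgM; first exact: cvg_klein_root.
by apply: cvgD; [exact: cvg_cst|exact: cvg_klein_root].
Qed.

(** The metric [klein_metric] is parallel.  With [w] the row [drow sigma *m X], the
    derivatives of the two terms of [X^T klein_metric X] are the same multiple of
    [w^T v + v^T w], where [v] is [drow sigma' *m X]. *)
Lemma frame_klein_metric sigma s X u : frame sigma s X -> 0 <= u <= 1 ->
  (X u)^T *m klein_metric (sigma u) *m X u = (X 0)^T *m klein_metric (sigma 0) *m X 0.
Proof.
move=> fX /andP[u0 u1]; have Us := frame_dom fX; apply/esym.
pose w t := drow (sigma t) *m X t.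
pose f t := (X t)^T *m form_diag *m X t - (klein_denom J (sigma t))^-1 *: ((w t)^T *m w t).
have fE t : (X t)^T *m klein_metric (sigma t) *m X t = f t.
  rewrite /f /w /klein_metric mulmxBr mulmxBl -!scalemxAr -!scalemxAl trmx_mul.
  by rewrite !mulmxA.
rewrite !fE; apply/matrixP => a b.
apply: (@is_cst_off_finite _ (fun t => f t a b) s 0 u u0).
  have sub : `[0, u] `<=` `[0, 1] by move=> t /=; rewrite !in_itv /=; lra.
  have cX : {within `[0, u], continuous X}.
    exact: continuous_subspaceW sub (frame_continuous fX).
  have cs : {within `[0, u], continuous sigma}.
    exact: continuous_subspaceW sub (frame_base_continuous fX).
  apply/subspace_continuousP => t t0u.
  have Ut : unit_ball (sigma t) by apply: Us; move: (sub _ t0u); rewrite /= in_itv.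
  have cXt : X @ within `[0, u] (nbhs t) --> X t.
    by have /subspace_continuousP := cX; apply.
  have cst : sigma @ within `[0, u] (nbhs t) --> sigma t.
    by have /subspace_continuousP := cs; apply.
  have ctr m1 m2 (g : R -> 'M[R]_(m1, m2)) (l : 'M[R]_(m1, m2)) :
      g @ within `[0, u] (nbhs t) --> l -> (g t)^T @[t --> within `[0, u] (nbhs t)] --> l^T.
    move=> H; apply: cvg_mx => i j; rewrite mxE; under eq_cvg do rewrite mxE.
    exact: cvg_coord.
  have cw : w @ within `[0, u] (nbhs t) --> w t.
    by apply: cvg_mulmx => //; exact: cvg_dual_row.
  apply: cvg_coord; apply: cvgB.
    by apply: cvg_mulmx => //; apply: cvg_mulmx; [exact: ctr|exact: cvg_cst].
  apply: cvgZ; last by apply: cvg_mulmx => //; exact: ctr.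
  by apply: cvgV; [rewrite gt_eqF // klein_denom_gt0|exact: cvg_klein_denom].
move=> t t0u ts; have t01 : 0 < t < 1 by lra.
have tc : 0 <= t <= 1 by lra.
have Ut := Us t tc; have D0 := klein_denom_gt0 JJ Ut.
have Dsig : is_derive t 1 sigma (derive1 sigma t).
  by rewrite derive1E; exact/derivableP/(frame_base_derivable fX).
have DX : is_derive t 1 X ((klein_denom J (sigma t))^-1 *: (derive1 sigma t *m w t)).
  apply: der_ext (frame_derive fX t01 ts) _ _ => //.
  by rewrite /klein_eta -scalemxAl -scalemxAr.
set s' := derive1 sigma t in Dsig DX; set D := klein_denom J (sigma t) in D0 DX.
pose v : 'rV[R]_n := drow s' *m X t.
pose m := (drow (sigma t) *m s') 0 0.
have Djr : is_derive t 1 (fun s => drow (sigma s)) (drow s').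
  apply: der_ext (der_mulmx (der_tr Dsig) (der_mxcst form_diag t)) _ _.
    by move=> s0; rewrite dual_row_mulmx.
  by rewrite mulmx0 addr0 dual_row_mulmx.
have Dw : is_derive t 1 w (v + (m / D) *: w t).
  apply: der_ext (der_mulmx Djr DX) _ _ => //.
  rewrite -/v -scalemxAr mulmxA [drow (sigma t) *m s']mx11_scalar -/m mul_scalar_mx.
  by rewrite scalerA mulrC.
have DD : is_derive t 1 (fun s => klein_denom J (sigma s)) (2 * m) by exact: der_klein_denom.
have Df' : is_derive t 1 f 0.
  have D1 := der_mulmx (der_mulmx (der_tr DX) (der_mxcst form_diag t)) DX.
  have D2 := der_scalemx (derV (f := fun s => klein_denom J (sigma s)) (lt0r_neq0 D0) DD)
    (der_mulmx (der_tr Dw) Dw).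
  have D3 := der_addmx D1 (der_scalemx (derC (-1) t) D2).
  apply: der_ext D3 _ _; first by move=> s0; rewrite scaleN1r.
  rewrite -/D mulmx0 addr0 scale0r add0r scaleN1r linearZ /= trmx_mul.
  have -> : D^-1 *: ((w t)^T *m s'^T) *m form_diag *m X t = D^-1 *: ((w t)^T *m v).
    by rewrite -!scalemxAl -(mulmxA _ s'^T) -dual_row_mulmx -mulmxA.
  have -> : (X t)^T *m form_diag *m (D^-1 *: (s' *m w t)) = D^-1 *: (v^T *m w t).
    by rewrite -scalemxAr /v trmx_mul dual_row_tr !mulmxA.
  have -> : (v + (m / D) *: w t)^T = v^T + (m / D) *: (w t)^T.
    by rewrite linearD linearZ.
  rewrite mulmxDl mulmxDr -!scalemxAl -!scalemxAr.
  apply/matrixP => i j; rewrite !mxE; field; exact: lt0r_neq0.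
by have /der_mxP/(_ a b) := Df'; rewrite mxE.
Qed.

Definition SOform : set 'M[R]_n := [set A | A^T *m form_diag *m A = form_diag /\ \det A = 1].

(** In the orthonormal frame, the frame along the loop becomes a path in the
    special orthogonal group.  No homotopy of the loop is needed: the path itself
    connects the holonomy to the identity. *)
Lemma frame_component sigma s X x A : frame sigma s X -> sigma 0 = x -> sigma 1 = x ->
  X 0 = frm x -> X 1 = frm x *m A -> connected_component SOform 1%:M A.
Proof.
move=> fX s0 s1 X0 X1; have Us := frame_dom fX.
have Ux : unit_ball x by rewrite -s0; apply: Us; lra.
pose At t := frmV (sigma t) *m X t.
have frK y : unit_ball y -> frm y *m frmV y = 1%:M.
  by move=> Uy; exact: mulmx1C (klein_frame_invK JJ Uy).
have XE t : 0 <= t <= 1 -> X t = frm (sigma t) *m At t.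
  by move=> t01; rewrite /At mulmxA frK ?mul1mx //; exact: Us.
have det_fr y : unit_ball y -> \det (frm y) * expR (klein_phi J 0) = expR (klein_phi J y).
  move=> Uy; have [sg [Y [fY Y1 Y2 Y3 Y4]]] := piece_frame (radial_piece JJ Uy).
  have := frame_det phi_smooth etaE fY (_ : 0 <= 1 <= 1).
  by rewrite ler01 lexx => /(_ isT); rewrite Y1 Y2 Y3 Y4 det1 mul1r.
exists (At @` `[0, 1]); last first.
  exists 1; first by rewrite /= in_itv /= ler01 lexx.
  by rewrite /At s1 X1 mulmxA klein_frame_invK // mul1mx.
split.
- exists 0; first by rewrite /= in_itv /= ler01 lexx.
  by rewrite /At s0 X0 klein_frame_invK.
- move=> _ [t t01 <-]; have tc : 0 <= t <= 1 by move: t01; rewrite /= in_itv.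
  have Ut := Us t tc; split.
    have H := frame_klein_metric fX tc; rewrite X0 s0 klein_metric_frame // XE // trmx_mul in H.
    by rewrite -[RHS]H -(klein_metric_frame Ut) !mulmxA.
  have e0 y : expR (klein_phi J y) != 0 by rewrite gt_eqF // expR_gt0.
  have := frame_det phi_smooth etaE fX tc.
  rewrite XE // det_mulmx X0 s0 -(det_fr _ Ut) -(det_fr _ Ux).
  have dx0 : \det (frm x) != 0.
    by apply/eqP => H; move: (e0 x); rewrite -det_fr // H mul0r eqxx.
  have dt0 : \det (frm (sigma t)) != 0.
    by apply/eqP => H; move: (e0 (sigma t)); rewrite -det_fr // H mul0r eqxx.
  move=> H; apply: (mulfI (mulf_neq0 (mulf_neq0 dx0 dt0) (e0 0))).
  by rewrite mulr1 -[RHS]mulrA -H; ring.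
apply: connected_continuous_connected; first exact: segment_connected.
apply/subspace_continuousP => t t01.
have Ut : unit_ball (sigma t) by apply: Us; move: t01; rewrite /= in_itv.
apply: cvg_mulmx; last by have /subspace_continuousP := frame_continuous fX; apply.
apply: cvg_klein_frame_inv => //.
by have /subspace_continuousP := frame_base_continuous fX; apply.
Qed.

End KleinUpper.

(** * Sectors realize rotations and boosts *)

Section KleinLower.
Context {R : realType} {n : nat}.
Local Notation E := 'cV[R]_n.
Variable J : 'I_n -> R.
Hypothesis JJ : forall i, J i * J i = 1.
Local Notation drow := (dual_row J).
Local Notation frm := (klein_frame J).
Local Notation frmV := (klein_frame_inv J).
Local Notation rad := (@radius R n).
Local Notation phi_smooth := (klein_phi_smooth JJ).
Local Notation etaE := (klein_etaE JJ).
Local Notation chain := (chain (klein_eta J)).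

Variables i j : 'I_n.
Hypothesis ij : i != j.
Let ji : j != i. Proof. by rewrite eq_sym. Qed.

Let e := J i * J j.
Let e1 : e = 1 \/ e = -1.
Proof.
rewrite /e; have [->|->] := sign_cases JJ i; have [->|->] := sign_cases JJ j;
  rewrite ?mulr1 ?mul1r ?mulrNN ?mulr1; by [left|right].
Qed.

Definition plane_flow t := plane_rot J i j (gcos e t) (gsin e t).
Definition plane_gen : 'M[R]_n := delta_mx j i - e *: delta_mx i j.

Lemma plane_flowD t u : plane_flow (t + u) = plane_flow t *m plane_flow u.
Proof.
rewrite /plane_flow -[plane_rot J i j (gcos e (t + u)) _]mulmx1.
rewrite -[plane_rot J i j (gcos e u) _]mulmx1.
apply/matrixP => a b; rewrite !mul_plane_rotE // gcosD // gsinD // -/e !eqxx (negPf ji).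
by case: (a == i); [ring|case: (a == j) => //; ring].
Qed.

Lemma plane_flow0 : plane_flow 0 = 1%:M.
Proof. by rewrite /plane_flow gcos0 gsin0 /plane_rot subrr mulr0 !scale0r subr0 !addr0. Qed.

Lemma der_plane_flow (k t : R) :
  is_derive t 1 (fun s => plane_flow (k * s)) (k *: (plane_gen *m plane_flow (k * t))).
Proof.
have Dk : is_derive t 1 (fun s : R => k * s) k.
  by apply: der_ext (derM (derC k t) (derI t)) _ _ => //; ring.
have DC := derF (f := fun s : R => k * s) (der_gcos e1 (k * t)) Dk.
have DS := derF (f := fun s : R => k * s) (der_gsin e1 (k * t)) Dk.
apply/der_mxP => a b; rewrite mxE /plane_gen mulmxBl -scalemxAl mxE [X in _ + X]mxE.
rewrite [X in _ - X]mxE !mul_deltaE.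
rewrite /plane_flow -[plane_rot J i j _ _]mulmx1 !mul_plane_rotE // eqxx (negPf ji) eqxx -/e.
have E s : plane_flow (k * s) a b = (plane_flow (k * s) *m 1%:M) a b by rewrite mulmx1.
apply: (@der_ext _ _ (fun s => (plane_flow (k * s) *m 1%:M) a b)); last by [].
  2: by move=> s; rewrite E.
rewrite /plane_flow.
pose f s := if a == i then
    gcos e (k * s) * (1%:M : 'M[R]_n) i b - e * gsin e (k * s) * (1%:M : 'M[R]_n) j b
  else if a == j then
    gsin e (k * s) * (1%:M : 'M[R]_n) i b + gcos e (k * s) * (1%:M : 'M[R]_n) j b
  else (1%:M : 'M[R]_n) a b.
apply: (@der_ext _ _ f); last by [].
  2: by move=> s; rewrite mul_plane_rotE.
rewrite /f; case: (eqVneq a i) => [ai|ai].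
  have aj : (a == j) = false by rewrite ai (negPf ij).
  apply: der_ext (derD (derM DC (derC ((1%:M : 'M[R]_n) i b) t))
    (derN (derM (derM (derC e t) DS) (derC ((1%:M : 'M[R]_n) j b) t)))) _ _ => //.
  by rewrite aj /=; ring.
case: (eqVneq a j) => [_|aj].
  apply: der_ext (derD (derM DS (derC ((1%:M : 'M[R]_n) i b) t))
    (derM DC (derC ((1%:M : 'M[R]_n) j b) t))) _ _ => //.
  by rewrite /=; ring.
by apply: der_ext (derC _ t) _ _ => //=; ring.
Qed.

(** Small enough for the orbit to stay in the ball for times in [-1, 1], since both
    [gcos] and [gsin] are bounded by [expR 1] there. *)
Definition orbit_radius : R := (expR 1 + 1)^-1.
Definition orbit (t : R) : E :=
  orbit_radius *: (gcos e t *: delta_mx i 0 + gsin e t *: delta_mx j 0).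
Definition orbit_speed (t : R) : E :=
  orbit_radius *: (- e * gsin e t *: delta_mx i 0 + gcos e t *: delta_mx j 0).

Lemma orbitE t k : orbit t k 0 = orbit_radius * (gcos e t * (k == i)%:R + gsin e t * (k == j)%:R).
Proof. by rewrite !mxE !eqxx !andbT. Qed.

Lemma orbit_speedE t k :
  orbit_speed t k 0 = orbit_radius * (- e * gsin e t * (k == i)%:R + gcos e t * (k == j)%:R).
Proof. by rewrite !mxE !eqxx !andbT. Qed.

Lemma orbit_radius_gt0 : 0 < orbit_radius.
Proof. by rewrite invr_gt0 addr_gt0 // expR_gt0. Qed.

Lemma orbit_ball t : -1 <= t <= 1 -> unit_ball (orbit t).
Proof.
move=> t1; have [C1 S1] := gcos_gsin_bound e1 t1; have r0 := orbit_radius_gt0.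
have e0 : 0 < expR 1 :> R by exact: expR_gt0.
have bound (c : R) : `|c| <= expR 1 -> `|orbit_radius * c| < 1.
  move=> H; rewrite normrM gtr0_norm // /orbit_radius mulrC ltr_pdivrMr; lra.
apply: unit_ballP => k; rewrite orbitE; case: (eqVneq k i) => [->|ki].
  by rewrite (negPf ij) mulr1 mulr0 addr0; exact: bound.
case: (eqVneq k j) => [_|kj]; first by rewrite mulr0 add0r mulr1; exact: bound.
by rewrite !mulr0 addr0 mulr0 normr0.
Qed.

Lemma der_orbit (k t : R) : is_derive t 1 (fun s => orbit (k * s)) (k *: orbit_speed (k * t)).
Proof.
have Dk : is_derive t 1 (fun s : R => k * s) k.
  by apply: der_ext (derM (derC k t) (derI t)) _ _ => //; ring.
have DC := derF (f := fun s : R => k * s) (der_gcos e1 (k * t)) Dk.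
have DS := derF (f := fun s : R => k * s) (der_gsin e1 (k * t)) Dk.
apply/der_mxP => a b; rewrite ord1 mxE orbit_speedE.
apply: der_ext (derM (derC orbit_radius t) (derD (derM DC (derC (a == i)%:R t))
  (derM DS (derC (a == j)%:R t)))) _ _; first by move=> s; rewrite orbitE.
by ring.
Qed.

Lemma der_orbit_speed (k t : R) :
  is_derive t 1 (fun s => orbit_speed (k * s)) (- (e * k) *: orbit (k * t)).
Proof.
have Dk : is_derive t 1 (fun s : R => k * s) k.
  by apply: der_ext (derM (derC k t) (derI t)) _ _ => //; ring.
have DC := derF (f := fun s : R => k * s) (der_gcos e1 (k * t)) Dk.
have DS := derF (f := fun s : R => k * s) (der_gsin e1 (k * t)) Dk.
apply/der_mxP => a b; rewrite ord1 mxE orbitE.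
apply: der_ext (derM (derC orbit_radius t) (derD (derM (derM (derC (- e) t) DS) (derC (a == i)%:R t))
  (derM DC (derC (a == j)%:R t)))) _ _; first by move=> s; rewrite orbit_speedE.
by ring.
Qed.

Let q := orbit_radius ^+ 2 * J i.

Lemma orbit_quad t : quad J (orbit t) = q.
Proof.
rewrite /quad (bigD1 i) //= (bigD1 j) //= big1 ?addr0 => [|k /andP[ki kj]]; last first.
  by rewrite orbitE (negPf ki) (negPf kj) !mulr0 addr0 mulr0 expr0n mulr0.
rewrite !orbitE !eqxx (negPf ij) (negPf ji) /= /q.
move: (gcos e t) (gsin e t) (gcos2Dgsin2 e1 t) => C S cs.
transitivity (orbit_radius ^+ 2 * J i * (C ^+ 2 + e * S ^+ 2)); last by rewrite cs mulr1.
by rewrite /e; have [->|->] := sign_cases JJ i; have [->|->] := sign_cases JJ j; ring.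
Qed.

Lemma plane_genE k l :
  plane_gen k l = (k == j)%:R * (l == i)%:R - e * ((k == i)%:R * (l == j)%:R).
Proof.
by rewrite /plane_gen !mxE; case: (k == j); case: (l == i); case: (k == i); case: (l == j);
  rewrite /= ?mulr1 ?mulr0 ?mul0r.
Qed.

Lemma orbit_wedge t :
  orbit_speed t *m drow (orbit t) - orbit t *m drow (orbit_speed t) = q *: plane_gen.
Proof.
apply/matrixP => k l.
have outer x y : (x *m drow y) k l = x k 0 * (J l * y l 0) by rewrite mxE big_ord1 mxE.
rewrite [LHS]mxE [X in _ + X]mxE !outer [RHS]mxE plane_genE !(orbitE, orbit_speedE).
have qE : q = orbit_radius ^+ 2 * J i * (gcos e t ^+ 2 + e * gsin e t ^+ 2).
  by rewrite gcos2Dgsin2 // mulr1.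
rewrite qE; move: (gcos e t) (gsin e t) => C S; rewrite /e.
case: (eqVneq l i) => [->|li].
  case: (eqVneq k i) => [_|ki]; rewrite (negPf ij) /=.
    by have [->|->] := sign_cases JJ i; have [->|->] := sign_cases JJ j; ring.
  by case: (k == j) => /=; have [->|->] := sign_cases JJ i; have [->|->] := sign_cases JJ j; ring.
case: (eqVneq l j) => [->|lj] /=; last by ring.
case: (eqVneq k i) => [ki|ki] /=.
  have kj : (k == j) = false by rewrite ki (negPf ij).
  by rewrite kj /=; have [->|->] := sign_cases JJ i; have [->|->] := sign_cases JJ j; ring.
by case: (k == j) => /=; have [->|->] := sign_cases JJ i; have [->|->] := sign_cases JJ j; ring.
Qed.

Lemma dual_row_orbit_gen t : drow (orbit t) *m plane_gen = - drow (orbit_speed t).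
Proof.
apply/rowP => l.
have -> : (- drow (orbit_speed t)) 0 l = - (J l * orbit_speed t l 0) by rewrite !mxE.
rewrite mul_dual_rowE (bigD1 i) //= (bigD1 j) //= big1 => [|k /andP[ki kj]]; last first.
  by rewrite orbitE (negPf ki) (negPf kj) !mulr0 addr0 mulr0 mulr0 mul0r.
rewrite !plane_genE !orbitE orbit_speedE !eqxx (negPf ij) (negPf ji) /e.
case: (eqVneq l i) => [->|li].
  by rewrite (negPf ij) /=; have [->|->] := sign_cases JJ i; have [->|->] := sign_cases JJ j; ring.
case: (eqVneq l j) => [->|lj] /=; last by ring.
by have [->|->] := sign_cases JJ i; have [->|->] := sign_cases JJ j; ring.
Qed.

Let d0 := Num.sqrt (radius_sqr (R := R) (n := n) + q).

Lemma orbit_klein_root t : klein_root J (orbit t) = d0.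
Proof. by rewrite /klein_root /klein_denom orbit_quad. Qed.

(** The speed of rotation; it is nonzero because the radius of the orbit is. *)
Let kappa := 1 - rad / d0.

Let d0_gt0 : 0 < d0.
Proof. by rewrite -(orbit_klein_root 0) klein_root_gt0 //; apply: orbit_ball; lra. Qed.

Let d02 : d0 ^+ 2 = radius_sqr (n := n) + q.
Proof.
rewrite -(orbit_klein_root 0) sqr_klein_root //; first by rewrite /klein_denom orbit_quad.
by apply: orbit_ball; lra.
Qed.

Let q_dd : q = d0 ^+ 2 - rad ^+ 2.
Proof. by rewrite d02 sqr_radius; ring. Qed.

Let q_neq0 : q != 0.
Proof.
rewrite /q mulf_neq0 ?expf_neq0 ?(gt_eqF orbit_radius_gt0) //.
by have [->|->] := sign_cases JJ i; rewrite ?oppr_eq0 oner_eq0.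
Qed.

Let kappa_neq0 : kappa != 0.
Proof.
have a0 := @radius_gt0 R n; apply: contra q_neq0 => /eqP k0.
have : kappa * d0 = d0 - rad by rewrite /kappa mulrBl mul1r divfK // gt_eqF.
by rewrite k0 mul0r => /esym/subr0_eq E; rewrite q_dd E subrr.
Qed.

(** The left side is the derivative of [frm (orbit t) *m plane_flow (kappa * t)]
    divided by [plane_flow (kappa * t)], the right side what the equation of parallel
    fields makes of it.  By [orbit_wedge] the generator is a combination of the two
    rank-one matrices that occur, and the coefficients of both agree. *)
Lemma orbit_frame t : let c := (rad * (rad + d0))^-1 in
  c *: (orbit_speed t *m drow (orbit t) + orbit t *m drow (orbit_speed t)) +
  kappa *: (frm (orbit t) *m plane_gen) =
  (d0 / rad / d0 ^+ 2) *: (orbit_speed t *m drow (orbit t)).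
Proof.
move=> c; have a0 := @radius_gt0 R n.
have plane_genE' : plane_gen = q^-1 *: (orbit_speed t *m drow (orbit t) - orbit t *m drow (orbit_speed t)).
  by rewrite orbit_wedge scalerA mulVf // scale1r.
have -> : frm (orbit t) *m plane_gen = plane_gen - c *: (orbit t *m drow (orbit_speed t)).
  rewrite /klein_frame mulmxDl mul1mx -scalemxAl -mulmxA dual_row_orbit_gen mulmxN scalerN.
  by rewrite /klein_frame_coef orbit_klein_root.
rewrite {1}plane_genE'; move: (orbit_speed t *m _) (orbit t *m _) => M N.
apply/matrixP => k l; rewrite !mxE /c /kappa q_dd.
have dq : d0 ^+ 2 - rad ^+ 2 != 0 by rewrite -q_dd.
have dma : d0 - rad != 0 by apply: contra dq => /eqP H; rewrite subr_sqr H mul0r.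
by rewrite subr_sqr; field; rewrite dma !gt_eqF // addr_gt0.
Qed.

(** Parallel translation along the orbit, read in the orthonormal frame, is the
    rotation [plane_flow] run at speed [kappa]. *)
Lemma orbit_piece (s : R) : -1 <= s <= 1 ->
  piece (klein_eta J) (orbit 0) (orbit s)
    (frm (orbit s) *m plane_flow (kappa * s) *m frmV (orbit 0)).
Proof.
move=> s1; have a0 := @radius_gt0 R n.
exists (fun t => orbit (s * t)).
exists (fun t => frm (orbit (s * t)) *m plane_flow ((kappa * s) * t) *m frmV (orbit 0)).
have d1 (t : R) : derive1 (fun t => orbit (s * t)) t = s *: orbit_speed (s * t).
  by rewrite derive1E; have [_ ->] := der_orbit s t.
have Us t : 0 <= t <= 1 -> unit_ball (orbit (s * t)).
  by move=> t01; apply: orbit_ball; nra.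
split; split.
- exact: Us.
- by move=> t; have [] := der_orbit s t.
- move=> t; rewrite /continuous_at d1; under eq_cvg do rewrite d1.
  apply: cvgZ; first exact: cvg_cst.
  have [+ _] := der_orbit_speed s t.
  by move=> /derivable1_diffP/differentiable_continuous.
- move=> t t01; rewrite d1.
  have Ut := Us t t01.
  have Djr : is_derive t 1 (fun t => drow (orbit (s * t))) (s *: drow (orbit_speed (s * t))).
    apply: der_ext (der_mulmx (der_tr (der_orbit s t)) (der_mxcst (form_diag J) t)) _ _.
      by move=> s0; rewrite dual_row_mulmx.
    by rewrite mulmx0 addr0 dual_row_mulmx linearZ /= scalemxAl.
  pose c := (rad * (rad + d0))^-1.
  have Dfr : is_derive t 1 (fun t => frm (orbit (s * t)))
      (s *: (c *: (orbit_speed (s * t) *m drow (orbit (s * t))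
                   + orbit (s * t) *m drow (orbit_speed (s * t))))).
    apply: der_ext (der_addmx (der_mxcst 1%:M t) (der_scalemx (derC c t)
      (der_mulmx (der_orbit s t) Djr))) _ _.
      by move=> u; rewrite /klein_frame /klein_frame_coef orbit_klein_root.
    rewrite add0r scale0r add0r -scalemxAl -scalemxAr -scalerDr.
    by rewrite scalerA mulrC -scalerA.
  apply: der_ext (der_mulmx (der_mulmx Dfr (der_plane_flow (kappa * s) t))
    (der_mxcst (frmV (orbit 0)) t)) _ _ => //.
  have eta_fr : klein_eta J (orbit (s * t)) *m frm (orbit (s * t)) =
      (d0 / rad / d0 ^+ 2) *: drow (orbit (s * t)).
    rewrite /klein_eta -scalemxAl dual_row_klein_frame // orbit_klein_root scalerA.
    by rewrite -(sqr_klein_root JJ Ut) orbit_klein_root mulrC.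
  have oF := orbit_frame (s * t); rewrite -/c in oF.
  rewrite mulmx0 addr0 -[frm _ *m plane_flow (kappa * s * t) *m _]mulmxA
    [klein_eta _ _ *m _]mulmxA eta_fr.
  transitivity (s *: ((c *: (orbit_speed (s * t) *m drow (orbit (s * t))
     + orbit (s * t) *m drow (orbit_speed (s * t))) + kappa *: (frm (orbit (s * t)) *m plane_gen))
     *m (plane_flow (kappa * s * t) *m frmV (orbit 0)))).
    rewrite [RHS]scalemxAl [in RHS]mulmxA; congr (_ *m _).
    rewrite [s *: (_ + kappa *: _)]scalerDr [in RHS]mulmxDl; congr (_ + _).
    by rewrite scalerA -!scalemxAl -scalemxAr mulmxA mulrC.
  by rewrite oF -!scalemxAl -!scalemxAr !mulmxA ; congr (_ *: _); rewrite !scalerA mulrC.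
- by rewrite mulr0.
- by rewrite mulr1.
- by rewrite !mulr0 plane_flow0 mulmx1; apply: mulmx1C; apply: klein_frame_invK => //;
  apply: orbit_ball; lra.
- by rewrite !mulr1.
Qed.

(** The frames at the two ends of the orbit are cancelled by the two radii. *)
Lemma sector_chain (s : R) : -1 <= s <= 1 -> chain 0 0 (plane_flow (kappa * s)).
Proof.
move=> s1; have U0 : unit_ball (orbit 0) by apply: orbit_ball; lra.
have Us : unit_ball (orbit s) by exact: orbit_ball.
have p1 := radial_piece JJ U0; have p2 := orbit_piece s1.
have p3 := radial_piece JJ Us; have u3 := piece_unit phi_smooth etaE p3.
have := chain_cons p1 (chain_cons p2 (piece_chain (piece_rev phi_smooth etaE p3))).
by rewrite -!mulmxA klein_frame_invK // mulmx1 mulmxA mulVmx // mul1mx.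
Qed.

Lemma plane_flow_chain (t : R) : chain 0 0 (plane_flow t).
Proof.
have U0 : unit_ball (0 : E) by rewrite /unit_ball /= normr0.
have k0 : 0 < `|kappa| by rewrite normr_gt0.
apply: (one_parameter_subgroup k0).
- exact: chain_nil.
- by move=> A B cA cB; exact: chain_cat cB cA.
- exact: plane_flowD.
- exact: plane_flow0.
- move=> u u01; have -> : u = kappa * (u / kappa) by rewrite mulrC divfK.
  apply: sector_chain; rewrite -ler_norml normrM normfV ler_pdivrMr //.
  by rewrite mul1r ger0_norm; lra.
move=> u cu; have uu := chain_unit phi_smooth etaE cu.
have := chain_rev phi_smooth etaE cu.
suff -> : invmx (plane_flow u) = plane_flow (- u) by [].
by apply: (can_inj (mulKmx uu)); rewrite mulmxV // -plane_flowD subrr plane_flow0.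
Qed.

Lemma plane_rot_chain c s : rot_param J i j c s -> (J i != J j -> 0 < c) ->
  chain 0 0 (plane_rot J i j c s).
Proof.
move=> cs c0; have [|t [<- <-]] := gcos_gsin_onto e1 cs; last exact: plane_flow_chain.
by move=> ne; apply: c0; apply: contra ne => /eqP E; rewrite /e E JJ.
Qed.

End KleinLower.

(** * A density with holonomy SO+(p, q) *)

Section PseudoOrthogonal.
Context {R : realType} {p q : nat}.
Local Notation E := 'cV[R]_(p + q).

Definition sign_pq (i : 'I_(p + q)) : R := if fintype.split i is inl _ then 1 else -1.

Lemma sign_pq_sqr i : sign_pq i * sign_pq i = 1.
Proof. by rewrite /sign_pq; case: fintype.split => _; rewrite ?mulrNN mulr1. Qed.

Lemma sign_pq_lshift k : sign_pq (lshift q k) = 1.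
Proof. by rewrite /sign_pq -[lshift q k]/(unsplit (inl k)) unsplitK. Qed.

Lemma sign_pq_rshift k : sign_pq (rshift p k) = -1.
Proof. by rewrite /sign_pq -[rshift p k]/(unsplit (inr k)) unsplitK. Qed.

Lemma form_mxE : form_mx R p q = form_diag sign_pq.
Proof.
apply/matrixP => i k; rewrite -[i]splitK -[k]splitK /form_mx /form_diag.
case: (fintype.split i) => a; case: (fintype.split k) => b /=.
- rewrite block_mxEul !mxE sign_pq_lshift eq_lshift; by [].
- by rewrite block_mxEur !mxE eq_lrshift.
- by rewrite block_mxEdl !mxE eq_rlshift.
by rewrite block_mxEdr !mxE sign_pq_rshift eq_rshift mulNrn.
Qed.

Lemma SO_form : SO R p q = SOform sign_pq.
Proof. by rewrite /SO /SOform form_mxE. Qed.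

(** On a vector killed by the upper left block the form would be both positive
    and non-positive. *)
Lemma SO_ulsubmx A : SO R p q A -> \det (ulsubmx A) != 0.
Proof.
move=> [AF _]; apply/negP => /eqP d0.
have : \det (ulsubmx A)^T == 0 by rewrite det_tr d0.
move/det0P => [v v0 va].
have ul : (ulsubmx A)^T *m ulsubmx A - (dlsubmx A)^T *m dlsubmx A = 1%:M.
  move: AF; rewrite -{1 2}[A]submxK /form_mx tr_block_mx !mulmx_block.
  move=> /(congr1 (@ulsubmx _ p q p q)); rewrite !block_mxKul.
  by rewrite !mulmx1 !mulmx0 addr0 add0r mulmxN mulmx1 mulNmx.
pose w := v *m (dlsubmx A)^T.
have wE : dlsubmx A *m v^T = w^T by rewrite /w trmx_mul trmxK.
have Ew : - (w *m w^T) = v *m v^T.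
  transitivity (v *m 1%:M *m v^T); last by rewrite mulmx1.
  rewrite -ul mulmxBr mulmxBl !mulmxA va !mul0mx sub0r.
  by rewrite -/w -wE mulmxA.
have sq m (u : 'rV[R]_m) : (u *m u^T) 0 0 = \sum_i u 0 i ^+ 2.
  by rewrite mxE; apply: eq_bigr => i _; rewrite mxE expr2.
have Ev : - \sum_i w 0 i ^+ 2 = \sum_i v 0 i ^+ 2.
  by have := congr1 (fun M : 'M[R]_1 => M 0 0) Ew; rewrite [LHS]mxE !sq.
have s0 m (u : 'rV[R]_m) : 0 <= \sum_i u 0 i ^+ 2.
  by apply: sumr_ge0 => i _; exact: sqr_ge0.
have v2 : \sum_i v 0 i ^+ 2 = 0.
  by apply/le_anti; rewrite s0 andbT -Ev oppr_le0 s0.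
move: v0; apply/negP; rewrite negbK; apply/eqP/rowP => k; rewrite mxE.
have /eqP := v2; rewrite psumr_eq0 => [/allP/(_ k)|i _]; last exact: sqr_ge0.
by rewrite mem_index_enum sqrf_eq0 => /(_ isT) /eqP.
Qed.

(** The determinant of the upper left block is 1 at the identity and cannot vanish on
    a connected set. *)
Lemma SOplus_ulsubmx A : SOplus R p q A -> 0 < \det (ulsubmx A).
Proof.
move=> pA; rewrite ltNge; apply/negP => A0.
pose f (A : 'M[R]_(p + q)) := \det (ulsubmx A).
have cf : continuous f.
  move=> M; apply: (@cvg_det R _ (nbhs M) _ _ (fun A => ulsubmx A) (ulsubmx M)).
  apply: (@cvg_mx R _ (nbhs M) _ _ _ (fun A => ulsubmx A)) => i k; rewrite !mxE.
  under eq_cvg do rewrite !mxE.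
  exact: (@coord_continuous R _ _ (lshift q i) (lshift q k) M).
have := connected_continuous_connected (@component_connected _ (SO R p q) 1%:M)
  (continuous_subspaceT cf).
move=> /connected_intervalP/(_ (f A) 1) itv.
have [||| M pM M0] := itv _ _ 0.
- by exists A.
- exists 1%:M; last by rewrite /f scalar_mx_block block_mxKul det1.
  apply: connected_component_refl; split; last exact: det1.
  by rewrite trmx1 mul1mx mulmx1.
- by rewrite A0 ler01.
by have := SO_ulsubmx (connected_component_sub pM); rewrite -/(f M) M0 eqxx.
Qed.

Local Notation eta := (klein_eta sign_pq).
Local Notation phi_smooth := (klein_phi_smooth sign_pq_sqr).
Local Notation etaE := (klein_etaE sign_pq_sqr).

Lemma chain_SOplus A : chain eta 0 0 A -> SOplus R p q A.
Proof.
move=> /chain_frame[sigma [s [X [fX _ [s0 s1 X0 X1]]]]].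
rewrite /SOplus SO_form; apply: (frame_component sign_pq_sqr fX s0 s1);
  rewrite klein_frame0 ?mul1mx //.
Qed.

(** Write [A] as a product of plane rotations and of a diagonal matrix of signs.  The
    rotations are in SO+ as holonomies, so the upper left block of the sign matrix
    has positive determinant; hence both blocks have determinant 1. *)
Lemma SOplus_chain A : SOplus R p q A -> chain eta 0 0 A.
Proof.
move=> pA; have U0 : unit_ball (0 : E) by rewrite /unit_ball /= normr0.
have H1 : chain eta 0 0 1%:M by exact: chain_nil.
have HM B C : chain eta 0 0 B -> chain eta 0 0 C -> chain eta 0 0 (B *m C).
  by move=> cB cC; exact: chain_cat cC cB.
have HR i j c s (ij : i != j) := @plane_rot_chain R _ sign_pq sign_pq_sqr i j ij c s.
have := connected_component_sub pA; rewrite SO_form => -[AF dA].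
have oA : orthogonal_form sign_pq A.
  move=> a b; have /matrixP/(_ a b) := AF; rewrite !mxE => E.
  transitivity (sign_pq a *+ (a == b)); last by rewrite mulr_natl.
  rewrite -E; apply: eq_bigr => i _; rewrite mul_mx_diag !mxE; ring.
have [g [d [cg d1 E]]] := orthogonal_form_generated sign_pq_sqr H1 HM HR oA.
rewrite E; apply: (HM _ _ cg); apply: (diag_signs_generated H1 HM HR d1).
have pg := chain_SOplus cg.
have dg : \det g = 1 by have [] := connected_component_sub pg.
have prod_d : \prod_i d 0 i = 1 by rewrite -det_diag -[LHS]mul1r -{1}dg -det_mulmx -E.
rewrite big_split_ord /= in prod_d.
have ul : \det (ulsubmx A) = \det (ulsubmx g) * \prod_(i < p) d 0 (lshift q i).
  have -> : ulsubmx A = ulsubmx g *m diag_mx (\row_i d 0 (lshift q i)).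
    apply/matrixP => a b; by rewrite E !mul_mx_diag !mxE.
  by rewrite det_mulmx det_diag; congr (_ * _); apply: eq_bigr => i _; rewrite mxE.
have lp : \prod_(i < p) d 0 (lshift q i) = 1.
  have pos : 0 < \prod_(i < p) d 0 (lshift q i).
    by have := SOplus_ulsubmx pA; rewrite ul pmulr_rgt0 // SOplus_ulsubmx.
  have /eqP : (\prod_(i < p) d 0 (lshift q i)) ^+ 2 = 1.
    by rewrite -prodrXl big1.
  by rewrite sqrf_eq1 => /orP[/eqP //|/eqP e]; move: pos; rewrite e oppr_gt0 ltNge ler01.
have rp : \prod_(i < q) d 0 (rshift p i) = 1 by rewrite lp mul1r in prod_d.
move=> x; rewrite big_split_ord /=.
have L : \prod_(i < p | sign_pq (lshift q i) == x) d 0 (lshift q i) = 1.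
  under eq_bigl do rewrite sign_pq_lshift.
  by case: (1 == x); [exact: lp|rewrite big_pred0_eq].
have L' : \prod_(i < q | sign_pq (rshift p i) == x) d 0 (rshift p i) = 1.
  under eq_bigl do rewrite sign_pq_rshift.
  by case: (-1 == x); [exact: rp|rewrite big_pred0_eq].
by rewrite L L' mulr1.
Qed.

Theorem flat_ball_holonomy_SO : holonomy_is (flat_ball phi_smooth) (SOplus R p q).
Proof.
move=> x; have Ux := to_ballP (x : E).
have cx := piece_chain (radial_piece sign_pq_sqr Ux).
have ux := chain_unit phi_smooth etaE cx.
exists tt, (klein_frame sign_pq (to_ball x)); split; [by []|exact: ux|].
apply/seteqP; split=> A.
  move=> /(holonomy_frame etaE)[sigma [s [X [fX s0 s1 X0 X1]]]].
  rewrite /SOplus SO_form.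
  exact: (frame_component sign_pq_sqr fX s0 s1 X0 X1).
move=> /SOplus_chain cA.
by apply: (chain_holonomy etaE) cA; exact: cx.
Qed.

End PseudoOrthogonal.

Theorem theorem1p3 (R : realType) :
  (forall n : nat, (1 <= n)%N ->
     exists M : density_manifold R n, holonomy_is M (SL R n)) /\
  (forall p q : nat, (1 <= p + q)%N ->
     exists M : density_manifold R (p + q), holonomy_is M (SOplus R p q)).
Proof.
split=> [n _|p q _]; eexists; first exact: flat_ball_holonomy_SL.
exact: flat_ball_holonomy_SO.
Qed.
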